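(* $\mathrm{MC}(\cup,\cap,+,\times,/)\in\mathrm{NEXP}$.
   Context: Natural numbers include $0$. For $A,B\subseteq\mathbb N$: $A\cup B$, $A\cap B$ are the usual operations, $\overline{A}=\mathbb N\setminus A$, $A+B=\{a+b: a\in A, b\in B\}$, $A\times B=\{a\cdot b: a\in A, b\in B\}$, and $A/B=\{c\in\mathbb N:\exists a\in A\ \exists b\in B\setminus\{0\}: a=c\cdot b\}$ (exact integer division without remainder or rounding). For $\emptyset\ne\mathcal O\subseteq\{\cup,\cap,\overline{\phantom{c}},+,\times,/\}$, an $\mathcal O$-circuit $C=(V,E,g_C,\alpha)$ is a finite acyclic directed multigraph with gate set $V\subseteq\mathbb N$, every gate having indegree $0$, $1$ or $2$, a designated output gate $g_C\in V$, and a labeling $\alpha$: gates of indegree $0$ (input gates) are labeled by natural numbers, gates of indegree $1$ are labeled $\overline{\phantom{c}}$ (allowed only if $\overline{\phantom{c}}\in\mathcal O$), and gates of indegree $2$ are labeled by an operation in $\mathcal O\setminus\{\overline{\phantom{c}}\}$. The result set $I(g)\subseteq\mathbb N$ is defined inductively: $I(g)=\{\alpha(g)\}$ for an input gate; $I(g)=\mathbb N\setminus I(p)$ for a complement gate with predecessor $p$; $I(g)=I(g_1)\,\sigma\,I(g_2)$ for a gate labeled $\sigma$ with predecessors $g_1\le g_2$ (a double edge from one gate gives $g_1=g_2$). $I(C)=I(g_C)$. A circuit is encoded as a bit string listing its gates in reverse topological order, each gate as the triple (gate name, label, list of predecessors), with all numbers (including input labels) in binary; $|C|$ denotes the length of this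 encoding. The membership problem is $\mathrm{MC}(\mathcal O)=\{(C,b): C \text{ is an } \mathcal O\text{-circuit},\ b\in\mathbb N,\ b\in I(C)\}$, with $b$ given in binary; $\mathrm{MC}(\sigma_1,\dots,\sigma_n)$ abbreviates $\mathrm{MC}(\{\sigma_1,\dots,\sigma_n\})$. *)

(* Defs.v *)
From mathcomp Require Import all_boot.
Set Implicit Arguments. Unset Strict Implicit. Unset Printing Implicit Defensive.

Inductive op := OCup | OCap | OCompl | OPlus | OTimes | ODiv.

Inductive label :=
| LIn of nat | LCompl | LCup | LCap | LPlus | LTimes | LDiv.

Definition gate := (nat * label * seq nat)%type.
Definition gname (g : gate) : nat := g.1.1.
Definition glabel (g : gate) : label := g.1.2.
Definition gpreds (g : gate) : seq nat := g.2.

(* A circuit: (output gate name, list of gates in reverse topological order,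
   i.e. every predecessor of a gate is listed after that gate). *)
Definition circuit := (nat * seq gate)%type.

Definition setU (A B : nat -> Prop) : nat -> Prop := fun c => A c \/ B c.
Definition setI (A B : nat -> Prop) : nat -> Prop := fun c => A c /\ B c.
Definition setC (A : nat -> Prop) : nat -> Prop := fun c => ~ A c.
Definition setPlus (A B : nat -> Prop) : nat -> Prop :=
  fun c => exists a b, A a /\ B b /\ c = a + b.
Definition setTimes (A B : nat -> Prop) : nat -> Prop :=
  fun c => exists a b, A a /\ B b /\ c = a * b.
Definition setDiv (A B : nat -> Prop) : nat -> Prop :=
  fun c => exists a b, A a /\ B b /\ b <> 0 /\ a = c * b.

Definition binsem (l : label) : option ((nat -> Prop) -> (nat -> Prop) -> nat -> Prop) :=
  match l with
  | LCup => Some setU | LCap => Some setI | LPlus => Some setPlus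
  | LTimes => Some setTimes | LDiv => Some setDiv
  | _ => None
  end.

(* Result set I(x) of the gate named x, for a gate list in reverse
   topological order.  For a binary gate with predecessors g1 <= g2
   (as gate names), I(g) = I(g1) op I(g2). *)
Fixpoint sem (gs : seq gate) (x : nat) : nat -> Prop :=
  match gs with
  | [::] => fun _ => False
  | g :: rest =>
      if gname g == x then
        match glabel g, gpreds g with
        | LIn a, _ => fun c => c = a
        | LCompl, [:: p] => setC (sem rest p)
        | l, [:: p; q] =>
            match binsem l with
            | Some f => f (sem rest (minn p q)) (sem rest (maxn p q))
            | None => fun _ => False
            end
        | _, _ => fun _ => False
        end
      else sem rest x
  end.

Definition label_ok (O : op -> bool) (l : label) (ps : seq nat) : bool :=
  match l with
  | LIn _ => size ps == 0
  | LCompl => O OCompl && (size ps == 1)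
  | LCup => O OCup && (size ps == 2)
  | LCap => O OCap && (size ps == 2)
  | LPlus => O OPlus && (size ps == 2)
  | LTimes => O OTimes && (size ps == 2)
  | LDiv => O ODiv && (size ps == 2)
  end.

Fixpoint wf_gates (O : op -> bool) (gs : seq gate) : bool :=
  match gs with
  | [::] => true
  | g :: rest =>
      [&& label_ok O (glabel g) (gpreds g),
          all (fun p => p \in map gname rest) (gpreds g),
          gname g \notin map gname rest &
          wf_gates O rest]
  end.

Definition is_circuit (O : op -> bool) (C : circuit) : bool :=
  wf_gates O C.2 && (C.1 \in map gname C.2).

Definition circuit_sem (C : circuit) : nat -> Prop := sem C.2 C.1.

Inductive token :=
| T0 | T1 | TSep | TOpen | TClose | TEnd
| TIn | TCompl | TCup | TCap | TPlus | TTimes | TDiv.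

Fixpoint bin_aux (fuel n : nat) : seq bool :=
  match fuel with
  | 0 => [::]
  | f.+1 => if n is 0 then [::] else rcons (bin_aux f n./2) (odd n)
  end.
Definition bin (n : nat) : seq bool := if n is 0 then [:: false] else bin_aux n n.
Definition binT (n : nat) : seq token := map (fun b : bool => if b then T1 else T0) (bin n).

Definition enc_label (l : label) : seq token :=
  match l with
  | LIn a => TIn :: binT a
  | LCompl => [:: TCompl] | LCup => [:: TCup] | LCap => [:: TCap]
  | LPlus => [:: TPlus] | LTimes => [:: TTimes] | LDiv => [:: TDiv]
  end.

Definition enc_gate (g : gate) : seq token :=
  [:: TOpen] ++ binT (gname g) ++ [:: TSep] ++ enc_label (glabel g) ++ [:: TSep]
  ++ flatten (map (fun p => binT p ++ [:: TSep]) (gpreds g)) ++ [:: TClose].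

Definition enc_circuit (C : circuit) : seq token :=
  binT C.1 ++ [:: TSep] ++ flatten (map enc_gate C.2).

Definition enc_instance (C : circuit) (b : nat) : seq token :=
  enc_circuit C ++ [:: TEnd] ++ binT b.

Definition token_bits (t : token) : seq bool :=
  match t with
  | T0 => [:: false; false; false; false]
  | T1 => [:: false; false; false; true]
  | TSep => [:: false; false; true; false]
  | TOpen => [:: false; false; true; true]
  | TClose => [:: false; true; false; false]
  | TEnd => [:: false; true; false; true]
  | TIn => [:: false; true; true; false]
  | TCompl => [:: false; true; true; true]
  | TCup => [:: true; false; false; false]
  | TCap => [:: true; false; false; true]
  | TPlus => [:: true; false; true; false]
  | TTimes => [:: true; false; true; true]
  | TDiv => [:: true; true; false; false]
  end.

Definition to_bits (ts : seq token) : seq bool := flatten (map token_bits ts).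

Definition MC (O : op -> bool) (w : seq bool) : Prop :=
  exists (C : circuit) (b : nat),
    w = to_bits (enc_instance C b) /\ is_circuit O C /\ circuit_sem C b.

Definition O_cup_cap_plus_times_div (o : op) : bool :=
  match o with OCompl => false | _ => true end.

(* Single-tape NTM.  States and tape symbols are natural numbers; the start
   state is 0, the accepting state is 1, the blank symbol is 0, and input
   bits false/true are written as symbols 1/2.  A rule
   (q, a, q', a', right) means: in state q reading a, go to state q',
   write a', move right if right = true, else left.  The machine is the
   finite list of its rules. *)
Definition rule := (nat * nat * nat * nat * bool)%type.
Definition NTM := seq rule.

(* configuration: (state, left part of tape reversed, tape from head on) *)
Definition config := (nat * seq nat * seq nat)%type.

Definition init_config (w : seq bool) : config :=
  (0, [::], map (fun b : bool => if b then 2 else 1) w).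

Definition read (c : config) : nat := head 0 c.2.

Definition apply_rule (r : rule) (c : config) : config :=
  let: (_, _, q', a', mv) := r in
  let: (_, lt, rt) := c in
  if mv then (q', a' :: lt, behead rt)
  else match lt with
       | [::] => (q', [::], 0 :: a' :: behead rt)
       | x :: l => (q', l, x :: a' :: behead rt)
       end.

Definition step (M : NTM) (c c' : config) : bool :=
  has (fun r : rule =>
         [&& r.1.1.1.1 == c.1.1, r.1.1.1.2 == read c & c' == apply_rule r c]) M.

Definition accepts_within (M : NTM) (w : seq bool) (t : nat) : Prop :=
  exists cs : seq config,
    [&& size cs <= t, path (step M) (init_config w) cs &
        (last (init_config w) cs).1.1 == 1].

(* NEXP = union over k of NTIME(2^(n^k)) (here with the harmless
   normalisation 2^((n+1)^k)). *)
Definition in_NEXP (L : seq bool -> Prop) : Prop :=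
  exists (M : NTM) (k : nat),
    forall w : seq bool, L w <-> accepts_within M w (2 ^ ((size w).+1 ^ k)).

(* Main.v *)
Require Import Defs.
From HB Require Import structures.
From mathcomp Require Import all_boot.
From mathcomp Require Import zify.
From Stdlib Require Import FunctionalExtensionality.
Set Implicit Arguments. Unset Strict Implicit. Unset Printing Implicit Defensive.

(* A regular expression over stack operations (push, pop, test for emptiness)
   is run by a one-tape machine that keeps the stacks on parallel tracks, lets
   its head wander nondeterministically between two operations, and has as
   states the lists of expressions still to be run.

   Without complement every result set is finite: for an encoding of length [n]
   all values are below [2 ^ (n * 2 ^ n)].  Hence [b \in I(C)] is witnessed by
   a proof tree with exponentially many nodes, labelled with numbers of
   exponentially many bits.  The tree is guessed level by level while the
   gates are read from the output towards the inputs.  A list of goals of the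
   form "[v] belongs to [I(x)]" is maintained; a gate named [x] replaces
   each goal about [x] by at most two guessed goals about its predecessors, so
   every gate at most doubles the list, up to a constant.  Two further kinds of
   goals, "a gate named [x] follows" and "no gate named [x] follows", take care
   of well-formedness.  The arithmetic relations are checked on binary numbers
   by nondeterministic addition with carry and by Horner's scheme. *)

(** * Regular programs over stacks *)

(** The two directions of the simulation are deliberately uneven. An accepting run of any length
    yields some [N] with [wp N], and membership follows from it without looking at [N]; only
    completeness has to exhibit a concrete [N]. That single number bounds every star at once: the
    digits of a guessed value, the goals in the list, the rounds of an addition or multiplication,
    the gates read. Since the program text is fixed, a run consists of polynomially many stack
    actions in [N], and one action costs a number of machine steps linear in the stack height. Thus
    [N] may be exponential in the input length [n]: values have up to [n * 2 ^ n] bits, and doubling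
    the goals at each of at most [n] gates costs a factor [2 ^ n]. The value [b] stands at the end
    of the input although the first gate already has to produce it. It is therefore guessed at the
    start and compared with the input at the end. In the same way, nothing is known about the
    predecessors of a gate while it is read, so every claim about them has to be stored as a
    goal. *)

Definition token_code (t : token) : bool * bool * bool * bool :=
  if token_bits t is [:: a; b; c; d] then (a, b, c, d)
  else (true, true, true, true).
Definition token_decode (x : bool * bool * bool * bool) : token :=
  match x with
  | (false, false, false, false) => T0
  | (false, false, false, true) => T1
  | (false, false, true, false) => TSep
  | (false, false, true, true) => TOpen
  | (false, true, false, false) => TClose
  | (false, true, false, true) => TEnd
  | (false, true, true, false) => TIn
  | (false, true, true, true) => TCompl
  | (true, false, false, false) => TCup
  | (true, false, false, true) => TCap
  | (true, false, true, false) => TPlus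
  | (true, false, true, true) => TTimes
  | _ => TDiv
  end.
Lemma token_codeK : cancel token_code token_decode. Proof. by case. Qed.
(** The rules of the machine are listed by enumerating all cell contents, so tokens have to form a
    finite type. *)
HB.instance Definition _ := Finite.copy token (can_type token_codeK).

Inductive act :=
| Eps | Push of nat & token | Pop of nat & token | Empty of nat.

Definition act_code (a : act) : unit + (nat * token) + (nat * token + nat) :=
  match a with
  | Eps => inl (inl tt)
  | Push i t => inl (inr (i, t))
  | Pop i t => inr (inl (i, t))
  | Empty i => inr (inr i)
  end.
Definition act_decode (x : unit + (nat * token) + (nat * token + nat)) : act :=
  match x with
  | inl (inl _) => Eps
  | inl (inr (i, t)) => Push i t
  | inr (inl (i, t)) => Pop i t
  | inr (inr i) => Empty i
  end.
Lemma act_codeK : cancel act_code act_decode. Proof. by case. Qed.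
HB.instance Definition _ := Countable.copy act (can_type act_codeK).

Inductive prog :=
| Act of act | Seq of prog & prog | Alt of prog & prog | Star of prog.

(** States of the machine are natural numbers; countability provides [pickle], which numbers the
    lists of programs. *)
Fixpoint prog_code (p : prog) : GenTree.tree act :=
  match p with
  | Act a => GenTree.Leaf a
  | Seq p q => GenTree.Node 0 [:: prog_code p; prog_code q]
  | Alt p q => GenTree.Node 1 [:: prog_code p; prog_code q]
  | Star p => GenTree.Node 2 [:: prog_code p]
  end.
Fixpoint prog_decode (t : GenTree.tree act) : prog :=
  match t with
  | GenTree.Leaf a => Act a
  | GenTree.Node 0 [:: x; y] => Seq (prog_decode x) (prog_decode y)
  | GenTree.Node _ [:: x; y] => Alt (prog_decode x) (prog_decode y)
  | GenTree.Node _ [:: x] => Star (prog_decode x)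
  | _ => Act Eps
  end.
Lemma prog_codeK : cancel prog_code prog_decode.
Proof. by elim=> //= [p -> q ->|p -> q ->|p ->]. Qed.
HB.instance Definition _ := Countable.copy prog (can_type prog_codeK).

Definition stacks := nat -> seq token.
Definition upd (S : stacks) (i : nat) (x : seq token) : stacks :=
  fun j => if j == i then x else S j.

Definition astep (a : act) (S S' : stacks) : Prop :=
  match a with
  | Eps => S' = S
  | Push i t => S' = upd S i (t :: S i)
  | Pop i t => exists2 r, S i = t :: r & S' = upd S i r
  | Empty i => S i = [::] /\ S' = S
  end.

(* Angelic weakest precondition: some run from [S] in which every star makes
   at most [N] iterations ends in [Q].  Bounding the iterations bounds the
   length of the run by a function of [N] and of the program text only. *)
Fixpoint wp (N : nat) (p : prog) (Q : stacks -> Prop) (S : stacks) : Prop :=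
  match p with
  | Act a => exists2 S', astep a S S' & Q S'
  | Seq p q => wp N p (wp N q Q) S
  | Alt p q => wp N p Q S \/ wp N q Q S
  | Star p => exists2 n, n <= N & iter n (wp N p) Q S
  end.

Lemma iter_mono (f g : (stacks -> Prop) -> stacks -> Prop) n Q Q' S :
  (forall Q Q' S, (forall S, Q S -> Q' S) -> f Q S -> g Q' S) ->
  (forall S, Q S -> Q' S) -> iter n f Q S -> iter n g Q' S.
Proof.
move=> fg QQ'; elim: n S => [|n IH] S; first exact: QQ'.
by rewrite !iterS; apply: fg.
Qed.

Lemma wp_mono N N' p Q Q' S :
  N <= N' -> (forall S, Q S -> Q' S) -> wp N p Q S -> wp N' p Q' S.
Proof.
move=> leN; elim: p Q Q' S => [a|p IHp q IHq|p IHp q IHq|p IHp] Q Q' S QQ' /=.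
- by case=> S' aS /QQ'; exists S'.
- by apply: IHp => S1; apply: IHq.
- by case=> [/(IHp _ _ _ QQ')|/(IHq _ _ _ QQ')]; [left|right].
- case=> n len H; exists n; first exact: leq_trans leN.
  by apply: iter_mono H.
Qed.

Fixpoint wpk (N : nat) (k : seq prog) (S : stacks) : Prop :=
  if k is p :: k' then wp N p (wpk N k') S else True.

Lemma wpk_mono N N' k S : N <= N' -> wpk N k S -> wpk N' k S.
Proof.
by move=> leN; elim: k S => //= p k IH S; apply: wp_mono.
Qed.

(** Control flow is unfolded by steps with the silent action [Eps], so that every transition carries
    exactly one stack action. *)
Definition trans (k : seq prog) : seq (act * seq prog) :=
  match k with
  | [::] => [::]
  | Act a :: k => [:: (a, k)]
  | Seq p q :: k => [:: (Eps, p :: q :: k)]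
  | Alt p q :: k => [:: (Eps, p :: k); (Eps, q :: k)]
  | Star p :: k => [:: (Eps, k); (Eps, p :: Star p :: k)]
  end.

(** An angelic run ends in one definite store. Fixing that store lets an existential inside the
    postcondition, such as the iteration count of a later star, be opened outside of [wp]. *)
Lemma wp_point N p Q S : wp N p Q S -> exists2 S', Q S' & wp N p (eq S') S.
Proof.
elim: p Q S => [a|p IHp q IHq|p IHp q IHq|p IHp] Q S /=.
- by case=> S' aS QS'; exists S' => //; exists S'.
- case/IHp=> S1 /IHq[S2 QS2 H2] H1; exists S2 => //.
  by apply: wp_mono H1 => // _ <-.
- by case=> [/IHp|/IHq] [S1 Q1 H1]; exists S1 => //; [left|right].
- case=> n len H.
  suff [S' QS' H']: exists2 S', Q S' & iter n (wp N p) (eq S') S.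
    by exists S' => //; exists n.
  elim: n {len} S H => [|n IH] S; first by exists S.
  rewrite iterS => /IHp[S1 /IH[S2 QS2 H2] H1]; exists S2 => //.
  by rewrite iterS; apply: wp_mono H1 => // _ <-.
Qed.

(** Used backwards along a run: raising the bound by one per step pays for the iteration added when
    a star is unrolled. *)
Lemma wpk_trans k a k' S S' N :
  (a, k') \in trans k -> astep a S S' -> wpk N k' S' -> wpk N.+1 k S.
Proof.
case: k => // p k; case: p => [b|p q|p q|p] /=; rewrite ?inE.
- case/eqP=> -> -> aS H; exists S' => //; exact: wpk_mono H.
- case/eqP=> -> -> /= -> /=.
  by apply: wp_mono => // S1; apply: wp_mono => // S2; apply: wpk_mono.
- by case/orP=> /eqP[-> ->] /= -> /= H; [left|right];
    apply: wp_mono H => // S1; apply: wpk_mono.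
- case/orP=> /eqP[-> ->] /= ->.
    by move=> H; exists 0 => //=; apply: wpk_mono H.
  case/wp_point=> S1 [n len H1] H; exists n.+1 => //.
  rewrite iterS; apply: wp_mono H => // _ <-.
  apply: iter_mono H1; last by move=> S2; apply: wpk_mono.
  by move=> Q Q' S2 QQ'; apply: wp_mono.
Qed.

(** The body of a star continues with the same star, so finitely many continuations are reachable
    and the machine has finitely many states. The bare [k] is not listed; for [k = [::]] it is the
    accepting continuation. *)
Fixpoint conts (p : prog) (k : seq prog) : seq (seq prog) :=
  (p :: k) :: match p with
  | Act a => [::]
  | Seq p q => conts p (q :: k) ++ conts q k
  | Alt p q => conts p k ++ conts q k
  | Star p' => conts p' (p :: k)
  end.

(* [srun L m k S k' S']: [m] steps lead from [(k, S)] to [(k', S')], and every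
   continuation that is left on the way belongs to [L]. *)
Fixpoint srun (L : seq (seq prog)) m k S k' S' : Prop :=
  if m is m'.+1 then
    k \in L /\ exists a k1 S1, [/\ (a, k1) \in trans k, astep a S S1 &
                             srun L m' k1 S1 k' S']
  else k' = k /\ S' = S.

Lemma srun_cat L m1 m2 k1 S1 k2 S2 k3 S3 :
  srun L m1 k1 S1 k2 S2 -> srun L m2 k2 S2 k3 S3 ->
  srun L (m1 + m2) k1 S1 k3 S3.
Proof.
elim: m1 k1 S1 => [|m IH] k1 S1 /=; first by case=> -> ->.
case=> kL [a [k [S [t aS r]]]] r2; split=> //.
by exists a, k, S; split=> //; apply: IH r2.
Qed.

Lemma srun_eps L m p k k1 S k2 S2 :
  p :: k \in L -> (Eps, k1) \in trans (p :: k) ->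
  srun L m k1 S k2 S2 -> srun L m.+1 (p :: k) S k2 S2.
Proof. by move=> pL t r; split=> //; exists Eps, k1, S. Qed.

Fixpoint cost (N : nat) (p : prog) : nat :=
  match p with
  | Act _ => 1
  | Seq p q => (cost N p + cost N q).+1
  | Alt p q => (cost N p + cost N q).+1
  | Star p => (N * (cost N p).+1).+1
  end.

Fixpoint psize (p : prog) : nat :=
  match p with
  | Act _ => 1
  | Seq p q => (psize p + psize q).+1
  | Alt p q => (psize p + psize q).+1
  | Star p => (psize p).+1
  end.

Lemma psize_gt0 p : 0 < psize p. Proof. by case: p. Qed.

(** [psize] is independent of [N], hence the run length is polynomial in [N] for a fixed program.
    Two factors that are at least 2 have a sum not exceeding their product, and the base [N.+2]
    absorbs the remaining [.+1]. *)
Lemma cost_bound N p : cost N p <= N.+2 ^ psize p.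
Proof.
have pos q : N.+1 < N.+2 ^ psize q.
  by rewrite -{1}[N.+2]expn1 leq_exp2l // psize_gt0.
have aux a b c d : N.+1 < a -> N.+1 < b -> c <= a -> d <= b ->
    (c + d).+1 <= N.+2 * (a * b).
  move=> /(leq_ltn_trans (ltn0Sn N)) a1 /(leq_ltn_trans (ltn0Sn N)) b1 ca db.
  have ab : a + b <= a * b.
    by rewrite -(subnK a1) -(subnK b1); move: (a - _) (b - _) => ? ?; lia.
  have : 2 * (a * b) <= N.+2 * (a * b) by rewrite leq_mul2r orbT.
  by move: (a * b) (N.+2 * _) ab; lia.
elim: p => [a|p IHp q IHq|p IHp q IHq|p IHp] /=; rewrite ?expnS ?expnD.
- by rewrite expn0 muln1.
- exact: aux (pos p) (pos q) IHp IHq.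
- exact: aux (pos p) (pos q) IHp IHq.
- move: (pos p) IHp; move: (_ ^ _) (cost _ _) => a c Na ca.
  by have := leq_mul (leqnn N) ca; rewrite mulnS mulSn mulSn; lia.
Qed.

Lemma wp_srun N L p Q S k : {subset conts p k <= L} -> wp N p Q S ->
  exists m S', [/\ m <= cost N p, Q S' & srun L m (p :: k) S k S'].
Proof.
elim: p Q S k => [a|p IHp q IHq|p IHp q IHq|p IHp] Q S k sub /=;
  have pL := sub _ (mem_head _ _).
- case=> S' aS QS'; exists 1, S'; split=> //=; split=> //.
  by exists a, k, S'; rewrite mem_head.
- case/(IHp _ _ (q :: k)) => [x xp|m1 [S1 [c1 H1 r1]]].
    by apply: sub; rewrite inE mem_cat xp orbT.
  case/(IHq _ _ k): H1 => [x xp|m2 [S2 [c2 H2 r2]]].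
    by apply: sub; rewrite inE mem_cat xp !orbT.
  exists (m1 + m2).+1, S2; split=> //; first by lia.
  by apply: srun_eps (srun_cat r1 r2); rewrite //= mem_head.
- case=> [/(IHp _ _ k)|/(IHq _ _ k)] [x xp|m1 [S1 [c1 H1 r1]]];
    try by apply: sub; rewrite inE mem_cat xp !orbT.
    exists m1.+1, S1; split=> //; first by lia.
    by apply: srun_eps r1; rewrite //= !inE eqxx.
  exists m1.+1, S1; split=> //; first by lia.
  by apply: srun_eps r1; rewrite //= !inE eqxx orbT.
- case=> n len H.
  suff [m [S' [cm QS' r]]]: exists m S', [/\ m <= (n * (cost N p).+1).+1, Q S' &
     srun L m (Star p :: k) S k S'].
    exists m, S'; split=> //; apply: leq_trans cm _.
    by rewrite ltnS leq_mul2r len orbT.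
  elim: n {len} S H => [|n IH] S H.
    exists 1, S; split=> //; apply: (@srun_eps _ 0 _ _ k) => //.
    by rewrite inE eqxx.
  case/(IHp _ _ (Star p :: k)): H => [x xp|m1 [S1 [c1 /IH[m2 [S2 [c2 H2 r2]]] r1]]].
    by apply: sub; rewrite inE xp orbT.
  exists (m1 + m2).+1, S2; split=> //; first by lia.
  by apply: srun_eps (srun_cat r1 r2); rewrite //= !inE eqxx orbT.
Qed.

(** * Compilation to a one-tape Turing machine *)

(** One track for each of the registers [rI] (0) to [rX] (15). *)
Definition nstacks := 16.
Definition track := {ffun 'I_nstacks -> option token}.

(* [None] is the marker at the origin, to the left of the input.  Stack [i] is
   written on track [i], bottom first, from cell 1 on. *)
Definition cell := option track.

Definition bit_cell (t : token) : cell :=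
  Some [ffun i : 'I_nstacks => if i == ord0 then Some t else None].
Definition blank_cell : cell := Some [ffun => None].
(** The input convention fixes the symbols 0, 1, 2 for blank and the two bits, so these cells come
    first. They recur in the enumeration, but [index] returns the first occurrence. *)
Definition cells : seq cell :=
  [:: blank_cell, bit_cell T0, bit_cell T1 & enum {: cell}].
Definition code (c : cell) : nat := index c cells.

Lemma mem_cells c : c \in cells. Proof. by rewrite !inE mem_enum !orbT. Qed.

Lemma code_inj : injective code.
Proof.
by move=> c c' /(congr1 (nth None cells)); rewrite !nth_index ?mem_cells.
Qed.

Lemma code_blank : code blank_cell = 0. Proof. by rewrite /code /= eqxx. Qed.

Lemma code_bit (b : bool) :
  code (bit_cell (if b then T1 else T0)) = (if b then 2 else 1).
Proof.
have ne t : (blank_cell == bit_cell t) = false.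
  by apply/eqP=> -[/ffunP/(_ ord0)]; rewrite !ffunE.
rewrite /code /= ne; case: b; rewrite ?eqxx //.
by rewrite ifF //; apply/eqP=> -[/ffunP/(_ ord0)]; rewrite !ffunE.
Qed.

Definition cellat (S : stacks) (j : nat) : cell :=
  if j is j'.+1 then Some [ffun i : 'I_nstacks => onth (rev (S i)) j']
  else None.

Definition set_track (f : track) i x : cell :=
  Some [ffun j : 'I_nstacks => if j == i then x else f j].

(* Stack operations are performed locally, at the top end of a track: rewrite
   one cell, then test the neighbour ([lact_dir] tells on which side). *)
Definition lact_write (a : act) (c : cell) : option cell :=
  match a, c with
  | Eps, _ => Some c
  | Push i t, Some f =>
      if f (inord i) == None then Some (set_track f (inord i) (Some t)) else None
  | Pop i t, Some f =>
      if f (inord i) == Some t then Some (set_track f (inord i) None) else None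
  | Empty _, None => Some c
  | _, _ => None
  end.
Definition lact_dir (a : act) : bool := if a is Push _ _ then false else true.
Definition lact_test (a : act) (c : cell) : bool :=
  match a, c with
  | Eps, _ => true
  | Push i _, Some f => f (inord i) != None
  | Push _ _, None => true
  | (Pop i _ | Empty i), Some f => f (inord i) == None
  | _, _ => false
  end.

Definition act_ok (a : act) : bool :=
  match a with
  | Eps => true
  | Push i _ | Pop i _ | Empty i => i < nstacks
  end.

Definition shift (mv : bool) (h : nat) := if mv then h.+1 else h.-1.

Lemma onth_rev_None (s : seq token) j : (onth (rev s) j == None) = (size s <= j).
Proof. by rewrite -size_rev -onthNE; case: onth. Qed.

Lemma onth_rcons (s : seq token) x j :
  onth (rcons s x) j = if j == size s then Some x else onth s j.
Proof.
by elim: s j => [|y s IH] [|j] //=; rewrite ?onth0n // IH eqSS.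
Qed.

Local Arguments onth : simpl never.

Lemma cellat_upd S i x j (Hi : i < nstacks) :
  cellat (upd S i x) j.+1 =
  Some [ffun k : 'I_nstacks =>
    if k == inord i then onth (rev x) j else onth (rev (S k)) j].
Proof.
congr Some; apply/ffunP=> k; rewrite !ffunE /upd.
by rewrite -(inj_eq val_inj) /= inordK //; case: eqP.
Qed.

(** A write and a look at one neighbour locate the top of a stack. A free cell whose left neighbour
    is occupied, or is the origin, is the place to push; an occupied cell with a free right
    neighbour is the top; a stack is empty if the cell right of the origin is free. A push never
    happens at the origin, so the head cannot leave the tape to the left. *)
Lemma lact_sound a S h c :
  act_ok a -> lact_write a (cellat S h) = Some c ->
  lact_test a (cellat S (shift (lact_dir a) h)) ->
  [/\ lact_dir a || (0 < h) & exists2 S', astep a S S' &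
      forall j, cellat S' j = if j == h then c else cellat S j].
Proof.
case: a => [|i t|i t|i] /=.
- by move=> _ [<-] _; split=> //; exists S => // j; case: eqP => // ->.
- case: h => // h Hi /=; rewrite !ffunE inordK // onth_rev_None.
  case: (leqP (size (S i)) h) => //= lh [<-] ht; split=> //.
  have eh : size (S i) = h.
    case: h lh ht => [|h] lh; first by move=> _; apply/eqP; rewrite -leqn0.
    rewrite /= !ffunE inordK // onth_rev_None -ltnNge => ht.
    by apply/eqP; rewrite eqn_leq lh.
  exists (upd S i (t :: S i)) => // -[|j] //.
  rewrite cellat_upd // eqSS /set_track rev_cons.
  case: eqP => [->|/eqP nj]; congr Some; apply/ffunP=> k; rewrite !ffunE;
    case: (eqVneq k (inord i)) => [ek|//]; rewrite onth_rcons size_rev eh ?eqxx //.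
  by rewrite (negbTE nj) ek inordK.
- case: h => // h Hi /=; rewrite !ffunE inordK //.
  case: (_ =P Some t) => //= et [<-]; rewrite onth_rev_None => lh; split=> //.
  case eS: (S i) et lh => [|t' r] /=; first by rewrite onth0n.
  rewrite rev_cons onth_rcons size_rev.
  rewrite ltnS; case: (h =P size r) => [eh [->] _|_ H /= lh]; last first.
    have: onth (rev r) h == None by rewrite onth_rev_None.
    by rewrite H.
  exists (upd S i r); first by exists r.
  case=> [|j] //; rewrite cellat_upd // eqSS /set_track.
  case: eqP => [->|/eqP nj]; congr Some; apply/ffunP=> k; rewrite !ffunE;
    case: (eqVneq k (inord i)) => [ek|//].
    by rewrite onth_default // size_rev eh.
  by rewrite ek inordK // eS rev_cons onth_rcons size_rev -eh (negbTE nj).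
- case: h => //= Hi [<-]; rewrite ffunE inordK // onth_rev_None leqn0 => /nilP e.
  by split=> //; exists S => // j; case: eqP => // ->.
Qed.

(** A stack of height at most [B] has its top at a cell not beyond [B], and a push writes one cell
    further. *)
Lemma lact_complete a S S' B :
  act_ok a -> astep a S S' -> (forall i, size (S i) <= B) ->
  exists h c, [/\ h <= B.+1, lact_write a (cellat S h) = Some c,
    lact_test a (cellat S (shift (lact_dir a) h)), lact_dir a || (0 < h) &
    forall j, cellat S' j = if j == h then c else cellat S j].
Proof.
case: a => [|i t|i t|i] /=.
- move=> _ -> _; exists 0, None; split=> // j; by case: eqP => // ->.
- move=> Hi -> HB.
  have w : lact_write (Push i t) (cellat S (size (S i)).+1) =
    Some (set_track [ffun i0 : 'I_nstacks => onth (rev (S i0)) (size (S i))]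
            (inord i) (Some t)).
    by rewrite /= ffunE inordK // onth_rev_None leqnn.
  have tst : lact_test (Push i t) (cellat S (size (S i)).+1.-1).
    by case eS: (S i) => [|x r] //=; rewrite ffunE inordK // onth_rev_None eS -ltnNge /=.
  have [_ [S1 -> H]] := @lact_sound (Push i t) _ _ _ Hi w tst.
  exists (size (S i)).+1; eexists; split;
      [by rewrite ltnS|exact: w|exact: tst|by []|exact: H].
- move=> Hi [r eS ->] HB.
  have w : lact_write (Pop i t) (cellat S (size (S i))) =
    Some (set_track [ffun i0 : 'I_nstacks => onth (rev (S i0)) (size r)]
            (inord i) None).
    by rewrite eS /= ffunE inordK // eS rev_cons onth_rcons size_rev !eqxx.
  have tst : lact_test (Pop i t) (cellat S (size (S i)).+1).
    by rewrite /= ffunE inordK // onth_rev_None.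
  have [_ [S1 [r' e' ->] H]] := @lact_sound (Pop i t) _ _ _ Hi w tst.
  have er : r' = r by move: e'; rewrite eS => -[].
  rewrite er in H.
  exists (size (S i)); eexists; split; [|exact: w|exact: tst| |exact: H] => //.
  exact: leq_trans (HB i) _.
- move=> Hi [eS ->] _; exists 0, None; split=> // [|j]; last by case: eqP => // ->.
  by rewrite /= ffunE inordK // eS.
Qed.

(** The default 0 of [nth] is the code of the blank cell, so the finite tape stands for an infinite
    one. *)
Definition repr (c : config) (q : nat) (f : nat -> cell) (h : nat) : Prop :=
  [/\ c.1.1 = q, size c.1.2 = h &
      forall j, nth 0 (catrev c.1.2 c.2) j = code (f j)].

Lemma repr_ext c q f g h : f =1 g -> repr c q f h -> repr c q g h.
Proof. by move=> fg [e1 e2 e3]; split=> // j; rewrite -fg. Qed.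

Lemma repr_read c q f h : repr c q f h -> read c = code (f h).
Proof.
case: c => [[q' lt] rt] [/= _ <- /(_ (size lt))].
by rewrite catrevE nth_cat size_rev ltnn subnn nth0.
Qed.

(** A left move at the left end inserts a new cell and would shift all positions; the condition
    [mv || (0 < h)] excludes it. *)
Lemma repr_apply c q f h q0 x q' c' mv : repr c q f h -> mv || (0 < h) ->
  repr (apply_rule (q0, x, q', code c', mv) c) q'
       (fun j => if j == h then c' else f j) (shift mv h).
Proof.
case: c => [[q1 lt] rt] [/= _ <- H] ok.
have key j : nth 0 (catrev lt (code c' :: behead rt)) j =
             code (if j == size lt then c' else f j).
  move: {H}(H j); rewrite !catrevE !nth_cat size_rev.
  case: (ltngtP j (size lt)) => [//|lj|->]; last by rewrite subnn.
  by move=> <-; rewrite -[j - size lt]prednK ?subn_gt0 //=; case: (rt) => //=;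
    rewrite nth_nil.
by case: mv ok => /= ok; [|case: lt ok H key => //= y lt _ _ key]; split.
Qed.

(** States 0, 1, 2 are start, acceptance and the writing of the origin marker. Odd numbers from 3 on
    mean that the head is walking, even ones from 4 on that an action is halfway, between its write
    and its test. *)
Definition main_state (k : seq prog) : nat := (pickle k).*2 + 3.
Definition mid_state (a : act) (k : seq prog) : nat := (pickle (a, k)).*2 + 4.

Lemma main_state_inj : injective main_state.
Proof. by move=> k k' /addIn/double_inj/(pcan_inj pickleK). Qed.

Lemma mid_state_inj a k a' k' :
  mid_state a k = mid_state a' k' -> a = a' /\ k = k'.
Proof. by move=> /addIn/double_inj/(pcan_inj pickleK)-[-> ->]. Qed.

Lemma main_neq_mid k a k' : main_state k <> mid_state a k'.
Proof. by move/(congr1 odd); rewrite !oddD !odd_double. Qed.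

Definition rule_src (r : rule) : nat := r.1.1.1.1.

(** Moving left off the input makes the tape grow by a blank cell, which then receives the origin
    marker. *)
Definition init_rules (p : prog) : NTM :=
  [:: (2, 0, main_state [:: p], code None, true); (0, 0, 2, 0, false);
      (0, 1, 2, 1, false); (0, 2, 2, 2, false)].
Definition accept_rules : NTM :=
  [seq (main_state [::], code c, 1, code c, true) | c <- enum {: cell}].
Definition walk_rules (k : seq prog) : NTM :=
  [seq (main_state k, code c, main_state k, code c, true) | c <- enum {: cell}]
  ++ [seq (main_state k, code c, main_state k, code c, false)
     | c <- enum {: cell} & c != None].
Definition write_rules (k : seq prog) (a : act) (k' : seq prog) : NTM :=
  pmap (fun c => omap (fun x => (main_state k, code c, mid_state a k', code x,
                                 lact_dir a)) (lact_write a c)) (enum {: cell}).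
Definition test_rules (a : act) (k' : seq prog) : NTM :=
  [seq (mid_state a k', code c, main_state k', code c, ~~ lact_dir a)
  | c <- enum {: cell} & lact_test a c].

Definition prog_rules (k : seq prog) : NTM :=
  walk_rules k ++
  flatten [seq write_rules k t.1 t.2 ++ test_rules t.1 t.2 | t <- trans k].

Definition ntm (p : prog) : NTM :=
  init_rules p ++ accept_rules ++ flatten (map prog_rules (conts p [::])).

Lemma stepP M c c' :
  reflect (exists2 r, r \in M & [/\ rule_src r = c.1.1, r.1.1.1.2 = read c &
                                 c' = apply_rule r c]) (step M c c').
Proof.
apply: (iffP hasP) => -[r rM].
  by case/and3P=> /eqP ? /eqP ? /eqP ?; exists r.
by case=> <- <- ->; exists r; rewrite // !eqxx.
Qed.

Variant rule_of (p : prog) : rule -> Prop :=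
| RuleInit x : rule_of p (0, x, 2, x, false)
| RuleOrigin : rule_of p (2, 0, main_state [:: p], code None, true)
| RuleAccept c : rule_of p (main_state [::], code c, 1, code c, true)
| RuleWalk k c mv of mv || (c != None) :
    rule_of p (main_state k, code c, main_state k, code c, mv)
| RuleWrite k a k' c x of k \in conts p [::] & (a, k') \in trans k &
    lact_write a c = Some x :
    rule_of p (main_state k, code c, mid_state a k', code x, lact_dir a)
| RuleTest a k' c of lact_test a c :
    rule_of p (mid_state a k', code c, main_state k', code c, ~~ lact_dir a).

Lemma ntm_rule p r : r \in ntm p -> rule_of p r.
Proof.
rewrite !mem_cat; case/or3P.
- rewrite !inE => /or4P[] /eqP->; constructor.
- by case/mapP=> c _ ->; constructor.
- case/flatten_mapP=> k kL; rewrite mem_cat mem_cat; case/orP; first case/orP.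
  + by case/mapP=> c _ ->; constructor.
  + by case/mapP=> c; rewrite mem_filter => /andP[nc _] ->; constructor.
  + case/flatten_mapP=> -[a k'] tk; rewrite mem_cat => /orP[].
      rewrite mem_pmap => /mapP[c _].
      by case ew: lact_write => [x|] //= -[->]; constructor.
    by case/mapP=> c; rewrite mem_filter => /andP[tc _] ->; constructor.
Qed.

Lemma walk_mem p k c mv : k \in conts p [::] -> mv || (c != None) ->
  (main_state k, code c, main_state k, code c, mv) \in ntm p.
Proof.
move=> kL ok; rewrite !mem_cat; apply/orP; right; apply/orP; right.
apply/flatten_mapP; exists k => //; rewrite !mem_cat; apply/orP; left.
case: mv ok => /= nc; apply/orP; [left|right]; apply/mapP; exists c => //.
- by rewrite mem_enum.
- by rewrite mem_filter nc mem_enum.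
Qed.

Lemma write_mem p k a k' c x : k \in conts p [::] -> (a, k') \in trans k ->
  lact_write a c = Some x ->
  (main_state k, code c, mid_state a k', code x, lact_dir a) \in ntm p.
Proof.
move=> kL tk ew; rewrite !mem_cat; apply/orP; right; apply/orP; right.
apply/flatten_mapP; exists k => //; rewrite mem_cat; apply/orP; right.
apply/flatten_mapP; exists (a, k') => //; rewrite mem_cat; apply/orP; left.
by rewrite mem_pmap; apply/mapP; exists c; rewrite ?mem_enum //= ew.
Qed.

Lemma test_mem p k a k' c : k \in conts p [::] -> (a, k') \in trans k ->
  lact_test a c ->
  (mid_state a k', code c, main_state k', code c, ~~ lact_dir a) \in ntm p.
Proof.
move=> kL tk ew; rewrite !mem_cat; apply/orP; right; apply/orP; right.
apply/flatten_mapP; exists k => //; rewrite mem_cat; apply/orP; right.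
apply/flatten_mapP; exists (a, k') => //; rewrite mem_cat; apply/orP; right.
by apply/mapP; exists c; rewrite // mem_filter mem_enum andbT.
Qed.

Lemma accept_mem p c : (main_state [::], code c, 1, code c, true) \in ntm p.
Proof.
rewrite !mem_cat; apply/orP; right; apply/orP; left.
by apply/mapP; exists c; rewrite ?mem_enum.
Qed.

Fixpoint prog_ok (p : prog) : bool :=
  match p with
  | Act a => act_ok a
  | Seq p q => prog_ok p && prog_ok q
  | Alt p q => prog_ok p && prog_ok q
  | Star p => prog_ok p
  end.

Lemma conts_ok p k k' : prog_ok p -> all prog_ok k -> k' \in conts p k ->
  all prog_ok k'.
Proof.
elim: p k => [a|p IHp q IHq|p IHp q IHq|p IHp] k /= ok okk; rewrite in_cons => /predU1P[->|];
  rewrite /= ?ok ?okk //; rewrite ?mem_cat.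
- by case/andP: ok => okp okq /orP[/IHp|/IHq]; apply; rewrite //= okq.
- by case/andP: ok => okp okq /orP[/IHp|/IHq]; apply; rewrite //= okq.
- by move/IHp; apply; rewrite //= ok.
Qed.

Lemma trans_ok k a k' : all prog_ok k -> (a, k') \in trans k -> act_ok a.
Proof.
by case: k => // -[b|p q|p q|p] k /= /andP[ok _]; rewrite !inE;
  do ?case/orP; case/eqP=> -> _.
Qed.

Lemma lact_write_dir a c x : lact_write a c = Some x -> lact_dir a || (c != None).
Proof. by case: a => [|i t|i t|i] //; case: c. Qed.

Lemma cellat_None S h : (cellat S h != None) = (0 < h).
Proof. by case: h. Qed.

Lemma main_step p k c c' S h : repr c (main_state k) (cellat S) h ->
  step (ntm p) c c' ->
  [\/ k = [::], exists h', repr c' (main_state k) (cellat S) h' |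
      exists a k' x, [/\ k \in conts p [::], (a, k') \in trans k,
        lact_write a (cellat S h) = Some x &
        repr c' (mid_state a k') (fun j => if j == h then x else cellat S j)
             (shift (lact_dir a) h)]].
Proof.
move=> rc /stepP[r rM [src rd ->]]; have := repr_read rc.
have [src' _ _] := rc; rewrite src' in src.
case/ntm_rule: rM src rd.
- by rewrite /rule_src /= /main_state addn3.
- by rewrite /rule_src /= /main_state addn3.
- by move=> x /main_state_inj <-; constructor 1.
- move=> k1 x mv ok /main_state_inj <- /= <- /code_inj ex; constructor 2.
  have ok' : mv || (0 < h) by rewrite -(cellat_None S) -ex.
  exists (shift mv h).
  apply: repr_ext (repr_apply (main_state k1) (code x) (main_state k1) x rc ok').
  by move=> j; case: eqP => // ->.
- move=> k1 a k' x y kL tk ew /main_state_inj <- /= <- /code_inj ex; constructor 3.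
  exists a, k', y; rewrite -ex; split=> //.
  have ok : lact_dir a || (0 < h).
    by rewrite -(cellat_None S) -ex; apply: lact_write_dir ew.
  exact: (repr_apply (main_state k1) (code x) (mid_state a k') y rc ok).
- by move=> a k' x _ /esym /main_neq_mid.
Qed.

Lemma mid_step p a k c c' f h : repr c (mid_state a k) f h ->
  lact_dir a ==> (0 < h) -> step (ntm p) c c' ->
  lact_test a (f h) /\ repr c' (main_state k) f (shift (~~ lact_dir a) h).
Proof.
move=> rc ok /stepP[r rM [src rd ->]]; have := repr_read rc.
have [src' _ _] := rc; rewrite src' in src.
case/ntm_rule: rM src rd.
- by rewrite /rule_src /= /mid_state addn4.
- by rewrite /rule_src /= /mid_state addn4.
- by move=> x /main_neq_mid.
- by move=> k1 x mv _ /main_neq_mid.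
- by move=> k1 a' k' x y _ _ _ /main_neq_mid.
- move=> a' k' x tx /mid_state_inj[ea <-] /= <- /code_inj ex.
  rewrite -ex -ea; split=> //.
  have ok' : ~~ lact_dir a' || (0 < h) by rewrite -implybE ea.
  apply: repr_ext (repr_apply (mid_state a' k') (code x) (main_state k') x rc ok').
  by move=> j; case: eqP => // ->.
Qed.

(** Strong induction on the length of the run, because one stack action takes two machine steps, and
    a run that stops between them is not accepting. *)
Lemma ntm_sound_main p cs c k S h : prog_ok p ->
  repr c (main_state k) (cellat S) h ->
  path (step (ntm p)) c cs -> (last c cs).1.1 == 1 -> exists N, wpk N k S.
Proof.
move=> ok; have [m] := ubnP (size cs).
elim: m cs c k S h => // m IH [|c1 cs] c k S h szm rc.
  by case: rc => /= -> _ _ _; rewrite /main_state addn3.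
case/andP=> /(main_step rc); case.
- by move=> -> _ _; exists 0.
- by case=> h' rc1 pth lst; apply: IH pth lst => //; exact: rc1.
case=> a [k' [x [kL tk ew rc1]]].
case: cs szm => [|c2 cs] szm.
  by case: rc1 => /= -> _ _ _; rewrite /mid_state addn4.
have oka : act_ok a by apply: trans_ok tk; apply: conts_ok kL.
have okd : lact_dir a || (0 < h).
  by rewrite -(cellat_None S); apply: lact_write_dir ew.
case/andP=> /(mid_step rc1)[|tst rc2 pth lst].
  by case: (lact_dir a).
have [_ [S' aS HS']] : [/\ lact_dir a || (0 < h) & exists2 S', astep a S S' &
      forall j, cellat S' j = if j == h then x else cellat S j].
  (* The test sees the tape after the write; as [shift] really moves the head, the tested cell still
     has its old contents. *)
  apply: lact_sound => //; move: tst; case: eqP => //.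
  by move=> e; exfalso; move: okd e; case: lact_dir => /=; lia.
have szc : size cs < m by move: szm; rewrite /= !ltnS => /ltnW.
have {}rc2 := repr_ext (fun j => esym (HS' j)) rc2.
have [N H] := IH cs c2 k' S' _ szc rc2 pth lst.
by exists N.+1; apply: wpk_trans tk aS H.
Qed.

(** Read from the bottom, stack 0 spells the input in its order, so the initial tape already
    represents these stacks and the last input bit is on top. *)
Definition input_stacks (w : seq bool) : stacks :=
  fun i => if i == 0 then rev [seq if b then T1 else T0 | b <- w] else [::].

Definition init1 (w : seq bool) : config :=
  (2, [::], 0 :: read (init_config w) :: behead (init_config w).2).
Definition init2 p (w : seq bool) : config :=
  (main_state [:: p], [:: code None],
   read (init_config w) :: behead (init_config w).2).

Lemma repr_init2 p w :
  repr (init2 p w) (main_state [:: p]) (cellat (input_stacks w)) 1.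
Proof.
have E j : cellat (input_stacks w) j.+1 =
    if onth w j is Some b then bit_cell (if b then T1 else T0) else blank_cell.
  rewrite /= /input_stacks; case ew: (onth w j) => [b|]; congr Some;
    apply/ffunP=> i; rewrite !ffunE -?(inj_eq val_inj) /=;
    case: eqP => _; rewrite ?onth0n // revK onth_map ew //.
split=> // -[|j] //; rewrite E.
have -> : nth 0 (catrev (init2 p w).1.2 (init2 p w).2) j.+1 =
          nth 0 [seq if b then 2 else 1 | b <- w] j.
  by rewrite /init2 /init_config /read /=; case: (w) => //; case: j => [|[|j]].
rewrite -odflt_onth onth_map; case: (onth w j) => [b|] /=.
  by rewrite code_bit.
by rewrite code_blank.
Qed.

Local Arguments step : simpl never.

Lemma step_init p w c : step (ntm p) (init_config w) c -> c = init1 w.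
Proof.
case/stepP=> r rM [src rd ->]; case/ntm_rule: rM src rd; rewrite /rule_src /=.
- by move=> x _ ->.
- by [].
- by move=> x; rewrite /main_state addn3.
- by move=> k x mv _; rewrite /main_state addn3.
- by move=> k a k' x y _ _ _; rewrite /main_state addn3.
- by move=> a k' x _; rewrite /mid_state addn4.
Qed.

Lemma step_init1 p w c : step (ntm p) (init1 w) c -> c = init2 p w.
Proof.
case/stepP=> r rM [src rd ->]; case/ntm_rule: rM src rd; rewrite /rule_src /=.
- by [].
- by [].
- by move=> x; rewrite /main_state addn3.
- by move=> k x mv _; rewrite /main_state addn3.
- by move=> k a k' x y _ _ _; rewrite /main_state addn3.
- by move=> a k' x _; rewrite /mid_state addn4.
Qed.

Lemma ntm_sound p w t : prog_ok p -> accepts_within (ntm p) w t ->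
  exists N, wp N p (fun _ => True) (input_stacks w).
Proof.
move=> ok [cs /and3P[_]]; case: cs => // c1 cs /=.
case/andP=> /step_init->; case: cs => // c2 cs /= /andP[/step_init1->] pth lst.
exact: ntm_sound_main ok (repr_init2 p w) pth lst.
Qed.

(** * Completeness of the simulation and its running time *)

Section Complete.
Variable p : prog.
Hypothesis okp : prog_ok p.
Let M := ntm p.
Let L := conts p [::].

Lemma step_mem c q f h q' x mv : repr c q f h ->
  (q, code (f h), q', x, mv) \in M ->
  step M c (apply_rule (q, code (f h), q', x, mv) c).
Proof.
move=> rc rM; apply/stepP; eexists; first exact: rM.
by rewrite (repr_read rc); case: rc.
Qed.

Lemma walk1 k S c h mv : k \in L ->
  repr c (main_state k) (cellat S) h -> mv || (0 < h) ->
  exists2 c', step M c c' & repr c' (main_state k) (cellat S) (shift mv h).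
Proof.
move=> kL rc ok.
have R := repr_apply (main_state k) (code (cellat S h)) (main_state k)
                     (cellat S h) rc ok.
eexists; last by apply: repr_ext R => j; case: eqP => // ->.
by apply: (step_mem rc); apply: walk_mem; rewrite ?cellat_None.
Qed.

Lemma walk k S c h h' : k \in L ->
  repr c (main_state k) (cellat S) h ->
  exists cs, [/\ size cs <= maxn h h', path (step M) c cs &
    repr (last c cs) (main_state k) (cellat S) h'].
Proof.
move=> kL rc.
suff [cs [sz pth rl]] : exists cs, [/\ size cs = (h - h') + (h' - h),
    path (step M) c cs & repr (last c cs) (main_state k) (cellat S) h'].
  by exists cs; split=> //; rewrite sz; lia.
have [n] := ubnP ((h - h') + (h' - h)).
elim: n c h rc => // n IH c h rc lt_n.
have [<-|nhh] := eqVneq h h'; first by exists [::]; rewrite subnn.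
have ok : (h < h') || (0 < h) by lia.
have [c1 st rc1] := walk1 kL rc ok.
have [|cs [sz pth rl]] := IH _ _ rc1.
  by move: nhh lt_n ok {st rc1}; rewrite /shift; case: ifP; lia.
exists (c1 :: cs); rewrite /= st; split=> //; rewrite sz.
by move: nhh ok {lt_n st rc1 rl sz}; rewrite /shift; case: ifP; lia.
Qed.

(** At most [B.+1] steps of walking, one write and one test; the step back after the test returns
    the head to the cell written. *)
Lemma ntm_act k a k' S S' c h B : k \in L -> (a, k') \in trans k ->
  astep a S S' -> (forall i, size (S i) <= B) ->
  repr c (main_state k) (cellat S) h -> h <= B.+1 ->
  exists cs h', [/\ size cs <= B + 3, path (step M) c cs, h' <= B.+1 &
    repr (last c cs) (main_state k') (cellat S') h'].
Proof.
move=> kL tk aS HB rc hB.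
have oka : act_ok a by apply: trans_ok tk; apply: conts_ok kL.
have [h' [x [h'B w t d HS']]] := lact_complete oka aS HB.
have [cs [sz pth rc1]] := walk h' kL rc.
have R2 := repr_apply (main_state k) (code (cellat S h')) (mid_state a k') x rc1 d.
have sh : (shift (lact_dir a) h' == h') = false.
  by move: d; case: lact_dir => /=; lia.
have d' : ~~ lact_dir a || (0 < shift (lact_dir a) h').
  by case: lact_dir.
have R3 := repr_apply (mid_state a k') (code (cellat S (shift (lact_dir a) h')))
  (main_state k') (cellat S (shift (lact_dir a) h')) R2 d'.
set c2 := apply_rule _ (last c cs) in R2 R3.
set c3 := apply_rule _ c2 in R3.
have sh2 : shift (~~ lact_dir a) (shift (lact_dir a) h') = h'.
  by move: d; case: lact_dir => //=; lia.
rewrite sh2 in R3.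
exists (cs ++ [:: c2; c3]), h'; split=> //.
- rewrite size_cat /=; lia.
- rewrite cat_path pth /= andbT; apply/andP; split.
    exact: step_mem rc1 (write_mem kL tk w).
  have := @step_mem _ _ _ _ (main_state k')
    (code (cellat S (shift (lact_dir a) h'))) (~~ lact_dir a) R2.
  by rewrite sh; apply; apply: test_mem kL tk t.
- rewrite last_cat; apply: repr_ext R3 => j; rewrite HS'.
  by case: eqP => // ->; rewrite sh.
Qed.

Lemma astep_size a S S' B : astep a S S' -> (forall i, size (S i) <= B) ->
  forall i, size (S' i) <= B.+1.
Proof.
case: a => [|i t|i t|i] /=.
- by move=> -> HB i; apply: leqW.
- by move=> -> HB j; rewrite /upd; case: eqP => _ /=; rewrite ?ltnS // leqW.
- case=> r e -> HB j; rewrite /upd; case: eqP => _ /=; last exact: leqW.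
  by have := HB i; rewrite e /=; lia.
- by case=> _ -> HB j; apply: leqW.
Qed.

(** Each action raises a stack by at most one, so all heights stay below [B + m] throughout. *)
Lemma ntm_run m k S k' S' c h B : srun L m k S k' S' ->
  (forall i, size (S i) <= B) -> repr c (main_state k) (cellat S) h ->
  h <= B.+1 ->
  exists cs h', [/\ size cs <= m * (B + m + 3), path (step M) c cs &
    repr (last c cs) (main_state k') (cellat S') h'].
Proof.
elim: m k S c h B => [|m IH] k S c h B /=.
  by case=> -> -> _ rc _; exists [::], h.
case=> kL [a [k1 [S1 [tk aS r]]]] HB rc hB.
have [cs1 [h1 [sz1 pth1 h1B rc1]]] := ntm_act kL tk aS HB rc hB.
have [cs2 [h2 [sz2 pth2 rc2]]] := IH _ _ _ _ _ r (astep_size aS HB) rc1 (leqW h1B).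
exists (cs1 ++ cs2), h2; rewrite cat_path last_cat pth1; split=> //.
by rewrite size_cat mulSn; move: sz2; rewrite !addSn !addnS; lia.
Qed.

Lemma ntm_complete N w : wp N p (fun _ => True) (input_stacks w) ->
  accepts_within M w (cost N p * (size w + cost N p + 3) + 3).
Proof.
move=> H; have [m [S' [cm _ r]]] := wp_srun (fun x xp => xp : x \in L) H.
have HB i : size (input_stacks w i) <= size w.
  by rewrite /input_stacks; case: eqP => //; rewrite size_rev size_map.
have [cs [h [sz pth rc]]] := ntm_run r HB (repr_init2 p w) (ltn0Sn _).
have st1 : step M (init_config w) (init1 w).
  apply/stepP; set x := read (init_config w).
  exists (0, x, 2, x, false); last by split.
  rewrite mem_cat; apply/orP; left; rewrite /x; case: (w) => [|[] w'];
    by rewrite !inE ?eqxx ?orbT.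
have st2 : step M (init1 w) (init2 p w).
  by apply/stepP; exists (2, 0, main_state [:: p], code None, true);
    [rewrite mem_cat inE eqxx | split].
have [x st3] : exists c, step M (last (init2 p w) cs) c && (c.1.1 == 1).
  eexists; apply/andP; split.
    exact: step_mem rc (accept_mem p _).
  by case: (last _ _) => -[].
(* The summand 3 in the time bound pays for the two steps that set the origin marker and the last
   step into state 1. *)
exists [:: init1 w, init2 p w & rcons cs x]; apply/and3P; split.
- rewrite /= size_rcons addn3 !ltnS; apply: leq_trans sz _.
  by apply: leq_mul => //; lia.
- by rewrite /= st1 st2 rcons_path pth; case/andP: st3.
- by rewrite /= last_rcons; case/andP: st3.
Qed.
End Complete.

(** * Block transfers *)

Notation "p ;; q" := (Seq p q) (at level 65, right associativity).
Notation push i t := (Act (Push i t)).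
Notation pop i t := (Act (Pop i t)).
Notation isempty i := (Act (Empty i)).

Definition tok (b : bool) : token := if b then T1 else T0.
Definition bits (u : seq bool) : seq token := map tok u.

(* Numbers are kept on the stacks as blocks, least significant bit on top,
   with arbitrarily many leading zeros. *)
Definition blk (u : seq bool) (r : seq token) : seq token := bits u ++ TSep :: r.
Definition num (u : seq bool) : nat := foldr (fun (b : bool) n => b + n.*2) 0 u.

Lemma tok_inj : injective tok. Proof. by do 2!case. Qed.

Lemma blk_inj u u' r r' : blk u r = blk u' r' -> u = u' /\ r = r'.
Proof.
elim: u u' => [|b u IH] [|b' u'] //=; first by case.
- by case: b'.
- by case: b.
- by case=> /tok_inj-> /IH[-> ->].
Qed.

Lemma upd_eq S i x : upd S i x i = x. Proof. by rewrite /upd eqxx. Qed.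

Lemma upd_neq S i x j : j != i -> upd S i x j = S j.
Proof. by rewrite /upd => /negbTE->. Qed.

Lemma upd_upd S i x y : upd (upd S i x) i y = upd S i y.
Proof. by apply: functional_extensionality => k; rewrite /upd; case: eqP. Qed.

Lemma upd_id S i : upd S i (S i) = S.
Proof.
by apply: functional_extensionality => k; rewrite /upd; case: eqP => // ->.
Qed.

Lemma upd_idE S i x : S i = x -> upd S i x = S.
Proof. by move=> <-; rewrite upd_id. Qed.

Ltac upd_ext :=
  apply: functional_extensionality => ?; rewrite /upd /=;
  repeat match goal with |- context [?a == ?b] =>
    case: (@eqP _ a b) => [?|?]; subst; rewrite //=
  end.

Lemma updC S i j x y : i != j -> upd (upd S i x) j y = upd (upd S j y) i x.
Proof.
move=> ij; apply: functional_extensionality => k; rewrite /upd.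
by case: (eqVneq k j) => // ->; rewrite eq_sym (negbTE ij).
Qed.

Local Arguments wp : simpl never.

Lemma wp_seq N p q Q S : wp N (p ;; q) Q S <-> wp N p (wp N q Q) S.
Proof. by []. Qed.

Lemma wp_alt N p q Q S : wp N (Alt p q) Q S <-> wp N p Q S \/ wp N q Q S.
Proof. by []. Qed.

Lemma wp_star N p Q S :
  wp N (Star p) Q S <-> exists2 n, n <= N & iter n (wp N p) Q S.
Proof. by []. Qed.

Lemma wp_push N i t Q S : wp N (push i t) Q S <-> Q (upd S i (t :: S i)).
Proof. by split=> [[S' /= -> //]|H]; exists (upd S i (t :: S i)). Qed.

Lemma wp_pop N i t Q S :
  wp N (pop i t) Q S <-> exists2 r, S i = t :: r & Q (upd S i r).
Proof.
split=> [[S' [r e ->] H]|[r e H]]; first by exists r.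
by exists (upd S i r) => //; exists r.
Qed.

Lemma wp_empty N i Q S : wp N (isempty i) Q S <-> S i = [::] /\ Q S.
Proof. by split=> [[S' [e ->] H]|[e H]] //; exists S. Qed.

Definition Bit (f : bool -> prog) : prog := Alt (f false) (f true).

Lemma wp_bit N f Q S : wp N (Bit f) Q S <-> exists b, wp N (f b) Q S.
Proof.
split=> [[H|H]|[[] H]]; by [exists false | exists true | right | left].
Qed.

Definition pushes (l : seq nat) t := foldr (fun i p => push i t ;; p) (Act Eps) l.
Definition pops (l : seq nat) t := foldr (fun i p => pop i t ;; p) (Act Eps) l.

Definition ext (S : stacks) (l : seq nat) (s : seq token) : stacks :=
  fun i => if i \in l then s ++ S i else S i.

Lemma ext_cat S l s s' : ext (ext S l s) l s' = ext S l (s' ++ s).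
Proof.
by apply: functional_extensionality => i; rewrite /ext; case: (i \in l); rewrite ?catA.
Qed.

Lemma ext_nil S l : ext S l [::] = S.
Proof. by apply: functional_extensionality => i; rewrite /ext if_same. Qed.

Lemma extC S l l' s s' : ~~ has (mem l) l' ->
  ext (ext S l s) l' s' = ext (ext S l' s') l s.
Proof.
move=> /hasPn d; apply: functional_extensionality => i; rewrite /ext.
case il': (i \in l') => //; have /negbTE-> // : i \notin l by apply: d.
Qed.

Lemma ext_cons S i l t : i \notin l ->
  ext S (i :: l) [:: t] = ext (upd S i (t :: S i)) l [:: t].
Proof.
move=> il; apply: functional_extensionality => j; rewrite /ext /upd inE.
by case: (eqVneq j i) => [->|//]; rewrite (negbTE il).
Qed.

Lemma wp_pushes N l t Q S : uniq l ->
  wp N (pushes l t) Q S <-> Q (ext S l [:: t]).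
Proof.
elim: l S => [|i l IH] S /=.
  have -> : ext S [::] [:: t] = S by apply: functional_extensionality.
  by move=> _; split=> [[S' ->]|] //; exists S.
case/andP=> il ul; rewrite ext_cons //; apply: iff_trans (IH _ ul).
exact: (wp_push _ _ _ (wp N _ Q)).
Qed.

Lemma wp_pops N l t Q S : uniq l ->
  wp N (pops l t) Q S <-> exists2 S0, S = ext S0 l [:: t] & Q S0.
Proof.
elim: l S => [|i l IH] S /=.
  have E S0 : ext S0 [::] [:: t] = S0 by apply: functional_extensionality.
  move=> _; split=> [[S' -> H]|[S0 -> H]]; first by exists S.
  by exists S0 => //; rewrite E.
case/andP=> il ul; split.
  case/wp_seq/wp_pop=> r eS /IH[//|S0 eS0 H]; exists S0 => //.
  rewrite ext_cons //; apply: functional_extensionality => j.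
  have := congr1 (fun f => f i) eS0; rewrite upd_eq {1}/ext (negbTE il) => er.
  have := congr1 (fun f => f j) eS0; rewrite /ext /upd.
  by case: (eqVneq j i) => [->|//]; rewrite (negbTE il) -er.
case=> S0 -> H; apply/wp_seq/wp_pop; exists (S0 i); first by rewrite /ext mem_head.
apply/IH => //; exists S0 => //; apply: functional_extensionality => j.
rewrite /ext /upd inE; case: (eqVneq j i) => [->|//].
by rewrite (negbTE il).
Qed.

Definition Stream src dst :=
  Star (Bit (fun b => pops src (tok b) ;; pushes dst (tok b))).
(** All data movement is an instance: an empty [src] guesses a block, an empty [dst] discards one,
    and two targets duplicate it. The block arrives reversed. *)
Definition Xmit src dst :=
  pushes dst TSep ;; Stream src dst ;; pops src TSep.

Lemma wp_stream N src dst Q S :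
  uniq src -> uniq dst -> ~~ has (mem src) dst ->
  wp N (Stream src dst) Q S <->
  exists u S0, [/\ size u <= N, S = ext S0 src (bits u) &
                   Q (ext S0 dst (bits (rev u)))].
Proof.
move=> us ud dj.
suff it n S1 : iter n (wp N (Bit (fun b => pops src (tok b) ;; pushes dst (tok b)))) Q S1
    <-> exists u S0, [/\ size u = n, S1 = ext S0 src (bits u) &
                   Q (ext S0 dst (bits (rev u)))].
  split=> [[n len /it[u [S0 [sz eS H]]]]|[u [S0 [sz eS H]]]].
    by exists u, S0; rewrite sz.
  by exists (size u) => //; apply/it; exists u, S0.
elim: n S1 => [|n IH] S1.
  split; first by move=> H; exists [::], S1; rewrite !ext_nil.
  by case=> -[|b u] [S0 []] // _ ->; rewrite !ext_nil.
rewrite iterS; split.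
  case/wp_bit=> b /wp_seq/(wp_pops _ _ _ _ us)[S2 -> /(wp_pushes _ _ _ _ ud)/IH].
  case=> u [S0 [sz eS H]].
  (* [S0] still has the first bit on the target stacks; [S3] takes it off, which gives the store
     common to the situations before and after. *)
  pose S3 := fun i => if i \in dst then behead (S0 i) else S0 i.
  have dsc i : i \in dst -> i \in src = false.
    by move=> id; apply/negbTE; apply: (hasPn dj).
  have e2 i : i \in dst -> S0 i = tok b :: S2 i.
    move=> id; have := congr1 (fun f => f i) eS.
    by rewrite /ext id dsc.
  exists (b :: u), S3; split; rewrite /= ?sz //.
    apply: functional_extensionality => i.
    have := congr1 (fun f => f i) eS; rewrite /ext /S3.
    case: (boolP (i \in dst)) => [id|_]; first by rewrite dsc // e2.
    by case: ifP => // _ ->.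
  have -> : ext S3 dst (bits (rev (b :: u))) = ext S0 dst (bits (rev u)); last by [].
  apply: functional_extensionality => i; rewrite /ext /S3.
  case: (boolP (i \in dst)) => // id; rewrite (e2 _ id) /= rev_cons /bits map_rcons cat_rcons //.
case=> -[|b u] [S0 []] // [sz] -> H.
apply/wp_bit; exists b; apply/wp_seq/wp_pops => //; exists (ext S0 src (bits u)).
  by rewrite ext_cat.
apply/wp_pushes => //; apply/IH.
exists u, (ext S0 dst [:: tok b]); split=> //; first by rewrite extC.
by rewrite ext_cat; move: H; rewrite rev_cons /bits map_rcons -cats1.
Qed.

Lemma wp_xmit N src dst Q S :
  uniq src -> uniq dst -> ~~ has (mem src) dst ->
  wp N (Xmit src dst) Q S <->
  exists u S0, [/\ size u <= N, S = ext S0 src (blk u [::]) &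
                   Q (ext S0 dst (blk (rev u) [::]))].
Proof.
move=> us ud dj; have dsc i : i \in dst -> i \in src = false.
  by move=> id; apply/negbTE; apply: (hasPn dj).
rewrite /Xmit; split.
  move/wp_seq/(wp_pushes _ _ _ _ ud)/wp_seq/(wp_stream _ _ _ us ud dj)=> -[u [S0 [sz eS]]].
  case/(wp_pops _ _ _ _ us)=> S1 eS1 H.
  (* The store below the block: [S] itself on the targets, where [S1] has already received the copy,
     and [S1] elsewhere. *)
  exists u, (fun i => if i \in dst then S i else S1 i); split=> //.
    apply: functional_extensionality => i.
    have := congr1 (fun f => f i) eS; have := congr1 (fun f => f i) eS1.
    rewrite /ext /blk; case: (boolP (i \in dst)) => [id|_]; first by rewrite dsc.
    by case: ifP => [_ -> ->|_ -> ->]; rewrite -?catA.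
  suff <- : S1 = ext (fun i => if i \in dst then S i else S1 i) dst (blk (rev u) [::]) by [].
  apply: functional_extensionality => i.
  have := congr1 (fun f => f i) eS; have := congr1 (fun f => f i) eS1.
  rewrite /ext /blk; case: (boolP (i \in dst)) => [id|//]; rewrite dsc //.
  by move=> <- <-; rewrite -catA.
case=> u [S0 [sz -> H]]; apply/wp_seq/wp_pushes => //; apply/wp_seq/wp_stream => //.
exists u, (ext (ext S0 src [:: TSep]) dst [:: TSep]); split=> //.
  by rewrite -(@extC _ src dst) // ext_cat.
apply/wp_pops => //; exists (ext S0 dst (blk (rev u) [::])) => //.
by rewrite ext_cat extC.
Qed.

Lemma blk_cat u r : blk u [::] ++ r = blk u r.
Proof. by rewrite /blk -catA. Qed.

Lemma ext1 S i s : ext S [:: i] s = upd S i (s ++ S i).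
Proof.
apply: functional_extensionality => j; rewrite /ext /upd inE.
by case: eqP => // ->.
Qed.

Lemma ext2 S i j s : i != j ->
  ext S [:: i; j] s = upd (upd S i (s ++ S i)) j (s ++ S j).
Proof.
move=> ij; apply: functional_extensionality => k; rewrite /ext /upd !inE orbC.
by case: (eqVneq k j) => [->|_] //=; case: eqP => [->|].
Qed.

Lemma ext1_blk S S0 i u : S = ext S0 [:: i] (blk u [::]) ->
  exists2 r, S i = blk u r & S0 = upd S i r.
Proof.
rewrite ext1 blk_cat => ->.
by exists (S0 i); rewrite ?upd_eq // upd_upd upd_id.
Qed.

Definition Move i j := Xmit [:: i] [:: j].

Lemma wp_move N i j Q S : i != j -> wp N (Move i j) Q S <->
  exists u r, [/\ size u <= N, S i = blk u r &
                  Q (upd (upd S i r) j (blk (rev u) (S j)))].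
Proof.
move=> ij; have dj : ~~ has (mem [:: i]) [:: j] by rewrite /= inE orbF eq_sym.
apply: (iff_trans (@wp_xmit N [:: i] [:: j] Q S isT isT dj)).
split=> -[u [x [sz]]].
  case/ext1_blk=> r -> ->; rewrite ext1 blk_cat upd_neq 1?eq_sym // => H.
  by exists u, r.
move=> eS H; exists u, (upd S i x); split=> //.
  by rewrite ext1 upd_upd upd_eq blk_cat -eS upd_id.
by rewrite ext1 blk_cat upd_neq 1?eq_sym.
Qed.

(* [rI]: input bits, last bit on top; [rW]: the tokens still to be read;
   [rG]: goals awaiting the current gate; [rH]: goals for the later gates;
   [rN], [rP], [rQ]: name of the current gate and of its predecessors ([rP] is
   the value of an input gate); [rV]: value demanded of the current gate;
   [rX]: the guess for [b]; the others are scratch. *)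
Notation rI := 0 (only parsing).
Notation rW := 1 (only parsing).
Notation rG := 2 (only parsing).
Notation rH := 3 (only parsing).
Notation rN := 4 (only parsing).
Notation rP := 5 (only parsing).
Notation rQ := 6 (only parsing).
Notation rV := 7 (only parsing).
Notation rA := 8 (only parsing).
Notation rB := 9 (only parsing).
Notation rC := 10 (only parsing).
Notation rD := 11 (only parsing).
Notation rE := 12 (only parsing).
Notation rF := 13 (only parsing).
Notation rT := 14 (only parsing).
Notation rX := 15 (only parsing).

(** The detour through [rT] reverses the block twice and thereby restores its order. *)
Definition Copy i j := Move i rT ;; Xmit [:: rT] [:: i; j].

Lemma wp_copy N i j Q S : uniq [:: i; j; rT] -> wp N (Copy i j) Q S <->
  exists u r, [/\ size u <= N, S i = blk u r & Q (upd S j (blk u (S j)))].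
Proof.
rewrite /= !inE => /and3P[/norP[ij iT] jT _].
have E u r : S i = blk u r -> ext (upd S i r) [:: i; j] (blk u [::]) = upd S j (blk u (S j)).
  move=> eS; rewrite ext2 // !blk_cat upd_eq upd_upd -eS upd_id.
  by rewrite upd_neq // eq_sym.
have Ti : rT != i by rewrite eq_sym.
have dj : ~~ has (mem [:: rT]) [:: i; j] by rewrite /= !inE (negbTE iT) (negbTE jT).
have ui : uniq [:: i; j] by rewrite /= inE ij.
split.
  move/wp_seq/(wp_move _ _ _ iT)=> [u [r [sz eS]]].
  move/(wp_xmit _ _ _ (isT : uniq [:: rT]) ui dj)=> [u' [S0 [_ /ext1_blk[r']]]].
  rewrite upd_eq => /blk_inj[<- <-] ->; rewrite revK upd_upd upd_idE ?upd_neq // E // => H.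
  by exists u, r.
case=> u [r [sz eS H]]; apply/wp_seq/(wp_move _ _ _ iT).
exists u, r; split=> //; apply/(wp_xmit _ _ _ (isT : uniq [:: rT]) ui dj).
exists (rev u), (upd S i r); split; first by rewrite size_rev.
- by rewrite ext1 blk_cat upd_neq.
- by rewrite revK E.
Qed.

Definition Xfer i j := Move i rT ;; Move rT j.

Lemma wp_xfer N i j Q S : uniq [:: i; j; rT] -> wp N (Xfer i j) Q S <->
  exists u r, [/\ size u <= N, S i = blk u r &
                  Q (upd (upd S i r) j (blk u (S j)))].
Proof.
rewrite /= !inE => /and3P[/norP[ij iT] jT _].
have Tj : rT != j by rewrite eq_sym.
have Ti : rT != i by rewrite eq_sym.
have ji : j != i by rewrite eq_sym.
split.
  move/wp_seq/(wp_move _ _ _ iT)=> [u [r [sz eS]]].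
  move/(wp_move _ _ _ Tj)=> [u' [r' [_]]].
  rewrite upd_eq => /blk_inj[<- <-].
  rewrite revK upd_upd [upd _ rT _]upd_idE ?upd_neq // => H.
  by exists u, r.
case=> u [r [sz eS H]]; apply/wp_seq/(wp_move _ _ _ iT).
exists u, r; split=> //; apply/(wp_move _ _ _ Tj).
exists (rev u), (S rT); split; first by rewrite size_rev.
- by rewrite upd_eq.
- by rewrite revK upd_upd [upd _ rT _]upd_idE ?upd_neq.
Qed.

Definition Drop i := Xmit [:: i] [::].

Lemma wp_drop N i Q S : wp N (Drop i) Q S <->
  exists u r, [/\ size u <= N, S i = blk u r & Q (upd S i r)].
Proof.
apply: (iff_trans (@wp_xmit N [:: i] [::] Q S isT isT isT)).
have E S0 s : ext S0 [::] s = S0 by apply: functional_extensionality.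
split=> -[u [x [sz]]].
  by case/ext1_blk=> r -> ->; rewrite E => H; exists u, r.
move=> eS H; exists u, (upd S i x); rewrite E; split=> //.
by rewrite ext1 upd_upd upd_eq blk_cat -eS upd_id.
Qed.

Definition Guess i j := Xmit [::] [:: i; j].

Lemma wp_guess N i j Q S : i != j -> wp N (Guess i j) Q S <->
  exists2 u, size u <= N & Q (upd (upd S i (blk u (S i))) j (blk u (S j))).
Proof.
move=> ij; have ui : uniq [:: i; j] by rewrite /= inE ij.
have dj : ~~ has (mem ([::] : seq nat)) [:: i; j] by [].
apply: (iff_trans (@wp_xmit N [::] [:: i; j] Q S isT ui dj)).
have E S0 s : ext S0 [::] s = S0 by apply: functional_extensionality.
split=> [[u [x [sz]]]|[u sz]].
  by rewrite E ext2 // !blk_cat => -> H; exists (rev u); rewrite ?size_rev.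
move=> H; exists (rev u), S; rewrite E size_rev revK; split=> //.
by rewrite ext2 // !blk_cat.
Qed.

(** * Binary arithmetic *)

(** At the end of a block a zero may be read without consuming the separator, so blocks of different
    lengths can be processed in parallel. *)
Definition PopPad i (b : bool) : prog :=
  if b then pop i T1 else Alt (pop i T0) (pop i TSep ;; push i TSep).

Definition popped (b : bool) (s s' : seq token) : Prop :=
  s = tok b :: s' \/ [/\ b = false, s' = s & exists r, s = TSep :: r].

Lemma wp_poppad N i b Q S : wp N (PopPad i b) Q S <->
  exists2 s, popped b (S i) s & Q (upd S i s).
Proof.
split.
  case: b => [/wp_pop[r e H]|/wp_alt[/wp_pop[r e H]|]].
  - by exists r => //; left.
  - by exists r => //; left.
  - move/wp_seq/wp_pop=> [r e /wp_push]; rewrite upd_eq upd_upd -e => H.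
    by exists (S i) => //; right; split=> //; exists r.
case=> s [e H|[-> -> [r e] H]].
  by case: b e => e; [apply/wp_pop|apply/wp_alt; left; apply/wp_pop]; exists s.
apply/wp_alt; right; apply/wp_seq/wp_pop; exists r => //; apply/wp_push.
by rewrite upd_eq upd_upd -e.
Qed.

Lemma popped_blk b s u r : popped b s (blk u r) ->
  exists2 v, s = blk v r & num v = b + (num u).*2.
Proof.
case=> [->|[-> <- [r' e]]]; first by exists (b :: u).
exists u; rewrite // add0n; case: u e => [//|[]]; by case.
Qed.

Lemma blk_popped u r : popped (odd (num u)) (blk u r) (blk (behead u) r) /\
  num (behead u) = (num u)./2.
Proof.
case: u => [|b u] /=; first by split=> //; right; split=> //; exists r.
by rewrite oddD odd_double addbF oddb half_bit_double; split=> //; left.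
Qed.

Definition maj (a b c : bool) := (a && b) || (a && c) || (b && c).

Definition AddBit : prog :=
  Bit (fun c => Bit (fun x => Bit (fun y =>
    pop rT (tok c) ;; PopPad rD x ;; PopPad rE y ;;
    PopPad rF (x (+) y (+) c) ;; push rT (tok (maj x y c))))).

(* Destroys the blocks [x], [y], [z] on [rD], [rE], [rF] and checks
   [x + y + c = z]; the carry lives on [rT]. *)
Definition Add (c : bool) : prog :=
  push rT (tok c) ;; Star AddBit ;;
  pop rT T0 ;; pop rD TSep ;; pop rE TSep ;; pop rF TSep.

Lemma wp_addbit N Q S : wp N AddBit Q S <->
  exists c x y t d e f, [/\ S rT = tok c :: t, popped x (S rD) d,
    popped y (S rE) e, popped (x (+) y (+) c) (S rF) f &
    Q (upd (upd (upd (upd S rT (tok (maj x y c) :: t)) rD d) rE e) rF f)].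
Proof.
split.
  case/wp_bit=> c /wp_bit[x /wp_bit[y]].
  case/wp_seq/wp_pop=> t eT /wp_seq/wp_poppad[d pd] /wp_seq/wp_poppad[e pe].
  case/wp_seq/wp_poppad=> f pf /wp_push H.
  exists c, x, y, t, d, e, f; split=> //.
  move: H; congr Q; by upd_ext.
case=> c [x [y [t [d [e [f [eT pd pe pf H]]]]]]].
apply/wp_bit; exists c; apply/wp_bit; exists x; apply/wp_bit; exists y.
apply/wp_seq/wp_pop; exists t => //; apply/wp_seq/wp_poppad; exists d => //.
apply/wp_seq/wp_poppad; exists e => //; apply/wp_seq/wp_poppad; exists f => //.
apply/wp_push; move: H; congr Q; by upd_ext.
Qed.

Definition add_end : prog :=
  pop rT T0 ;; pop rD TSep ;; pop rE TSep ;; pop rF TSep.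

Lemma add_iter_sound N n Q S : iter n (wp N AddBit) (wp N add_end Q) S ->
  exists (c : bool) x y z t d e f, [/\ S rT = tok c :: t,
    S rD = blk x d, S rE = blk y e, S rF = blk z f &
    num x + num y + c = num z /\
    Q (upd (upd (upd (upd S rT t) rD d) rE e) rF f)].
Proof.
elim: n S => [|n IH] S.
  case/wp_seq/wp_pop=> t eT /wp_seq/wp_pop[d eD] /wp_seq/wp_pop[e eE] /wp_pop[f eF H].
  by exists false, [::], [::], [::], t, d, e, f; split=> //; split=> //.
rewrite iterS => /wp_addbit[c [x [y [t [d0 [e0 [f0 [eT pD pE pF]]]]]]]].
case/IH=> c' [x' [y' [z' [t' [d [e [f [eT' eD eE eF [xyz HQ]]]]]]]]].
move: eT' eD eE eF; rewrite /upd /= => -[/tok_inj ec' et] eD eE eF.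
rewrite eD in pD; rewrite eE in pE; rewrite eF in pF.
have [u eu nu] := popped_blk pD; have [v ev nv] := popped_blk pE.
have [w ew nw] := popped_blk pF.
exists c, u, v, w, t, d, e, f; split=> //; split.
  rewrite nu nv nw -xyz -ec'.
  by case: (x) (y) (c) => [] [] []; rewrite /maj /=; lia.
by move: HQ; congr Q; rewrite -et; upd_ext.
Qed.

Lemma wp_add_sound N c Q S : wp N (Add c) Q S ->
  exists x y z d e f, [/\ S rD = blk x d, S rE = blk y e, S rF = blk z f,
    num x + num y + c = num z & Q (upd (upd (upd S rD d) rE e) rF f)].
Proof.
move/wp_seq/wp_push/wp_seq/wp_star=> [n _ /add_iter_sound].
case=> c' [x [y [z [t [d [e [f [eT eD eE eF [xyz]]]]]]]]].
move: eT; rewrite upd_eq upd_upd => -[/tok_inj ec <-]; rewrite upd_id => HQ.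
by exists x, y, z, d, e, f; rewrite ec.
Qed.

(** Padding supplies zeros without limit, so the number of rounds can be any common bound of the
    three lengths; after them the blocks are empty and the carry must be 0. *)
Lemma add_iter_complete N n (c : bool) x y z t d e f (Q : stacks -> Prop) S :
  S rT = tok c :: t -> S rD = blk x d -> S rE = blk y e -> S rF = blk z f ->
  size x <= n -> size y <= n -> size z <= n -> num x + num y + c = num z ->
  Q (upd (upd (upd (upd S rT t) rD d) rE e) rF f) ->
  iter n (wp N AddBit) (wp N add_end Q) S.
Proof.
elim: n c x y z S => [|n IH] c x y z S eT eD eE eF.
  rewrite !leqn0 => /nilP ex /nilP ey /nilP ez; subst x y z.
  rewrite /= !add0n => c0 HQ; case: c c0 eT => // _ eT.
  apply/wp_seq/wp_pop; exists t => //; apply/wp_seq/wp_pop; exists d => //.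
  by apply/wp_seq/wp_pop; exists e => //; apply/wp_pop; exists f.
move=> sx sy sz xyz HQ; rewrite iterS; apply/wp_addbit.
have [pD nx] := blk_popped x d; have [pE ny] := blk_popped y e.
have [pF nz] := blk_popped z f.
exists c, (odd (num x)), (odd (num y)), t, (blk (behead x) d), (blk (behead y) e),
  (blk (behead z) f); split=> //.
- by rewrite eD.
- by rewrite eE.
- rewrite eF; move: pF; congr popped.
  by rewrite -xyz !oddD; case: (c).
apply: (IH (maj (odd (num x)) (odd (num y)) c) (behead x) (behead y) (behead z)) => //.
- by rewrite size_behead; lia.
- by rewrite size_behead; lia.
- by rewrite size_behead; lia.
- rewrite nx ny nz -xyz; move: (odd_double_half (num x)) (odd_double_half (num y)).
  by case: (odd (num x)) (odd (num y)) (c) => [] [] []; rewrite /maj /=; lia.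
- by move: HQ; congr Q; upd_ext.
Qed.

Lemma wp_add_complete N (c : bool) (Q : stacks -> Prop) S x y z d e f :
  S rD = blk x d -> S rE = blk y e -> S rF = blk z f ->
  size x <= N -> size y <= N -> size z <= N ->
  num x + num y + c = num z -> Q (upd (upd (upd S rD d) rE e) rF f) ->
  wp N (Add c) Q S.
Proof.
move=> eD eE eF sx sy sz xyz HQ.
apply/wp_seq/wp_push/wp_seq/wp_star; exists N => //.
apply: (@add_iter_complete N N c x y z (S rT) d e f) => //.
by rewrite upd_upd upd_id.
Qed.

Lemma wp_guess1 N i Q S : wp N (Xmit [::] [:: i]) Q S <->
  exists2 u, size u <= N & Q (upd S i (blk u (S i))).
Proof.
have dj : ~~ has (mem ([::] : seq nat)) [:: i] by [].
apply: (iff_trans (@wp_xmit N [::] [:: i] Q S isT isT dj)).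
have E S0 s : ext S0 [::] s = S0 by apply: functional_extensionality.
split=> [[u [x [sz]]]|[u sz]].
  by rewrite E ext1 blk_cat => -> H; exists (rev u); rewrite ?size_rev.
move=> H; exists (rev u), S; rewrite E size_rev revK; split=> //.
by rewrite ext1 blk_cat.
Qed.

(* The comparisons consume a block [x] on [rD] and a block [y] on [rF]. *)
Definition Cmp (c : bool) := Xmit [::] [:: rE] ;; Add c.
Definition Eq := push rE TSep ;; Add false.
Definition Neq :=
  Alt (Cmp true) (Xfer rD rE ;; Xfer rF rD ;; Xfer rE rF ;; Cmp true).

(** The guessed summand is the slack between the two numbers, and a carry-in of [true] makes the
    comparison strict. *)
Lemma wp_cmp_sound N c Q S : wp N (Cmp c) Q S ->
  exists x y d f, [/\ S rD = blk x d, S rF = blk y f, num x + c <= num y &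
                      Q (upd (upd S rD d) rF f)].
Proof.
move/wp_seq/wp_guess1=> [w _] /wp_add_sound[x [y [z [d [e [f []]]]]]].
rewrite /upd /= => eD /blk_inj[_ <-] eF xyz H.
exists x, z, d, f; split=> //; first by lia.
by move: H; congr Q; upd_ext.
Qed.

Definition lsb (n : nat) : seq bool := rev (bin n).

Lemma num_bin_aux f n : n <= f -> num (rev (bin_aux f n)) = n.
Proof.
elim: f n => [|f IH] [|n] // nf; rewrite /= rev_rcons /= IH; last by lia.
by rewrite -[RHS]odd_double_half.
Qed.

Lemma num_lsb n : num (lsb n) = n.
Proof. by rewrite /lsb; case: n => // n; apply: num_bin_aux. Qed.

Lemma size_bin_aux f n m : n < 2 ^ m -> size (bin_aux f n) <= m.
Proof.
elim: f n m => [|f IH] [|n] [|m] //=; rewrite ?expn0 //.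
by rewrite expnS size_rcons ltnS => h; apply: IH; lia.
Qed.

(** The condition [0 < m] is for [n = 0], which is written with the one digit 0. *)
Lemma size_lsb n m : n < 2 ^ m -> 0 < m -> size (lsb n) <= m.
Proof.
by rewrite size_rev; case: n => [|n] // h _; apply: size_bin_aux.
Qed.

Lemma num_bound u : num u < 2 ^ size u.
Proof. by elim: u => //= b u; rewrite expnS; case: b => /=; lia. Qed.

Lemma wp_cmp_complete N (c : bool) x y d f (Q : stacks -> Prop) S :
  S rD = blk x d -> S rF = blk y f -> 0 < N -> size x <= N -> size y <= N ->
  num x + c <= num y -> Q (upd (upd S rD d) rF f) -> wp N (Cmp c) Q S.
Proof.
move=> eD eF N0 sx sy xy H.
have sw : size (lsb (num y - c - num x)) <= N.
  apply: size_lsb N0; apply: (@leq_trans (2 ^ size y)); last by rewrite leq_exp2l.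
  by have := num_bound y; lia.
apply/wp_seq/wp_guess1; exists (lsb (num y - c - num x)) => //.
apply: (@wp_add_complete N c _ _ x (lsb (num y - c - num x)) y d (S rE) f) => //.
  by rewrite num_lsb; lia.
by move: H; congr Q; upd_ext.
Qed.

Lemma wp_eq_sound N Q S : wp N Eq Q S ->
  exists x y d f, [/\ S rD = blk x d, S rF = blk y f, num x = num y &
                      Q (upd (upd S rD d) rF f)].
Proof.
move/wp_seq/wp_push/wp_add_sound=> [x [y [z [d [e [f []]]]]]].
rewrite /upd /= => eD eE eF xyz H.
have [ey ee] := @blk_inj [::] y _ _ eE.
exists x, z, d, f; split=> //; first by move: xyz; rewrite -ey /=; lia.
by move: H; rewrite -ee; congr Q; upd_ext.
Qed.

Lemma wp_eq_complete N x y d f (Q : stacks -> Prop) S :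
  S rD = blk x d -> S rF = blk y f -> size x <= N -> size y <= N ->
  num x = num y -> Q (upd (upd S rD d) rF f) -> wp N Eq Q S.
Proof.
move=> eD eF sx sy xy H; apply/wp_seq/wp_push.
apply: (@wp_add_complete N false _ _ x [::] y d (S rE) f) => //.
  by rewrite /= !addn0.
by move: H; congr Q; upd_ext.
Qed.

Lemma wp_neq_sound N Q S : wp N Neq Q S ->
  exists x y d f, [/\ S rD = blk x d, S rF = blk y f, num x <> num y &
                      Q (upd (upd S rD d) rF f)].
Proof.
case/wp_alt=> [/wp_cmp_sound[x [y [d [f [eD eF xy H]]]]]|].
  by exists x, y, d, f; split=> //; lia.
move/wp_seq/(wp_xfer _ _ _ (isT : uniq [:: rD; rE; rT])) => [x [d [_ eD]]].
move/wp_seq/(wp_xfer _ _ _ (isT : uniq [:: rF; rD; rT])) => [y [f [_ eF]]].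
move/wp_seq/(wp_xfer _ _ _ (isT : uniq [:: rE; rF; rT])) => [x' [e [_ eE]]].
move: eD eF eE; rewrite /upd /= => eD eF /blk_inj[<- <-].
move/wp_cmp_sound=> [x'' [y'' [d' [f' []]]]].
rewrite /upd /= => /blk_inj[<- <-] /blk_inj[<- <-] xy H.
exists x, y, d, f; split=> //; first by lia.
by move: H; congr Q; upd_ext.
Qed.

Lemma wp_neq_complete N x y d f (Q : stacks -> Prop) S :
  S rD = blk x d -> S rF = blk y f -> 0 < N -> size x <= N -> size y <= N ->
  num x <> num y -> Q (upd (upd S rD d) rF f) -> wp N Neq Q S.
Proof.
move=> eD eF N0 sx sy xy H; apply/wp_alt.
have [lt_xy|lt_yx|//] := ltngtP (num x) (num y).
  by left; apply: wp_cmp_complete eD eF _ _ _ _ H; rewrite ?addn1.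
right; apply/wp_seq/(wp_xfer _ _ _ (isT : uniq [:: rD; rE; rT])).
exists x, d; split=> //.
apply/wp_seq/(wp_xfer _ _ _ (isT : uniq [:: rF; rD; rT])); exists y, f; split=> //.
apply/wp_seq/(wp_xfer _ _ _ (isT : uniq [:: rE; rF; rT])); exists x, (S rE); split=> //.
apply: (@wp_cmp_complete N true y x d f); rewrite ?addn1 //.
by move: H; congr Q; upd_ext.
Qed.

Local Arguments PopPad : simpl never.
(** For a digit 1 the guess is [z - y]: the copy on [rE] is used up by the check that adding [y]
    gives [z], the copy on [rA] becomes the new [z]. In both branches [PopPad] halves [z] and forces
    it to be even. *)
Definition MulBit : prog :=
  Alt (pop rB T0 ;; PopPad rV false)
      (pop rB T1 ;; Copy rC rD ;; Guess rE rA ;; Xfer rV rF ;; Add false ;;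
       Xfer rA rV ;; PopPad rV false).
Definition mul_end : prog :=
  pop rB TSep ;; Drop rC ;; push rD TSep ;; Xfer rV rF ;; Eq.

(* Consumes blocks [x], [y], [z] on [rB], [rC], [rV] and checks [x * y = z]:
   each round removes the lowest bit [b] of [x] and replaces [z] by
   [(z - b * y) / 2]. *)
Definition Mul : prog := Star MulBit ;; mul_end.

Lemma mul_iter_sound N n Q S : iter n (wp N MulBit) (wp N mul_end Q) S ->
  exists x y z b c v, [/\ S rB = blk x b, S rC = blk y c, S rV = blk z v,
    num x * num y = num z & Q (upd (upd (upd S rB b) rC c) rV v)].
Proof.
elim: n S => [|n IH] S.
  case/wp_seq/wp_pop=> b eB /wp_seq/wp_drop[y [c [_ eC]]] /wp_seq/wp_push.
  move/wp_seq/(wp_xfer _ _ _ (isT : uniq [:: rV; rF; rT])) => [z [v [_ eV]]].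
  case/wp_eq_sound=> x [z' [d [f []]]]; move: eC eV; rewrite /upd /=.
  move=> eC eV /(@blk_inj [::])[<- <-] /blk_inj[<- <-] ez H.
  exists [::], y, z, b, c, v; split=> //; move: H; congr Q; upd_ext.
rewrite iterS => /wp_alt[].
  case/wp_seq/wp_pop=> b eB /wp_poppad[v pV].
  case/IH=> x [y [z [b' [c [v' []]]]]]; rewrite /upd /= => eB' eC eV xyz H.
  rewrite eV in pV; have [w ew nw] := popped_blk pV.
  exists (false :: x), y, w, b', c, v'; split=> //.
  - by rewrite eB eB'.
  - by rewrite nw /= -xyz !add0n doubleMl.
  - by move: H; congr Q; upd_ext.
case/wp_seq/wp_pop=> b eB.
move/wp_seq/(wp_copy _ _ _ (isT : uniq [:: rC; rD; rT])) => [y [c [_ eC]]].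
move/wp_seq/(wp_guess _ _ _ (isT : rE != rA)) => [w _].
move/wp_seq/(wp_xfer _ _ _ (isT : uniq [:: rV; rF; rT])) => [z [v [_ eV]]].
move/wp_seq/wp_add_sound=> [y' [w' [z' [d [e [f []]]]]]].
move: eC eV; rewrite /upd /= => eC eV /blk_inj[<- <-] /blk_inj[<- <-] /blk_inj[<- <-].
rewrite addn0 => ywz.
move/wp_seq/(wp_xfer _ _ _ (isT : uniq [:: rA; rV; rT])) => [w2 [a [_]]].
move=> /= /blk_inj[<- <-] /wp_poppad[v2 pV].
case/IH=> x [y2 [z2 [b' [c' [v' []]]]]].
rewrite /upd /= eC => eB' /blk_inj[<- ec] eV' xyz H.
rewrite /upd /= eV' in pV; have [w3 ew nw] := popped_blk pV.
have [ew3 ev3] := blk_inj ew; subst w3 v'.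
exists (true :: x), y, z, b', c, v; split=> //.
- by rewrite eB eB'.
- by rewrite /= -ywz nw mulnDl mul1n -xyz !doubleMl add0n.
- by move: H; rewrite -ec; congr Q; upd_ext.
Qed.

Lemma wp_mul_sound N Q S : wp N Mul Q S ->
  exists x y z b c v, [/\ S rB = blk x b, S rC = blk y c, S rV = blk z v,
    num x * num y = num z & Q (upd (upd (upd S rB b) rC c) rV v)].
Proof. by move/wp_seq/wp_star=> [n _ /mul_iter_sound]. Qed.

Lemma mul_iter_complete N x y z b c v (Q : stacks -> Prop) S :
  S rB = blk x b -> S rC = blk y c -> S rV = blk z v ->
  0 < N -> size y <= N -> size z <= N -> num x * num y = num z ->
  Q (upd (upd (upd S rB b) rC c) rV v) ->
  iter (size x) (wp N MulBit) (wp N mul_end Q) S.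
Proof.
move=> eB eC eV N0 sy; elim: x z S eB eC eV => [|[] x IH] z S eB eC eV sz xyz H.
- apply/wp_seq/wp_pop; exists b => //; apply/wp_seq/wp_drop.
  exists y, c; split=> //; apply/wp_seq/wp_push.
  apply/wp_seq/(wp_xfer _ _ _ (isT : uniq [:: rV; rF; rT])).
  exists z, v; split=> //.
  apply: (@wp_eq_complete N [::] z (S rD) (S rF)) => //.
  by move: H; congr Q; upd_ext.
(* [w] is the product of the remaining digits with [y]; after subtracting [y], what is left of [z]
   is twice this product. *)
- have [w wz] : exists w, num z = num y + w.*2.
    by exists (num x * num y); rewrite -xyz /= doubleMl mulnDl mul1n.
  have sw : size (lsb w.*2) <= N.
    apply: size_lsb N0; apply: (@leq_trans (2 ^ size z)); last by rewrite leq_exp2l.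
    by have := num_bound z; lia.
  rewrite iterS; apply/wp_alt; right; apply/wp_seq/wp_pop; exists (blk x b) => //.
  apply/wp_seq/(wp_copy _ _ _ (isT : uniq [:: rC; rD; rT])); exists y, c; split=> //.
  apply/wp_seq/(wp_guess _ _ _ (isT : rE != rA)); exists (lsb w.*2) => //.
  apply/wp_seq/(wp_xfer _ _ _ (isT : uniq [:: rV; rF; rT])); exists z, v; split=> //.
  apply/wp_seq/(@wp_add_complete N false _ _ y (lsb w.*2) z (S rD) (S rE) (S rF)) => //.
    by rewrite num_lsb addn0.
  apply/wp_seq/(wp_xfer _ _ _ (isT : uniq [:: rA; rV; rT])).
  exists (lsb w.*2), (S rA); split=> //.
  have [pV nV] := blk_popped (lsb w.*2) v.
  move: pV nV; rewrite !num_lsb odd_double half_double => pV nV.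
  apply/wp_poppad; exists (blk (behead (lsb w.*2)) v) => //.
  apply: (IH (behead (lsb w.*2))) => //.
  + by rewrite size_behead; lia.
  + by rewrite nV; move: xyz; rewrite /= wz mulnDl mul1n -doubleMl; lia.
  + by move: H; congr Q; upd_ext.
- have [pV nV] := blk_popped z v.
  have ez : odd (num z) = false by rewrite -xyz /= add0n -doubleMl odd_double.
  rewrite iterS; apply/wp_alt; left; apply/wp_seq/wp_pop; exists (blk x b) => //.
  apply/wp_poppad; exists (blk (behead z) v); first by rewrite -ez /upd /= eV.
  apply: (IH (behead z)) => //.
  + by rewrite size_behead; lia.
  + by rewrite nV -xyz /= add0n -doubleMl half_double.
  + by move: H; congr Q; upd_ext.
Qed.

Lemma wp_mul_complete N x y z b c v (Q : stacks -> Prop) S :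
  S rB = blk x b -> S rC = blk y c -> S rV = blk z v ->
  0 < N -> size x <= N -> size y <= N -> size z <= N -> num x * num y = num z ->
  Q (upd (upd (upd S rB b) rC c) rV v) -> wp N Mul Q S.
Proof.
move=> eB eC eV N0 sx sy sz xyz H; apply/wp_seq/wp_star; exists (size x) => //.
exact: mul_iter_complete eB eC eV N0 sy sz xyz H.
Qed.

(** * Parsing canonical numerals *)

Definition Digits d := Stream [:: rW] [:: d].
(** A numeral is a lone 0 or starts with 1, so leading zeros, which [bin] never produces, are
    rejected. Digits come most significant first, which leaves the least significant one on top, as
    blocks require. *)
Definition Parse d : prog :=
  push d TSep ;;
  Alt (pop rW T0 ;; push d T0) (pop rW T1 ;; push d T1 ;; Digits d).

Lemma num_rcons_gt0 u : 0 < num (rcons u true).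
Proof. by elim: u => //= b u; lia. Qed.

(** Any word with a leading one is the numeral of its own value; hence what the parser accepts is
    literally a [binT]. *)
Lemma bin_aux_lead u f : num (rcons u true) <= f ->
  bin_aux f (num (rcons u true)) = true :: rev u.
Proof.
have pos := num_rcons_gt0.
elim: u f => [|b u IH] [|f] //=.
- by case: f => [|f].
- by have := pos u; lia.
move=> hf; case En: (b + _) hf => [|m] hf; first by have := pos u; lia.
rewrite -En oddD odd_double addbF oddb half_bit_double rev_cons -rcons_cons.
by rewrite IH //; move: hf; rewrite -En; have := pos u; lia.
Qed.

Lemma bin_lead u : bin (num (rcons u true)) = true :: rev u.
Proof.
rewrite -(bin_aux_lead (leqnn _)) /bin.
by case: (num _) (num_rcons_gt0 u).
Qed.

Lemma bin_head n : n != 0 -> exists u, bin n = true :: u.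
Proof.
have aux f m : 0 < m <= f -> exists u, bin_aux f m = true :: u.
  elim: f m => [|f IH] [|m] //= mf.
  case: m mf => [|m] mf; first by exists [::]; case: (f).
  have [|u ->] := IH (uphalf m.+1); first by move: mf; rewrite /=; lia.
  by exists (rcons u (~~ odd m.+1)).
by case: n => // n _; apply: aux; rewrite leqnn.
Qed.

(** The length bound is [N.+1] because the leading digit is read outside the star. *)
Lemma wp_parse N d Q S : d != rW -> wp N (Parse d) Q S <->
  exists n r, [/\ size (bin n) <= N.+1, S rW = binT n ++ r &
    Q (upd (upd S rW r) d (blk (lsb n) (S d)))].
Proof.
move=> dW; have Wd : rW != d by rewrite eq_sym.
have dj : ~~ has (mem [:: rW]) [:: d] by rewrite /= inE orbF.
split.
  move/wp_seq/wp_push/wp_alt; case.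
    move=> /wp_seq/wp_pop[r]; rewrite upd_neq // => eW /wp_push.
    rewrite upd_neq // upd_eq [upd (upd _ _ _) _ _]updC // upd_upd => H.
    by exists 0, r; split=> //; rewrite updC.
  move/wp_seq/wp_pop=> [r]; rewrite upd_neq // => eW /wp_seq/wp_push.
  move/(wp_stream _ _ _ (isT : uniq [:: rW]) (isT : uniq [:: d]) dj).
  case=> u [S0 [su eS H]].
  exists (num (rcons (rev u) true)), (S0 rW).
  rewrite /binT /lsb bin_lead revK; split=> //.
    have := congr1 (fun f => f rW) eS; rewrite ext1 /upd eqxx (negbTE Wd) /=.
    by rewrite eW => ->.
  move: H; rewrite ext1; congr Q; apply: functional_extensionality => k.
  have := congr1 (fun f => f k) eS; have := congr1 (fun f => f d) eS.
  rewrite ext1 /upd !eqxx ?(negbTE dW) ?(negbTE Wd) /=.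
  case: (eqVneq k d) => [->|kd].
    by move=> <- _; rewrite /blk rev_cons /bits map_rcons -cats1 -catA.
  by case: (eqVneq k rW) => [->|_] _ // ->.
case=> n [r [sn eW H]]; apply/wp_seq/wp_push/wp_alt.
case: (eqVneq n 0) sn eW H => [->|n0].
  move=> _ eW H; left; apply/wp_seq/wp_pop; exists r; first by rewrite upd_neq.
  apply/wp_push; move: H; rewrite upd_neq // upd_eq; congr Q.
  by rewrite (updC _ _ _ dW) upd_upd.
have [u eu] := bin_head n0; rewrite /binT /lsb eu /= ltnS => su eW H; right.
apply/wp_seq/wp_pop; exists (bits u ++ r); first by rewrite upd_neq.
apply/wp_seq/wp_push.
apply/(wp_stream _ _ _ (isT : uniq [:: rW]) (isT : uniq [:: d]) dj).
exists u, (upd (upd S rW r) d (T1 :: TSep :: S d)); split=> //.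
  rewrite ext1; apply: functional_extensionality => k; rewrite /upd !eqxx ?(negbTE dW) ?(negbTE Wd).
  by case: (eqVneq k d) => [->|kd]; rewrite ?(negbTE dW) //; case: (k == rW).
move: H; congr Q; rewrite ext1; apply: functional_extensionality => k.
rewrite /upd !eqxx; case: eqP => // _.
by rewrite /blk rev_cons /bits map_rcons -cats1 -catA.
Qed.

(** * Goals and gates *)

Notation kVal := TIn (only parsing).
Notation kNeed := TOpen (only parsing).
Notation kNot := TClose (only parsing).

(* A goal [(k, x, v)] asserts, for [k] equal to [kVal], [kNeed], [kNot]
   respectively: [num v \in I(num x)], there is a gate named [num x], there is
   none ([v] is then irrelevant). *)
Definition goal := (token * seq bool * seq bool)%type.

Definition enc_goal (a : goal) (r : seq token) : seq token :=
  a.1.1 :: blk a.1.2 (blk a.2 r).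
Definition enc_goals (l : seq goal) (r : seq token) := foldr enc_goal r l.

Definition holds (gs : seq gate) (a : goal) : Prop :=
  match a.1.1 with
  | kVal => sem gs (num a.1.2) (num a.2)
  | kNeed => num a.1.2 \in map gname gs
  | kNot => num a.1.2 \notin map gname gs
  | _ => False
  end.

Definition small N (a : goal) : bool := (size a.1.2 <= N) && (size a.2 <= N).

Lemma holds_cons gs a l : (forall b, b \in a :: l -> holds gs b) <->
  holds gs a /\ (forall b, b \in l -> holds gs b).
Proof.
split=> [H|[Ha Hl] b]; last by rewrite inE => /predU1P[->|/Hl].
by split=> [|b bl]; apply: H; rewrite inE ?eqxx ?bl ?orbT.
Qed.

(** Expects the value already on top of [rH]; name and kind are put above it to complete a goal. *)
Definition EmitV i := Copy i rH ;; push rH kVal.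

Lemma wp_emit N i Q S : i \in [:: rP; rQ] -> wp N (EmitV i) Q S <->
  exists u r, [/\ size u <= N, S i = blk u r &
                  Q (upd S rH (kVal :: blk u (S rH)))].
Proof.
move=> iPQ; have ui : uniq [:: i; rH; rT] by move: iPQ; rewrite !inE => /orP[]/eqP->.
split.
  move/wp_seq/(wp_copy _ _ _ ui)=> [u [r [su e]]] /wp_push.
  by rewrite upd_eq upd_upd => H; exists u, r.
case=> u [r [su e H]]; apply/wp_seq/(wp_copy _ _ _ ui); exists u, r; split=> //.
by apply/wp_push; rewrite upd_eq upd_upd.
Qed.

(** Each guess is written twice, to a scratch register for the arithmetic check and into a new goal,
    so that both speak of the same number. *)
Definition Guesses i j := Guess rB rH ;; EmitV i ;; Guess rC rH ;; EmitV j.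

Lemma wp_guesses N i j Q S : i \in [:: rP; rQ] -> j \in [:: rP; rQ] ->
  wp N (Guesses i j) Q S <->
  exists x y u v r s, [/\ size x <= N, size y <= N,
    size u <= N /\ S i = blk u r, size v <= N /\ S j = blk v s &
    Q (upd (upd (upd S rB (blk x (S rB))) rC (blk y (S rC))) rH
           (enc_goals [:: (kVal, v, y); (kVal, u, x)] (S rH)))].
Proof.
move=> iPQ jPQ.
have nPQ k : k \in [:: rP; rQ] -> [/\ k != rB, k != rC & k != rH].
  by rewrite !inE => /orP[]/eqP->.
have [iB iC iH] := nPQ _ iPQ; have [jB jC jH] := nPQ _ jPQ.
split.
  move/wp_seq/(wp_guess _ _ _ (isT : rB != rH))=> [x sx].
  move/wp_seq/(wp_emit _ _ _ iPQ)=> [u [r [su]]]; rewrite (upd_neq _ _ iH) (upd_neq _ _ iB) => eu.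
  move/wp_seq/(wp_guess _ _ _ (isT : rC != rH))=> [y sy].
  move/(wp_emit _ _ _ jPQ)=> [v [s [sv]]].
  rewrite (upd_neq _ _ jH) (upd_neq _ _ jC) 2!(upd_neq _ _ jH) (upd_neq _ _ jB) => ev H.
  exists x, y, u, v, r, s; split=> //; move: H; congr Q; upd_ext.
case=> x [y [u [v [r [s [sx sy [su eu] [sv ev] H]]]]]].
apply/wp_seq/(wp_guess _ _ _ (isT : rB != rH)); exists x => //.
apply/wp_seq/(wp_emit _ _ _ iPQ); exists u, r.
rewrite (upd_neq _ _ iH) (upd_neq _ _ iB); split=> //.
apply/wp_seq/(wp_guess _ _ _ (isT : rC != rH)); exists y => //.
apply/(wp_emit _ _ _ jPQ); exists v, s.
rewrite (upd_neq _ _ jH) (upd_neq _ _ jC) 2!(upd_neq _ _ jH) (upd_neq _ _ jB); split=> //.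
by move: H; congr Q; upd_ext.
Qed.

(* An expansion replaces the block on [rV], a value demanded of the current
   gate, by goals on [rH] about its predecessors; [P] and [Q] hold what the
   stacks [rP] and [rQ] contain, and [R rest] is the result set of the gate
   when [rest] are the gates listed after it. *)
Record expands (E : prog) (P Q : seq token) (R : seq gate -> nat -> Prop) (M : nat) : Prop := {
  expands_sound N K S : S rP = P -> S rQ = Q -> wp N E K S ->
    exists v r l, [/\ S rV = blk v r,
      forall rest, (forall b, b \in l -> holds rest b) -> R rest (num v) &
      K (upd (upd S rV r) rH (enc_goals l (S rH)))];
  expands_complete N rest v r (K : stacks -> Prop) S :
    S rP = P -> S rQ = Q -> S rV = blk v r -> size v <= N -> 0 < N -> M <= N ->
    (forall x y, sem rest x y -> y < 2 ^ N) -> R rest (num v) ->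
    (forall l, (forall b, b \in l -> holds rest b) -> size l <= 2 -> all (small N) l ->
      K (upd (upd S rV r) rH (enc_goals l (S rH)))) ->
    wp N E K S }.

Definition ExpandIn := Copy rP rD ;; Xfer rV rF ;; Eq.

Lemma expand_in a P Q : expands ExpandIn (blk (lsb a) P) Q (fun _ c => c = a) (size (lsb a)).
Proof.
split.
  move=> N K S eP eQ.
  move/wp_seq/(wp_copy _ _ _ (isT : uniq [:: rP; rD; rT]))=> [u [r [_]]].
  rewrite eP => /blk_inj[<- _].
  move/wp_seq/(wp_xfer _ _ _ (isT : uniq [:: rV; rF; rT])) => [v [s [_]]].
  rewrite /upd /= => eV /wp_eq_sound[x [y [d [f []]]]].
  rewrite /upd /= => /blk_inj[<- <-] /blk_inj[<- <-]; rewrite num_lsb => e H.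
  exists v, s, [::]; split=> //; move: H; congr K; upd_ext.
move=> N rest v r K S eP eQ eV sv N0 sa _ e H.
apply/wp_seq/(wp_copy _ _ _ (isT : uniq [:: rP; rD; rT])); exists (lsb a), P; split=> //.
apply/wp_seq/(wp_xfer _ _ _ (isT : uniq [:: rV; rF; rT])); exists v, r; split=> //.
apply: (@wp_eq_complete N (lsb a) v (S rD) (S rF)) => //; first by rewrite num_lsb.
have := H [::] (fun b => ltac:(done)) isT isT; congr K; upd_ext.
Qed.

Definition binop (f : (nat -> Prop) -> (nat -> Prop) -> nat -> Prop) p q
  (rest : seq gate) : nat -> Prop := f (sem rest (minn p q)) (sem rest (maxn p q)).

(** The semantics orders the predecessors by name, whereas the encoding lists them in any order; for
    a commutative operation the two readings agree. *)
Lemma binop_sym f p q rest c : (forall A B c, f A B c -> f B A c) ->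
  binop f p q rest c <-> f (sem rest p) (sem rest q) c.
Proof.
by move=> sym; rewrite /binop; case: (leqP p q) => _; split=> //; apply: sym.
Qed.

Notation vgoal u v := ((kVal, u, v) : goal).

Definition name_size p q := maxn (size (lsb p)) (size (lsb q)).

Section Expansions.
Variables (p q : nat) (sp sq : seq token).
Let u := lsb p.
Let w := lsb q.
Let P := blk u sp.
Let Q := blk w sq.
Let M := name_size p q.
Notation expands_op E f := (expands E P Q (binop f p q) M).

Lemma holds_val rest u0 v l :
  (forall b, b \in vgoal u0 v :: l -> holds rest b) ->
  sem rest (num u0) (num v) /\ (forall b, b \in l -> holds rest b).
Proof. by move/holds_cons. Qed.

Lemma holds_val1 rest u1 v1 : sem rest (num u1) (num v1) ->
  forall b, b \in [:: vgoal u1 v1] -> holds rest b.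
Proof. by move=> h b; rewrite inE => /eqP->. Qed.

Lemma holds_vals rest u1 v1 u2 v2 : sem rest (num u1) (num v1) ->
  sem rest (num u2) (num v2) ->
  forall b, b \in [:: vgoal u1 v1; vgoal u2 v2] -> holds rest b.
Proof.
by move=> h1 h2 b; rewrite !inE => /orP[]/eqP->.
Qed.

Lemma size_names N : M <= N -> size u <= N /\ size w <= N.
Proof. by rewrite geq_max => /andP[]. Qed.

Definition ExpandCup := Xfer rV rH ;; Alt (EmitV rP) (EmitV rQ).

Lemma expand_cup : expands_op ExpandCup Defs.setU.
Proof.
have sym A B c : Defs.setU A B c -> Defs.setU B A c by case; [right|left].
split.
  move=> N K S eP eQ.
  move/wp_seq/(wp_xfer _ _ _ (isT : uniq [:: rV; rH; rT])) => [v [r [_ eV]]].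
  case/wp_alt=> [/(wp_emit _ _ _ (isT : rP \in [:: rP; rQ]))|
                 /(wp_emit _ _ _ (isT : rQ \in [:: rP; rQ]))] [u' [r' [_]]];
    rewrite /upd /= ?eP ?eQ => /blk_inj[<- _] H.
    exists v, r, [:: vgoal u v]; split=> //; last by move: H; congr K; upd_ext.
    by move=> rest /holds_val[h _]; apply/binop_sym=> //; left; rewrite -(num_lsb p).
  exists v, r, [:: vgoal w v]; split=> //; last by move: H; congr K; upd_ext.
  by move=> rest /holds_val[h _]; apply/binop_sym=> //; right; rewrite -(num_lsb q).
move=> N rest v r K S eP eQ eV sv N0 /size_names[su sw] bd /(binop_sym _ _ _ _ sym) h H.
apply/wp_seq/(wp_xfer _ _ _ (isT : uniq [:: rV; rH; rT])); exists v, r; split=> //.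
rewrite -(num_lsb p) -(num_lsb q) in h.
apply/wp_alt; case: h => h; [left|right].
  apply/(wp_emit _ _ _ (isT : rP \in [:: rP; rQ])); exists u, sp; split=> //.
  have := H [:: vgoal u v] (holds_val1 h) isT; rewrite /= /small su sv => /(_ isT).
  by congr K; upd_ext.
apply/(wp_emit _ _ _ (isT : rQ \in [:: rP; rQ])); exists w, sq; split=> //.
have := H [:: vgoal w v] (holds_val1 h) isT; rewrite /= /small sw sv => /(_ isT).
by congr K; upd_ext.
Qed.

Definition ExpandCap := Copy rV rH ;; EmitV rP ;; Xfer rV rH ;; EmitV rQ.

Lemma expand_cap : expands_op ExpandCap Defs.setI.
Proof.
have sym A B c : Defs.setI A B c -> Defs.setI B A c by case.
split.
  move=> N K S eP eQ.
  move/wp_seq/(wp_copy _ _ _ (isT : uniq [:: rV; rH; rT])) => [v [r [_ eV]]].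
  move/wp_seq/(wp_emit _ _ _ (isT : rP \in [:: rP; rQ]))=> [u' [r1 [_]]].
  rewrite /upd /= eP => /blk_inj[<- _].
  move/wp_seq/(wp_xfer _ _ _ (isT : uniq [:: rV; rH; rT])) => [v' [r' [_]]].
  rewrite /= eV => /blk_inj[<- <-].
  move/(wp_emit _ _ _ (isT : rQ \in [:: rP; rQ]))=> [w' [r2 [_]]].
  rewrite /upd /= eQ => /blk_inj[<- _] H.
  exists v, r, [:: vgoal w v; vgoal u v]; split=> //; last by move: H; congr K; upd_ext.
  move=> rest /holds_val[hq /holds_val[hp _]]; apply/binop_sym=> //.
  by rewrite -(num_lsb p) -(num_lsb q).
move=> N rest v r K S eP eQ eV sv N0 /size_names[su sw] bd /(binop_sym _ _ _ _ sym) h H.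
rewrite -(num_lsb p) -(num_lsb q) in h; case: h => hp hq.
apply/wp_seq/(wp_copy _ _ _ (isT : uniq [:: rV; rH; rT])); exists v, r; split=> //.
apply/wp_seq/(wp_emit _ _ _ (isT : rP \in [:: rP; rQ])); exists u, sp; split=> //.
apply/wp_seq/(wp_xfer _ _ _ (isT : uniq [:: rV; rH; rT])); exists v, r; split=> //.
apply/(wp_emit _ _ _ (isT : rQ \in [:: rP; rQ])); exists w, sq; split=> //.
have := H [:: vgoal w v; vgoal u v] (holds_vals hq hp) isT.
by rewrite /= /small su sw sv => /(_ isT); congr K; upd_ext.
Qed.

(** Here the finiteness of the result sets enters: the operands that witness a value fit into blocks
    of [N] bits and can be guessed. *)
Lemma small_sem rest x y N : (forall x y, sem rest x y -> y < 2 ^ N) -> 0 < N ->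
  sem rest x y -> size (lsb y) <= N.
Proof. by move=> bd N0 /bd h; apply: size_lsb. Qed.

Definition ExpandPlus :=
  Guesses rP rQ ;; Xfer rB rD ;; Xfer rC rE ;; Xfer rV rF ;; Add false.

Lemma expand_plus : expands_op ExpandPlus setPlus.
Proof.
have sym A B c : setPlus A B c -> setPlus B A c.
  by case=> a [b [ha [hb ->]]]; exists b, a; rewrite addnC.
split.
  move=> N K S eP eQ.
  move/wp_seq/(wp_guesses _ _ _ (isT : rP \in [:: rP; rQ]) (isT : rQ \in [:: rP; rQ])).
  case=> x [y [u' [w' [r1 [r2 [_ _ []]]]]]] _; rewrite eP eQ => /blk_inj[<- _] [_] /blk_inj[<- _].
  move/wp_seq/(wp_xfer _ _ _ (isT : uniq [:: rB; rD; rT])) => [x' [b [_]]] /= /blk_inj[<- <-].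
  move/wp_seq/(wp_xfer _ _ _ (isT : uniq [:: rC; rE; rT])) => [y' [c [_]]] /= /blk_inj[<- <-].
  move/wp_seq/(wp_xfer _ _ _ (isT : uniq [:: rV; rF; rT])) => [v [r [_ eV]]].
  case/wp_add_sound=> x2 [y2 [v2 [d [e [f []]]]]].
  move: eV; rewrite /upd /= => eV /blk_inj[<- <-] /blk_inj[<- <-] /blk_inj[<- <-] xyv H.
  exists v, r, [:: vgoal w y; vgoal u x]; split=> //; last by move: H; congr K; upd_ext.
  move=> rest /holds_val[hq /holds_val[hp _]]; apply/binop_sym=> //.
  rewrite -(num_lsb p) -(num_lsb q).
  by exists (num x), (num y); rewrite -xyv addn0.
move=> N rest v r K S eP eQ eV sv N0 /size_names[su sw] bd /(binop_sym _ _ _ _ sym).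
case=> x [y [hp [hq vxy]]] H.
have sx := small_sem bd N0 hp; have sy := small_sem bd N0 hq.
apply/wp_seq/(wp_guesses _ _ _ (isT : rP \in [:: rP; rQ]) (isT : rQ \in [:: rP; rQ])).
exists (lsb x), (lsb y), u, w, sp, sq; split=> //.
apply/wp_seq/(wp_xfer _ _ _ (isT : uniq [:: rB; rD; rT])); exists (lsb x), (S rB); split=> //.
apply/wp_seq/(wp_xfer _ _ _ (isT : uniq [:: rC; rE; rT])); exists (lsb y), (S rC); split=> //.
apply/wp_seq/(wp_xfer _ _ _ (isT : uniq [:: rV; rF; rT])); exists v, r; split=> //.
apply: (@wp_add_complete N false _ _ (lsb x) (lsb y) v (S rD) (S rE) (S rF)) => //.
  by rewrite !num_lsb addn0.
rewrite -(num_lsb p) -(num_lsb x) in hp; rewrite -(num_lsb q) -(num_lsb y) in hq.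
have := H [:: vgoal w (lsb y); vgoal u (lsb x)] (holds_vals hq hp) isT.
by rewrite /= /small /= su sw sx sy => /(_ isT); congr K; upd_ext.
Qed.

Definition ExpandTimes := Guesses rP rQ ;; Mul.

Lemma expand_times : expands_op ExpandTimes setTimes.
Proof.
have sym A B c : setTimes A B c -> setTimes B A c.
  by case=> a [b [ha [hb ->]]]; exists b, a; rewrite mulnC.
split.
  move=> N K S eP eQ.
  move/wp_seq/(wp_guesses _ _ _ (isT : rP \in [:: rP; rQ]) (isT : rQ \in [:: rP; rQ])).
  case=> x [y [u' [w' [r1 [r2 [_ _ []]]]]]] _; rewrite eP eQ => /blk_inj[<- _] [_] /blk_inj[<- _].
  case/wp_mul_sound=> x' [y' [v [b [c [r []]]]]].
  rewrite /upd /= => /blk_inj[<- <-] /blk_inj[<- <-] eV xyv H.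
  exists v, r, [:: vgoal w y; vgoal u x]; split=> //; last by move: H; congr K; upd_ext.
  move=> rest /holds_val[hq /holds_val[hp _]]; apply/binop_sym=> //.
  rewrite -(num_lsb p) -(num_lsb q).
  by exists (num x), (num y); rewrite -xyv.
move=> N rest v r K S eP eQ eV sv N0 /size_names[su sw] bd /(binop_sym _ _ _ _ sym).
case=> x [y [hp [hq vxy]]] H.
have sx := small_sem bd N0 hp; have sy := small_sem bd N0 hq.
apply/wp_seq/(wp_guesses _ _ _ (isT : rP \in [:: rP; rQ]) (isT : rQ \in [:: rP; rQ])).
exists (lsb x), (lsb y), u, w, sp, sq; split=> //.
apply: (@wp_mul_complete N (lsb x) (lsb y) v (S rB) (S rC) r) => //.
  by rewrite !num_lsb.
rewrite -(num_lsb p) -(num_lsb x) in hp; rewrite -(num_lsb q) -(num_lsb y) in hq.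
have := H [:: vgoal w (lsb y); vgoal u (lsb x)] (holds_vals hq hp) isT.
by rewrite /= /small /= su sw sx sy => /(_ isT); congr K; upd_ext.
Qed.

(** Only division depends on the order of its operands: the dividend belongs to the predecessor of
    smaller name, so the names are compared before the values are guessed. *)
Definition Ordered i j := Copy i rD ;; Copy j rF ;; Cmp false ;; Guesses i j.

(** Comparing the empty block strictly with the divisor ensures that the latter is nonzero. The
    dividend then changes places with the demanded value, so that [Mul] checks quotient times
    divisor against dividend. *)
Definition ExpandDiv :=
  Alt (Ordered rP rQ) (Ordered rQ rP) ;;
  Copy rC rF ;; push rD TSep ;; Cmp true ;;
  Xfer rV rA ;; Xfer rB rV ;; Xfer rA rB ;; Mul.

Lemma wp_ordered_sound N i j u1 u2 r1 r2 K S :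
  (i, j) \in [:: (rP, rQ); (rQ, rP)] -> S i = blk u1 r1 -> S j = blk u2 r2 ->
  wp N (Ordered i j) K S -> num u1 <= num u2 /\ exists x y,
    K (upd (upd (upd S rB (blk x (S rB))) rC (blk y (S rC))) rH
           (enc_goals [:: vgoal u2 y; vgoal u1 x] (S rH))).
Proof.
move=> ij e1 e2; have [iPQ jPQ] : i \in [:: rP; rQ] /\ j \in [:: rP; rQ].
  by move: ij; rewrite !inE => /orP[]/eqP[-> ->].
have uiD : uniq [:: i; rD; rT] by move: iPQ; rewrite !inE => /orP[]/eqP->.
have ujF : uniq [:: j; rF; rT] by move: jPQ; rewrite !inE => /orP[]/eqP->.
have jD : j != rD by move: jPQ; rewrite !inE => /orP[]/eqP->.
move/wp_seq/(wp_copy _ _ _ uiD)=> [u1' [r1' [_]]]; rewrite e1 => /blk_inj[<- _].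
move/wp_seq/(wp_copy _ _ _ ujF)=> [u2' [r2' [_]]].
rewrite (upd_neq _ _ jD) e2 => /blk_inj[<- _].
move/wp_seq/wp_cmp_sound=> [x' [y' [d [f []]]]].
rewrite upd_eq [upd _ rF _ rD]/upd /= upd_eq => /blk_inj[<- <-] /blk_inj[<- <-].
rewrite addn0 => le12.
have -> : upd (upd (upd (upd S rD (blk u1 (S rD))) rF (blk u2 (upd S rD (blk u1 (S rD)) rF)))
    rD (S rD)) rF (upd S rD (blk u1 (S rD)) rF) = S by upd_ext.
move/(wp_guesses _ _ _ iPQ jPQ)=> [x [y [? [? [? [? [_ _ []]]]]]]] _.
rewrite e1 e2 => /blk_inj[<- _] [_] /blk_inj[<- _] H.
by split=> //; exists x, y.
Qed.

Lemma wp_ordered_complete N i j u1 u2 r1 r2 x y (K : stacks -> Prop) S :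
  (i, j) \in [:: (rP, rQ); (rQ, rP)] -> S i = blk u1 r1 -> S j = blk u2 r2 ->
  0 < N -> size u1 <= N -> size u2 <= N -> size x <= N -> size y <= N ->
  num u1 <= num u2 ->
  K (upd (upd (upd S rB (blk x (S rB))) rC (blk y (S rC))) rH
         (enc_goals [:: vgoal u2 y; vgoal u1 x] (S rH))) ->
  wp N (Ordered i j) K S.
Proof.
move=> ij e1 e2 N0 s1 s2 sx sy le12 H.
have [iPQ jPQ] : i \in [:: rP; rQ] /\ j \in [:: rP; rQ].
  by move: ij; rewrite !inE => /orP[]/eqP[-> ->].
have uiD : uniq [:: i; rD; rT] by move: iPQ; rewrite !inE => /orP[]/eqP->.
have ujF : uniq [:: j; rF; rT] by move: jPQ; rewrite !inE => /orP[]/eqP->.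
have jD : j != rD by move: jPQ; rewrite !inE => /orP[]/eqP->.
apply/wp_seq/(wp_copy _ _ _ uiD); exists u1, r1; split=> //.
apply/wp_seq/(wp_copy _ _ _ ujF); exists u2, r2; split; rewrite ?(upd_neq _ _ jD) //.
apply/wp_seq/(@wp_cmp_complete N false u1 u2 (S rD) (S rF)) => //; first by rewrite addn0.
have -> : upd (upd (upd (upd S rD (blk u1 (S rD))) rF (blk u2 (upd S rD (blk u1 (S rD)) rF)))
    rD (S rD)) rF (S rF) = S by upd_ext.
by apply/(wp_guesses _ _ _ iPQ jPQ); exists x, y, u1, u2, r1, r2; split.
Qed.

Lemma expand_div : expands_op ExpandDiv setDiv.
Proof.
split.
  move=> N K S eP eQ.
  have tail x y G : wp N (Copy rC rF ;; push rD TSep ;; Cmp true ;;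
      Xfer rV rA ;; Xfer rB rV ;; Xfer rA rB ;; Mul) K
      (upd (upd (upd S rB (blk x (S rB))) rC (blk y (S rC))) rH G) ->
      exists v r, [/\ S rV = blk v r, num y <> 0, num x = num v * num y &
        K (upd (upd S rV r) rH G)].
    move/wp_seq/(wp_copy _ _ _ (isT : uniq [:: rC; rF; rT]))=> [y' [c [_]]] /= /blk_inj[<- _].
    move/wp_seq/wp_push/wp_seq/wp_cmp_sound=> [z [y2 [d [f []]]]].
    rewrite /upd /= => /(@blk_inj [::])[<- <-] /blk_inj[<- <-] y0.
    move/wp_seq/(wp_xfer _ _ _ (isT : uniq [:: rV; rA; rT])) => [v [r [_ /= eV]]].
    move/wp_seq/(wp_xfer _ _ _ (isT : uniq [:: rB; rV; rT])) => [x' [b [_]]] /= /blk_inj[<- <-].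
    move/wp_seq/(wp_xfer _ _ _ (isT : uniq [:: rA; rB; rT])) => [v' [a [_]]] /= /blk_inj[<- <-].
    case/wp_mul_sound=> ? [? [? [? [? [? []]]]]].
    rewrite /upd /= => /blk_inj[<- <-] /blk_inj[<- <-] /blk_inj[<- <-] e H.
    exists v, r; split=> //; first by move: y0 => /=; lia.
    by move: H; congr K; upd_ext.
  case/wp_seq/wp_alt.
    case/(wp_ordered_sound (isT : (rP, rQ) \in [:: (rP, rQ); (rQ, rP)]) eP eQ)=> pq [x [y /tail[v [r [eV y0 e H]]]]].
    exists v, r, [:: vgoal w y; vgoal u x]; split=> //.
    move=> rest /holds_val[hq /holds_val[hp _]]; move: pq hq hp.
    rewrite !num_lsb => pq hq hp; rewrite /binop (minn_idPl pq) (maxn_idPr pq).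
    by exists (num x), (num y).
  case/(wp_ordered_sound (isT : (rQ, rP) \in [:: (rP, rQ); (rQ, rP)]) eQ eP)=> pq [x [y /tail[v [r [eV y0 e H]]]]].
  exists v, r, [:: vgoal u y; vgoal w x]; split=> //.
  move=> rest /holds_val[hq /holds_val[hp _]]; move: pq hq hp.
  rewrite !num_lsb => pq hq hp; rewrite /binop (minn_idPr pq) (maxn_idPl pq).
  by exists (num x), (num y).
move=> N rest v r K S eP eQ eV sv N0 /size_names[su sw] bd h H.
have tail x y G : size (lsb x) <= N -> size (lsb y) <= N -> y <> 0 -> x = num v * y ->
    K (upd (upd S rV r) rH G) -> wp N (Copy rC rF ;; push rD TSep ;; Cmp true ;;
      Xfer rV rA ;; Xfer rB rV ;; Xfer rA rB ;; Mul) K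
      (upd (upd (upd S rB (blk (lsb x) (S rB))) rC (blk (lsb y) (S rC))) rH G).
  move=> sx sy y0 e {}H.
  apply/wp_seq/(wp_copy _ _ _ (isT : uniq [:: rC; rF; rT])); exists (lsb y), (S rC); split=> //.
  apply/wp_seq/wp_push/wp_seq.
  apply: (@wp_cmp_complete N true [::] (lsb y) (S rD) (S rF)) => //.
    by rewrite num_lsb /=; lia.
  apply/wp_seq/(wp_xfer _ _ _ (isT : uniq [:: rV; rA; rT])); exists v, r; split=> //.
  apply/wp_seq/(wp_xfer _ _ _ (isT : uniq [:: rB; rV; rT])); exists (lsb x), (S rB); split=> //.
  apply/wp_seq/(wp_xfer _ _ _ (isT : uniq [:: rA; rB; rT])); exists v, (S rA); split=> //.
  apply: (@wp_mul_complete N v (lsb y) (lsb x) (S rB) (S rC) r) => //.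
    by rewrite !num_lsb.
  by move: H; congr K; upd_ext.
case: h => x [y [hx [hy [y0 e]]]].
have sx := small_sem bd N0 hx; have sy := small_sem bd N0 hy.
apply/wp_seq/wp_alt.
have [pq|/ltnW pq] := leqP p q; [left|right];
    rewrite ?(minn_idPl pq) ?(maxn_idPr pq) ?(minn_idPr pq) ?(maxn_idPl pq) in hx hy.
  rewrite -(num_lsb p) -(num_lsb x) in hx; rewrite -(num_lsb q) -(num_lsb y) in hy.
  apply: (@wp_ordered_complete N rP rQ u w sp sq (lsb x) (lsb y)); rewrite ?num_lsb //.
  apply: tail => //; apply: H (holds_vals hy hx) _ _ => //.
  by rewrite /= /small /= su sw sx sy.
rewrite -(num_lsb q) -(num_lsb x) in hx; rewrite -(num_lsb p) -(num_lsb y) in hy.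
apply: (@wp_ordered_complete N rQ rP w u sq sp (lsb x) (lsb y)); rewrite ?num_lsb //.
apply: tail => //; apply: H (holds_vals hy hx) _ _ => //.
by rewrite /= /small /= su sw sx sy.
Qed.

End Expansions.

(** * Working off the goals at one gate *)

Definition Fetch s k := pop s k ;; Xfer s rA ;; Xfer s rV.
Definition Store d k := Xfer rV d ;; Xfer rA d ;; push d k.
Definition kinds := [:: kVal; kNeed; kNot].
Definition AnyKind (f : token -> prog) := Alt (f kVal) (Alt (f kNeed) (f kNot)).

Lemma wp_anykind N f K S :
  wp N (AnyKind f) K S <-> exists2 k, k \in kinds & wp N (f k) K S.
Proof.
split.
  by case/wp_alt=> [H|/wp_alt[H|H]]; [exists kVal|exists kNeed|exists kNot].
case=> k; rewrite !inE => /or3P[]/eqP-> H; apply/wp_alt; first by left.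
  by right; apply/wp_alt; left.
by right; apply/wp_alt; right.
Qed.

Lemma holds_kind gs a : holds gs a -> a.1.1 \in kinds.
Proof. by rewrite /holds; case: a => [[[] x] v]. Qed.

Lemma wp_load N s k K S : s \in [:: rG; rH] -> wp N (Fetch s k) K S <->
  exists u v r, [/\ small N (k, u, v), S s = enc_goal (k, u, v) r &
    K (upd (upd (upd S s r) rA (blk u (S rA))) rV (blk v (S rV)))].
Proof.
move=> sGH.
have uA : uniq [:: s; rA; rT] by move: sGH; rewrite !inE => /orP[]/eqP->.
have uV : uniq [:: s; rV; rT] by move: sGH; rewrite !inE => /orP[]/eqP->.
split.
  move/wp_seq/wp_pop=> [r0 e0].
  move/wp_seq/(wp_xfer _ _ _ uA)=> [u [r1 [su]]]; rewrite upd_eq => e1.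
  move/(wp_xfer _ _ _ uV)=> [v [r [sv]]].
  move: sGH uA uV e0; rewrite !inE => /orP[]/eqP-> _ _; rewrite /upd /= => e0 e2 H;
    exists u, v, r; (split; [by rewrite /small /= su sv | by rewrite e0 e1 e2 |]);
    by move: H; congr K; upd_ext.
case=> u [v [r [/andP[/= su sv] e H]]].
apply/wp_seq/wp_pop; exists (blk u (blk v r)) => //.
apply/wp_seq/(wp_xfer _ _ _ uA); exists u, (blk v r); split=> //; first by rewrite upd_eq.
apply/(wp_xfer _ _ _ uV); exists v, r; split=> //.
  by move: sGH; rewrite !inE => /orP[]/eqP->.
by move: H; congr K; move: sGH; rewrite !inE => /orP[]/eqP->; upd_ext.
Qed.

Lemma wp_store N d k K S : d \in [:: rG; rH] -> wp N (Store d k) K S <->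
  exists u v r s, [/\ small N (k, u, v), S rA = blk u r, S rV = blk v s &
    K (upd (upd (upd S rA r) rV s) d (enc_goal (k, u, v) (S d)))].
Proof.
move=> sGH.
have uA : uniq [:: rA; d; rT] by move: sGH; rewrite !inE => /orP[]/eqP->.
have uV : uniq [:: rV; d; rT] by move: sGH; rewrite !inE => /orP[]/eqP->.
have Ad : rA != d by move: sGH; rewrite !inE => /orP[]/eqP->.
split.
  move/wp_seq/(wp_xfer _ _ _ uV)=> [v [s [sv e1]]].
  move/wp_seq/(wp_xfer _ _ _ uA)=> [u [r [su]]]; rewrite (upd_neq _ _ Ad) upd_neq // => e2.
  move/wp_push=> H; exists u, v, r, s; split=> //; first by rewrite /small /= su sv.
  by move: H; congr K; move: sGH; rewrite !inE => /orP[]/eqP->; upd_ext.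
case=> u [v [r [s [/andP[/= su sv] e1 e2 H]]]].
apply/wp_seq/(wp_xfer _ _ _ uV); exists v, s; split=> //.
apply/wp_seq/(wp_xfer _ _ _ uA); exists u, r; split=> //.
  by rewrite (upd_neq _ _ Ad) upd_neq.
apply/wp_push; move: H; congr K.
by move: sGH; rewrite !inE => /orP[]/eqP->; upd_ext.
Qed.

(** A gate is invisible to goals about other names, which can be passed on unchanged. *)
Lemma holds_other g rest a : gname g != num a.1.2 ->
  holds rest a <-> holds (g :: rest) a.
Proof.
move=> ne; case: a ne => [[k u] v] /= ne; rewrite /holds /= (negbTE ne).
by rewrite !inE eq_sym (negbTE ne); case: k.
Qed.

Definition Keep := AnyKind (fun k =>
  Fetch rG k ;; Copy rN rD ;; Copy rA rF ;; Neq ;; Store rH k).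
Definition Found k := Fetch rG k ;; Copy rN rD ;; Xfer rA rF ;; Eq.
(** A goal [kNot] about the current gate is false; no branch fits it, so such a run gets stuck. *)
Definition Goal E := Alt Keep (Alt (Found kNeed ;; Drop rV) (Found kVal ;; E)).
Definition Back := AnyKind (fun k => Fetch rH k ;; Store rG k).
(** New goals gather on [rH], apart from those not yet treated, since they are about later gates
    only. They go back to [rG] once it is empty. *)
Definition Loop E := Star (Goal E) ;; isempty rG ;; Star Back ;; isempty rH.

Lemma enc_goal_inj a a' r r' : enc_goal a r = enc_goal a' r' -> a = a' /\ r = r'.
Proof.
by case: a a' => [[k u] v] [[k' u'] v'] [-> /blk_inj[-> /blk_inj[-> ->]]].
Qed.

Lemma enc_goals_inj l l' : enc_goals l [::] = enc_goals l' [::] -> l = l'.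
Proof.
elim: l l' => [|a l IH] [|a' l'] //= /enc_goal_inj[-> /IH->] //.
Qed.

Lemma wp_back N K S : wp N Back K S <-> exists a r,
  [/\ a.1.1 \in kinds, small N a, S rH = enc_goal a r &
      K (upd (upd S rH r) rG (enc_goal a (S rG)))].
Proof.
split.
  case/wp_anykind=> k kk /wp_seq/(wp_load _ _ _ _ (isT : rH \in [:: rG; rH])).
  case=> u [v [r [su eH /(wp_store _ _ _ _ (isT : rG \in [:: rG; rH]))]]].
  case=> u' [v' [r1 [r2 [_]]]]; rewrite /upd /= => /blk_inj[<- <-] /blk_inj[<- <-] H.
  by exists (k, u, v), r; split=> //; move: H; congr K; upd_ext.
case=> -[[k u] v] [r [/= kk su eH H]]; apply/wp_anykind; exists k => //.
apply/wp_seq/(wp_load _ _ _ _ (isT : rH \in [:: rG; rH])); exists u, v, r; split=> //.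
apply/(wp_store _ _ _ _ (isT : rG \in [:: rG; rH])).
by exists u, v, (S rA), (S rV); split=> //; move: H; congr K; upd_ext.
Qed.

Lemma wp_backs N K S : wp N (Star Back) K S <-> exists l r,
  [/\ size l <= N, all (fun a => (a.1.1 \in kinds) && small N a) l,
      S rH = enc_goals l r &
      K (upd (upd S rH r) rG (enc_goals (rev l) (S rG)))].
Proof.
suff it n : iter n (wp N Back) K S <-> exists l r,
  [/\ size l = n, all (fun a => (a.1.1 \in kinds) && small N a) l,
      S rH = enc_goals l r & K (upd (upd S rH r) rG (enc_goals (rev l) (S rG)))].
  split=> [/wp_star[n len /it[l [r [sl ? ? ?]]]]|[l [r [sl ? ? ?]]]].
    by exists l, r; rewrite sl.
  by apply/wp_star; exists (size l) => //; apply/it; exists l, r.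
elim: n S => [|n IH] S.
  have E : upd (upd S rH (S rH)) rG (S rG) = S by upd_ext.
  split; first by move=> H; exists [::], (S rH); rewrite /= E.
  by case=> -[|a l] [r []] //= _ _ <-; rewrite E.
rewrite iterS; split.
  case/wp_back=> a [r [ak sa eH /IH[l [r' [sl al]]]]]; rewrite /upd /= => er H.
  exists (a :: l), r'; rewrite /= sl ak sa; split=> //; first by rewrite eH er.
  move: H; congr K; rewrite rev_cons /enc_goals foldr_rcons; upd_ext.
case=> -[|a l] [r []] // [sl] /= /andP[/andP[ak sa] al] eH H.
apply/wp_back; exists a, (enc_goals l r); split=> //; apply/IH; exists l, r; split=> //.
by move: H; congr K; rewrite rev_cons /enc_goals foldr_rcons; upd_ext.
Qed.

Section GateLoop.
Variables (g : gate) (sn P Q : seq token) (R : seq gate -> nat -> Prop) (M : nat).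
Variable E : prog.
Let n := gname g.
Hypothesis expE : expands E P Q R M.
Hypothesis semg : forall rest v, sem (g :: rest) n v <-> R rest v.

Definition gate_regs (S : stacks) :=
  [/\ S rN = blk (lsb n) sn, S rP = P & S rQ = Q].

Lemma wp_found_sound N k K S : gate_regs S -> wp N (Found k) K S ->
  exists u v r, [/\ S rG = enc_goal (k, u, v) r, num u = n &
    K (upd (upd S rG r) rV (blk v (S rV)))].
Proof.
case=> eN _ _.
move/wp_seq/(wp_load _ _ _ _ (isT : rG \in [:: rG; rH]))=> [u [v [r [su eG]]]].
move/wp_seq/(wp_copy _ _ _ (isT : uniq [:: rN; rD; rT]))=> [u1 [r1 [_]]].
rewrite /upd /= eN => /blk_inj[<- _].
move/wp_seq/(wp_xfer _ _ _ (isT : uniq [:: rA; rF; rT]))=> [u2 [r2 [_]]].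
rewrite /upd /= => /blk_inj[<- <-] /wp_eq_sound[x [y [d [f []]]]].
rewrite /upd /= => /blk_inj[<- <-] /blk_inj[<- <-]; rewrite num_lsb => e H.
by exists u, v, r; split=> //; move: H; congr K; upd_ext.
Qed.

Lemma wp_found_complete N k u v r (K : stacks -> Prop) S : gate_regs S ->
  S rG = enc_goal (k, u, v) r -> small N (k, u, v) -> num u = n ->
  size (lsb n) <= N -> K (upd (upd S rG r) rV (blk v (S rV))) ->
  wp N (Found k) K S.
Proof.
case=> eN _ _ eG suv un sn' H; have /andP[/= su sv] := suv.
apply/wp_seq/(wp_load _ _ _ _ (isT : rG \in [:: rG; rH])); exists u, v, r; split=> //.
apply/wp_seq/(wp_copy _ _ _ (isT : uniq [:: rN; rD; rT])).
exists (lsb n), sn; split=> //.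
apply/wp_seq/(wp_xfer _ _ _ (isT : uniq [:: rA; rF; rT])).
exists u, (S rA); split=> //.
apply: (@wp_eq_complete N (lsb n) u (S rD) (S rF)) => //; first by rewrite num_lsb.
by move: H; congr K; upd_ext.
Qed.

Lemma wp_keep_sound N K S : gate_regs S -> wp N Keep K S ->
  exists a r, [/\ S rG = enc_goal a r, n != num a.1.2 &
    K (upd (upd S rG r) rH (enc_goal a (S rH)))].
Proof.
case=> eN _ _ /wp_anykind[k kk].
move/wp_seq/(wp_load _ _ _ _ (isT : rG \in [:: rG; rH]))=> [u [v [r [su eG]]]].
move/wp_seq/(wp_copy _ _ _ (isT : uniq [:: rN; rD; rT]))=> [u1 [r1 [_]]].
rewrite /upd /= eN => /blk_inj[<- _].
move/wp_seq/(wp_copy _ _ _ (isT : uniq [:: rA; rF; rT]))=> [u2 [r2 [_]]].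
rewrite /upd /= => /blk_inj[<- _] /wp_seq/wp_neq_sound[x [y [d [f []]]]].
rewrite /upd /= => /blk_inj[<- <-] /blk_inj[<- <-]; rewrite num_lsb => /eqP ne.
move/(wp_store _ _ _ _ (isT : rH \in [:: rG; rH])).
case=> u' [v' [r1' [r2' [_]]]]; rewrite /upd /= => /blk_inj[<- <-] /blk_inj[<- <-] H.
by exists (k, u, v), r; split=> //; move: H; congr K; upd_ext.
Qed.

Lemma wp_keep_complete N a r (K : stacks -> Prop) S : gate_regs S ->
  S rG = enc_goal a r -> a.1.1 \in kinds -> small N a -> n != num a.1.2 ->
  0 < N -> size (lsb n) <= N ->
  K (upd (upd S rG r) rH (enc_goal a (S rH))) -> wp N Keep K S.
Proof.
case: a => [[k u] v] [eN _ _] eG kk suv /= ne N0 sn' H; have /andP[/= su sv] := suv.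
apply/wp_anykind; exists k => //.
apply/wp_seq/(wp_load _ _ _ _ (isT : rG \in [:: rG; rH])); exists u, v, r; split=> //.
apply/wp_seq/(wp_copy _ _ _ (isT : uniq [:: rN; rD; rT])).
exists (lsb n), sn; split=> //.
apply/wp_seq/(wp_copy _ _ _ (isT : uniq [:: rA; rF; rT])).
exists u, (S rA); split=> //; apply/wp_seq.
apply: (@wp_neq_complete N (lsb n) u (S rD) (S rF)) => //.
  by rewrite num_lsb; apply/eqP.
apply/(wp_store _ _ _ _ (isT : rH \in [:: rG; rH])).
by exists u, v, (S rA), (S rV); split=> //; move: H; congr K; upd_ext.
Qed.

(** The later gates are still unread at this point, so the new goals must imply the old one for
    every [rest]. *)
Lemma wp_goal_sound N K S : gate_regs S -> wp N (Goal E) K S ->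
  exists a r l, [/\ S rG = enc_goal a r,
    forall rest, (forall b, b \in l -> holds rest b) -> holds (g :: rest) a &
    K (upd (upd S rG r) rH (enc_goals l (S rH)))].
Proof.
move=> regs /wp_alt[/(wp_keep_sound regs)[a [r [eG ne H]]]|].
  exists a, r, [:: a]; split=> // rest /(_ a (mem_head _ _)).
  by apply: (iffLR (holds_other _ ne)).
case/wp_alt=> /wp_seq/(wp_found_sound regs)[u [v [r [eG un]]]].
  move/wp_drop=> [v' [r' [_]]]; rewrite upd_eq => /blk_inj[_ <-] H.
  exists (kNeed, u, v), r, [::]; split=> //; last by move: H; congr K; upd_ext.
  by move=> rest _; rewrite /holds /= un mem_head.
have regs' : gate_regs (upd (upd S rG r) rV (blk v (S rV))) by case: regs.
have [_ eP eQ] := regs'.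
move/(expands_sound expE eP eQ)=> [v' [r' [l []]]].
rewrite upd_eq => /blk_inj[<- <-] Hl H.
exists (kVal, u, v), r, l; split=> //; last by move: H; congr K; upd_ext.
by move=> rest /Hl; rewrite /holds /= un; apply: (iffRL (semg _ _)).
Qed.

Lemma wp_goal_complete N rest a r (K : stacks -> Prop) S : gate_regs S ->
  S rG = enc_goal a r -> small N a -> 0 < N -> M <= N -> size (lsb n) <= N ->
  (forall x y, sem rest x y -> y < 2 ^ N) ->
  n \notin map gname rest -> holds (g :: rest) a ->
  (forall l, (forall b, b \in l -> holds rest b) -> size l <= 2 ->
     all (small N) l -> K (upd (upd S rG r) rH (enc_goals l (S rH)))) ->
  wp N (Goal E) K S.
Proof.
move=> regs eG sa N0 MN sn' bd nrest ha H; apply/wp_alt.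
have [ne|ne] := boolP (n != num a.1.2).
  left; apply: (wp_keep_complete regs eG (holds_kind ha) sa ne N0 sn').
  apply: (H [:: a]) => //; last by rewrite /= sa.
  move=> b; rewrite inE => /eqP->.
  by apply: (iffRL (holds_other _ ne)).
right; apply/wp_alt; move: ne; rewrite negbK eq_sym => /eqP ne.
case: a ne eG sa ha => [[k u] v] /= ne eG suv ha.
have := holds_kind ha; rewrite !inE => /or3P[]/eqP/= ek; subst k.
- right; apply/wp_seq; apply: (wp_found_complete regs eG suv ne sn').
  have regs' : gate_regs (upd (upd S rG r) rV (blk v (S rV))) by case: regs.
  have [_ eP eQ] := regs'; have /andP[/= su sv] := suv.
  have hR : R rest (num v) by apply/semg; move: ha; rewrite /holds /= ne.
  apply: (expands_complete expE eP eQ (upd_eq _ _ _) sv N0 MN bd hR).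
  move=> l hl sl al; have := H l hl sl al; congr K; upd_ext.
- left; apply/wp_seq; apply: (wp_found_complete regs eG suv ne sn').
  have /andP[/= su sv] := suv.
  apply/wp_drop; exists v, (S rV); rewrite upd_eq; split=> //.
  have := H [::] (fun b => ltac:(done)) isT isT; congr K; upd_ext.
- by move: ha; rewrite /holds /= ne mem_head.
Qed.

Lemma enc_goals_cat l l' r : enc_goals (l ++ l') r = enc_goals l (enc_goals l' r).
Proof. exact: foldr_cat. Qed.

Lemma goals_iter_sound N m K S : gate_regs S -> iter m (wp N (Goal E)) K S ->
  exists l l' r, [/\ S rG = enc_goals l r,
    forall rest, (forall b, b \in l' -> holds rest b) ->
                 forall b, b \in l -> holds (g :: rest) b &
    K (upd (upd S rG r) rH (enc_goals l' (S rH)))].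
Proof.
elim: m S => [|m IH] S regs.
  move=> H; exists [::], [::], (S rG); split=> //.
  by have -> : upd (upd S rG (S rG)) rH (S rH) = S by upd_ext.
rewrite iterS => /(wp_goal_sound regs)[a [r [l1 [eG h1]]]].
case/IH=> [|l [l2 [r' []]]]; first by case: regs.
rewrite /upd /= => er h2 H.
exists (a :: l), (l2 ++ l1), r'; split.
- by rewrite eG er.
- move=> rest hb; apply/holds_cons; split.
    by apply: h1 => b bl; apply: hb; rewrite mem_cat bl orbT.
  by apply: h2 => b bl; apply: hb; rewrite mem_cat bl.
- by move: H; rewrite enc_goals_cat; congr K; upd_ext.
Qed.

Lemma wp_loop_sound N K S : gate_regs S -> S rH = [::] -> wp N (Loop E) K S ->
  exists l l', [/\ S rG = enc_goals l [::],
    forall rest, (forall b, b \in l' -> holds rest b) ->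
                 forall b, b \in l -> holds (g :: rest) b &
    K (upd S rG (enc_goals l' [::]))].
Proof.
move=> regs eH /wp_seq/wp_star[m _ /(goals_iter_sound regs)[l [l1 [r [eG h1]]]]].
rewrite eH => /wp_seq/wp_empty[]; rewrite /upd /= => r0; subst r.
move/wp_seq/wp_backs=> [l2 [r [_ _]]]; rewrite /= => e2 /wp_empty[].
rewrite /upd /= => r0 H; subst r.
have l12 := enc_goals_inj e2.
exists l, (rev l2); split=> //.
  by move=> rest hb; apply: h1 => b; rewrite l12 -mem_rev; apply: hb.
by move: H; congr K; upd_ext.
Qed.

Lemma goals_iter_complete N rest l r (K : stacks -> Prop) S : gate_regs S ->
  S rG = enc_goals l r -> all (small N) l -> 0 < N -> M <= N ->
  size (lsb n) <= N -> (forall x y, sem rest x y -> y < 2 ^ N) ->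
  n \notin map gname rest -> (forall b, b \in l -> holds (g :: rest) b) ->
  (forall l', (forall b, b \in l' -> holds rest b) -> size l' <= 2 * size l ->
     all (small N) l' -> K (upd (upd S rG r) rH (enc_goals l' (S rH)))) ->
  iter (size l) (wp N (Goal E)) K S.
Proof.
move=> regs eG sl N0 MN sn' bd nrest; elim: l S regs eG sl => [|a l IH] S regs eG.
  move=> _ _ H; have := H [::] (fun b => ltac:(done)) isT isT.
  by congr K; rewrite -[r]eG; upd_ext.
case/andP=> sa sl /holds_cons[ha hl] H; rewrite iterS.
apply: (wp_goal_complete regs eG sa N0 MN sn' bd nrest ha) => l1 h1 s1 a1.
apply: IH => //.
move=> l2 h2 s2 a2; have H' := H (l2 ++ l1); rewrite enc_goals_cat in H'.
have : K (upd (upd S rG r) rH (enc_goals l2 (enc_goals l1 (S rH)))).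
  apply: H'.
  - by move=> b; rewrite mem_cat => /orP[/h2|/h1].
  - by rewrite size_cat /= mulnS addnC leq_add.
  - by rewrite all_cat a1 a2.
by congr K; upd_ext.
Qed.

Lemma wp_loop_complete N rest l (K : stacks -> Prop) S : gate_regs S ->
  S rH = [::] -> S rG = enc_goals l [::] -> all (small N) l -> 2 * size l <= N ->
  0 < N -> M <= N ->
  size (lsb n) <= N -> (forall x y, sem rest x y -> y < 2 ^ N) ->
  n \notin map gname rest -> (forall b, b \in l -> holds (g :: rest) b) ->
  (forall l', (forall b, b \in l' -> holds rest b) -> size l' <= 2 * size l ->
     all (small N) l' -> K (upd S rG (enc_goals l' [::]))) ->
  wp N (Loop E) K S.
Proof.
move=> regs eH eG sl szl N0 MN sn' bd nrest hl H.
apply/wp_seq/wp_star; exists (size l); first by lia.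
apply: (goals_iter_complete regs eG sl N0 MN sn' bd nrest hl) => l' h' s' a'.
apply/wp_seq/wp_empty; split=> //; apply/wp_seq/wp_backs.
exists l', [::]; split.
- exact: leq_trans s' szl.
- apply/allP=> b bl; rewrite (allP a' b bl) andbT.
  exact: holds_kind (h' b bl).
- by rewrite upd_eq eH.
apply/wp_empty; split=> //.
have H' := H (rev l'); rewrite size_rev all_rev in H'.
have : K (upd S rG (enc_goals (rev l') [::])).
  by apply: H' => // b; rewrite mem_rev; apply: h'.
by congr K; upd_ext; rewrite eH.
Qed.

End GateLoop.

(** The kinds [kNeed] and [kNot] ignore the value; an empty block fills its place. *)
Definition NewGoal i k := push rG TSep ;; Xfer i rG ;; push rG k.

Lemma wp_newgoal N i k K S : i \in [:: rN; rP; rQ] ->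
  wp N (NewGoal i k) K S <-> exists u r, [/\ size u <= N, S i = blk u r &
    K (upd (upd S i r) rG (enc_goal (k, u, [::]) (S rG)))].
Proof.
move=> ir; have ui : uniq [:: i; rG; rT] by move: ir; rewrite !inE => /or3P[]/eqP->.
have iG : i != rG by move: ir; rewrite !inE => /or3P[]/eqP->.
have E u r : upd (upd (upd (upd S rG (TSep :: S rG)) i r) rG (blk u (TSep :: S rG)))
   rG (k :: blk u (TSep :: S rG)) = upd (upd S i r) rG (enc_goal (k, u, [::]) (S rG)).
  by move: ir; rewrite !inE => /or3P[]/eqP->; upd_ext.
split.
  move/wp_seq/wp_push/wp_seq/(wp_xfer _ _ _ ui)=> [u [r [su]]].
  rewrite (upd_neq _ _ iG) => eu /wp_push; rewrite !upd_eq E => H.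
  by exists u, r.
case=> u [r [su eu H]]; apply/wp_seq/wp_push/wp_seq/(wp_xfer _ _ _ ui).
exists u, r; rewrite (upd_neq _ _ iG); split=> //.
by apply/wp_push; rewrite !upd_eq E.
Qed.

(** * Reading one gate *)

Notation ops := O_cup_cap_plus_times_div (only parsing).

(** The goal [kNot] is created after [Loop], so the first gate it meets is the next one and not the
    gate whose name it forbids. *)
Definition GateIn :=
  pop rW TIn ;; Parse rP ;; pop rW TSep ;; pop rW TClose ;;
  Loop ExpandIn ;; Drop rP ;; NewGoal rN kNot.
Definition GateBin t E :=
  pop rW t ;; pop rW TSep ;; Parse rP ;; pop rW TSep ;; Parse rQ ;;
  pop rW TSep ;; pop rW TClose ;;
  Loop E ;; NewGoal rP kNeed ;; NewGoal rQ kNeed ;; NewGoal rN kNot.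
Definition Gate :=
  pop rW TOpen ;; Parse rN ;; pop rW TSep ;;
  Alt GateIn (Alt (GateBin TCup ExpandCup) (Alt (GateBin TCap ExpandCap)
    (Alt (GateBin TPlus ExpandPlus) (Alt (GateBin TTimes ExpandTimes)
      (GateBin TDiv ExpandDiv))))).

Definition wf_gate (g : gate) (rest : seq gate) : bool :=
  [&& label_ok ops (glabel g) (gpreds g),
      all (fun p => p \in map gname rest) (gpreds g) &
      gname g \notin map gname rest].

Lemma wf_gates_cons g rest :
  wf_gates ops (g :: rest) = wf_gate g rest && wf_gates ops rest.
Proof. by rewrite /= /wf_gate -!andbA. Qed.

(** Besides the goals of [l], the new goals must secure that [g] is well formed: distinctness of its
    name comes from [kNot], existence of its predecessors from [kNeed]. *)
Definition reduces g (l l' : seq goal) := forall rest,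
  (forall b, b \in l' -> holds rest b) ->
  (forall b, b \in l -> holds (g :: rest) b) /\ wf_gate g rest.

Lemma holds_need rest p : holds rest (kNeed, lsb p, [::]) = (p \in map gname rest) :> Prop.
Proof. by rewrite /holds /= num_lsb. Qed.

Lemma holds_not rest p : holds rest (kNot, lsb p, [::]) = (p \notin map gname rest) :> Prop.
Proof. by rewrite /holds /= num_lsb. Qed.

Lemma gatein_sound N n sn K S : S rN = blk (lsb n) sn -> S rH = [::] ->
  wp N GateIn K S -> exists a l l' r,
  [/\ S rW = TIn :: binT a ++ [:: TSep, TClose & r], S rG = enc_goals l [::],
      reduces (n, LIn a, [::]) l l' &
      K (upd (upd (upd S rN sn) rW r) rG (enc_goals l' [::]))].
Proof.
move=> eN eH /wp_seq/wp_pop[r0 e0].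
move/wp_seq/(wp_parse _ _ _ (isT : rP != rW))=> [a [r1 [_]]].
rewrite /upd /= => e1 /wp_seq/wp_pop[r2]; rewrite /= => e2 /wp_seq/wp_pop[r3].
rewrite /upd /= => e3 /wp_seq.
set S1 := (fun j => _) => H.
have regs : gate_regs (n, LIn a, [::]) sn (blk (lsb a) (S rP)) (S rQ) S1 by split.
have semg rest v : sem ((n, LIn a, [::]) :: rest) n v <-> v = a by rewrite /= eqxx.
case: (wp_loop_sound (expand_in a (S rP) (S rQ)) semg regs eH H) => l [l' [eG hl]].
move/wp_seq/wp_drop=> [u [s [_]]]; rewrite /= => /blk_inj[_ <-].
move/(wp_newgoal _ _ _ _ (isT : rN \in [:: rN; rP; rQ]))=> [u' [s' [_]]].
rewrite /upd /S1 /= eN => /blk_inj[<- <-] HK.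
exists a, l, ((kNot, lsb n, [::]) :: l'), r3; split=> //.
- by rewrite e0 e1 e2 e3.
- move=> rest /holds_cons[]; rewrite holds_not => nrest hb.
  by split; [apply: hl | rewrite /wf_gate /=].
- by move: HK; congr K; upd_ext.
Qed.

Section Binary.
Variables (t : token) (E : prog) (lb : label)
  (f : (nat -> Prop) -> (nat -> Prop) -> nat -> Prop).
Hypothesis expE : forall p q sp sq,
  expands E (blk (lsb p) sp) (blk (lsb q) sq) (binop f p q) (name_size p q).
Hypothesis elb : enc_label lb = [:: t].
Hypothesis lbok : forall p q, label_ok ops lb [:: p; q].
Hypothesis semlb : forall n p q rest v,
  sem ((n, lb, [:: p; q]) :: rest) n v <-> binop f p q rest v.

Lemma gatebin_sound N n sn K S : S rN = blk (lsb n) sn -> S rH = [::] ->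
  wp N (GateBin t E) K S -> exists p q l l' r,
  [/\ S rW = [:: t, TSep & binT p ++ TSep :: binT q ++ [:: TSep, TClose & r]],
      S rG = enc_goals l [::], reduces (n, lb, [:: p; q]) l l' &
      K (upd (upd (upd S rN sn) rW r) rG (enc_goals l' [::]))].
Proof.
move=> eN eH /wp_seq/wp_pop[r0 e0] /wp_seq/wp_pop[r0']; rewrite upd_eq => e0'.
move/wp_seq/(wp_parse _ _ _ (isT : rP != rW))=> [p [r1 [_]]].
rewrite /upd /= => e1 /wp_seq/wp_pop[r2]; rewrite /= => e2.
move/wp_seq/(wp_parse _ _ _ (isT : rQ != rW))=> [q [r1' [_]]].
rewrite /upd /= => e1' /wp_seq/wp_pop[r2']; rewrite /= => e2' /wp_seq/wp_pop[r3].
rewrite /upd /= => e3 /wp_seq.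
set S1 := (fun j => _) => H.
have regs : gate_regs (n, lb, [:: p; q]) sn (blk (lsb p) (S rP)) (blk (lsb q) (S rQ)) S1.
  by split.
case: (wp_loop_sound (expE p q (S rP) (S rQ)) (semlb n p q) regs eH H) => l [l' [eG hl]].
move/wp_seq/(wp_newgoal _ _ _ _ (isT : rP \in [:: rN; rP; rQ]))=> [u1 [s1 [_]]].
rewrite /= => /blk_inj[<- <-].
move/wp_seq/(wp_newgoal _ _ _ _ (isT : rQ \in [:: rN; rP; rQ]))=> [u2 [s2 [_]]].
rewrite /= => /blk_inj[<- <-].
move/(wp_newgoal _ _ _ _ (isT : rN \in [:: rN; rP; rQ]))=> [u' [s' [_]]].
rewrite /upd /S1 /= eN => /blk_inj[<- <-] HK.
exists p, q, l, [:: (kNot, lsb n, [::]), (kNeed, lsb q, [::]), (kNeed, lsb p, [::]) & l'], r3.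
split=> //.
- by rewrite e0 e0' e1 e2 e1' e2' e3.
- move=> rest /holds_cons[hn /holds_cons[hq /holds_cons[hp hb]]].
  move: hn hq hp; rewrite holds_not !holds_need => nrest hq hp.
  by split; [apply: hl | rewrite /wf_gate lbok /= hp hq].
- by move: HK; congr K; upd_ext.
Qed.
End Binary.

Definition opbin (lb : label) (E : prog) t f : Prop :=
  [/\ forall p q sp sq,
        expands E (blk (lsb p) sp) (blk (lsb q) sq) (binop f p q) (name_size p q),
      enc_label lb = [:: t], forall p q, label_ok ops lb [:: p; q] &
      forall n p q rest v,
        sem ((n, lb, [:: p; q]) :: rest) n v <-> binop f p q rest v].

Lemma opbin_cup : opbin LCup ExpandCup TCup Defs.setU.
Proof. by split=> // *; [apply: expand_cup | rewrite /= eqxx]. Qed.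
Lemma opbin_cap : opbin LCap ExpandCap TCap Defs.setI.
Proof. by split=> // *; [apply: expand_cap | rewrite /= eqxx]. Qed.
Lemma opbin_plus : opbin LPlus ExpandPlus TPlus setPlus.
Proof. by split=> // *; [apply: expand_plus | rewrite /= eqxx]. Qed.
Lemma opbin_times : opbin LTimes ExpandTimes TTimes setTimes.
Proof. by split=> // *; [apply: expand_times | rewrite /= eqxx]. Qed.
Lemma opbin_div : opbin LDiv ExpandDiv TDiv setDiv.
Proof. by split=> // *; [apply: expand_div | rewrite /= eqxx]. Qed.

Lemma wp_gate_sound N K S : S rH = [::] -> wp N Gate K S ->
  exists g l l' r, [/\ S rW = enc_gate g ++ r, S rG = enc_goals l [::],
    reduces g l l' & K (upd (upd S rW r) rG (enc_goals l' [::]))].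
Proof.
move=> eH /wp_seq/wp_pop[r0 e0].
move/wp_seq/(wp_parse _ _ _ (isT : rN != rW))=> [n [r1 [_]]].
rewrite upd_eq => e1 /wp_seq/wp_pop[r2] e2; have {}e2 : r1 = TSep :: r2 := e2.
set S1 := upd _ rW r2.
have eN1 : S1 rN = blk (lsb n) (S rN) by [].
have eH1 : S1 rH = [::] by [].
have tail r l' : upd (upd (upd S1 rN (S rN)) rW r) rG (enc_goals l' [::]) =
    upd (upd S rW r) rG (enc_goals l' [::]) by rewrite /S1; upd_ext.
have bin t E lb f : opbin lb E t f -> wp N (GateBin t E) K S1 ->
    exists g l l' r, [/\ S rW = enc_gate g ++ r, S rG = enc_goals l [::],
    reduces g l l' & K (upd (upd S rW r) rG (enc_goals l' [::]))].
  case=> expE elb lbok semlb H.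
  have [p [q [l [l' [r [eW eG red HK]]]]]] := gatebin_sound expE lbok semlb eN1 eH1 H.
  exists (n, lb, [:: p; q]), l, l', r; rewrite -tail; split=> //.
  rewrite e0 e1 e2 -[r2]/(S1 rW) eW /enc_gate elb /=.
  by rewrite -!catA /= -!catA /= -!catA.
case/wp_alt=> [/(gatein_sound eN1 eH1)|].
  case=> a [l [l' [r [eW eG red HK]]]].
  exists (n, LIn a, [::]), l, l', r; rewrite -tail; split=> //.
  rewrite e0 e1 e2 -[r2]/(S1 rW) eW /enc_gate /=.
  by rewrite -!catA /= -!catA.
case/wp_alt=> [/(bin _ _ _ _ opbin_cup) //|].
case/wp_alt=> [/(bin _ _ _ _ opbin_cap) //|].
case/wp_alt=> [/(bin _ _ _ _ opbin_plus) //|].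
by case/wp_alt=> [/(bin _ _ _ _ opbin_times)|/(bin _ _ _ _ opbin_div)].
Qed.

Definition gate_small N (g : gate) : bool :=
  [&& size (bin (gname g)) <= N, all (fun p => size (bin p) <= N) (gpreds g) &
      (if glabel g is LIn a then size (bin a) <= N else true)].

Lemma size_lsbE n : size (lsb n) = size (bin n). Proof. exact: size_rev. Qed.

Lemma gatein_complete N n sn a l r rest (K : stacks -> Prop) S :
  S rN = blk (lsb n) sn -> S rH = [::] ->
  S rW = TIn :: binT a ++ [:: TSep, TClose & r] -> S rG = enc_goals l [::] ->
  all (small N) l -> 2 * size l <= N -> 0 < N -> gate_small N (n, LIn a, [::]) ->
  (forall x y, sem rest x y -> y < 2 ^ N) -> wf_gate (n, LIn a, [::]) rest ->
  (forall b, b \in l -> holds ((n, LIn a, [::]) :: rest) b) ->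
  (forall l', (forall b, b \in l' -> holds rest b) -> size l' <= 2 * size l + 3 ->
     all (small N) l' ->
     K (upd (upd (upd S rN sn) rW r) rG (enc_goals l' [::]))) ->
  wp N GateIn K S.
Proof.
move=> eN eH eW eG sl szl N0 /and3P[/= sn' _ sa] bd /and3P[_ _ /= nrest] hl H.
apply/wp_seq/wp_pop; exists (binT a ++ [:: TSep, TClose & r]) => //.
apply/wp_seq/(wp_parse _ _ _ (isT : rP != rW)); exists a, [:: TSep, TClose & r].
split=> //; first exact: leqW.
apply/wp_seq/wp_pop; exists (TClose :: r) => //.
apply/wp_seq/wp_pop; exists r => //; apply/wp_seq.
set S1 := upd _ rW r.
have regs : gate_regs (n, LIn a, [::]) sn (blk (lsb a) (S rP)) (S rQ) S1 by split.
have semg gs v : sem ((n, LIn a, [::]) :: gs) n v <-> v = a by rewrite /= eqxx.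
have := @wp_loop_complete _ _ _ _ _ _ _ (expand_in a (S rP) (S rQ)) semg N rest l _ S1 regs.
apply=> //; rewrite ?size_lsbE //.
move=> l' hl' sl' al'.
apply/wp_seq/wp_drop; exists (lsb a), (S rP); rewrite size_lsbE; split=> //.
apply/(wp_newgoal _ _ _ _ (isT : rN \in [:: rN; rP; rQ])).
exists (lsb n), sn; rewrite size_lsbE; split=> //.
have H' := H ((kNot, lsb n, [::]) :: l').
have : K (upd (upd (upd S rN sn) rW r) rG (enc_goals ((kNot, lsb n, [::]) :: l') [::])).
  apply: H'.
  - by apply/holds_cons; rewrite holds_not.
  - by rewrite /= -addn1 leq_add.
  - by rewrite /= al' /small /= size_lsbE sn'.
by congr K; rewrite /S1; upd_ext.
Qed.

Lemma gatebin_complete t E lb f N n sn p q l r rest (K : stacks -> Prop) S :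
  opbin lb E t f -> S rN = blk (lsb n) sn -> S rH = [::] ->
  S rW = [:: t, TSep & binT p ++ TSep :: binT q ++ [:: TSep, TClose & r]] ->
  S rG = enc_goals l [::] ->
  all (small N) l -> 2 * size l <= N -> 0 < N -> gate_small N (n, lb, [:: p; q]) ->
  (forall x y, sem rest x y -> y < 2 ^ N) -> wf_gate (n, lb, [:: p; q]) rest ->
  (forall b, b \in l -> holds ((n, lb, [:: p; q]) :: rest) b) ->
  (forall l', (forall b, b \in l' -> holds rest b) -> size l' <= 2 * size l + 3 ->
     all (small N) l' ->
     K (upd (upd (upd S rN sn) rW r) rG (enc_goals l' [::]))) ->
  wp N (GateBin t E) K S.
Proof.
case=> expE elb lbok semlb eN eH eW eG sl szl N0 /and3P[/= sn' /and3P[sp sq _] _] bd.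
case/and3P=> /= _ /and3P[hp hq _] nrest hl H.
apply/wp_seq/wp_pop; eexists; first exact: eW.
apply/wp_seq/wp_pop; exists (binT p ++ TSep :: binT q ++ [:: TSep, TClose & r]) => //.
apply/wp_seq/(wp_parse _ _ _ (isT : rP != rW)).
exists p, (TSep :: binT q ++ [:: TSep, TClose & r]).
split=> //; first exact: leqW.
apply/wp_seq/wp_pop; exists (binT q ++ [:: TSep, TClose & r]) => //.
apply/wp_seq/(wp_parse _ _ _ (isT : rQ != rW)); exists q, [:: TSep, TClose & r].
split=> //; first exact: leqW.
apply/wp_seq/wp_pop; exists (TClose :: r) => //.
apply/wp_seq/wp_pop; exists r => //; apply/wp_seq.
set S1 := upd _ rW r.
have regs : gate_regs (n, lb, [:: p; q]) sn (blk (lsb p) (S rP)) (blk (lsb q) (S rQ)) S1.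
  by split.
have := @wp_loop_complete _ _ _ _ _ _ _ (expE p q (S rP) (S rQ)) (semlb n p q) N rest l _ S1 regs.
apply=> //; rewrite ?size_lsbE //; first by rewrite /name_size !size_lsbE geq_max sp sq.
move=> l' hl' sl' al'.
apply/wp_seq/(wp_newgoal _ _ _ _ (isT : rP \in [:: rN; rP; rQ])).
exists (lsb p), (S rP); rewrite size_lsbE; split=> //.
apply/wp_seq/(wp_newgoal _ _ _ _ (isT : rQ \in [:: rN; rP; rQ])).
exists (lsb q), (S rQ); rewrite size_lsbE; split=> //.
apply/(wp_newgoal _ _ _ _ (isT : rN \in [:: rN; rP; rQ])).
exists (lsb n), sn; rewrite size_lsbE; split=> //.
set l2 := [:: (kNot, lsb n, [::]), (kNeed, lsb q, [::]), (kNeed, lsb p, [::]) & l'].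
have : K (upd (upd (upd S rN sn) rW r) rG (enc_goals l2 [::])).
  apply: H.
  - by do 3!(apply/holds_cons; split; rewrite ?holds_not ?holds_need //).
  - by rewrite /= addn3 !ltnS.
  - by rewrite /= al' /small /= !size_lsbE sn' sp sq.
by congr K; rewrite /S1; upd_ext.
Qed.

Lemma wp_gate_complete N g l r rest (K : stacks -> Prop) S :
  S rH = [::] -> S rW = enc_gate g ++ r -> S rG = enc_goals l [::] ->
  all (small N) l -> 2 * size l <= N -> 0 < N -> gate_small N g ->
  (forall x y, sem rest x y -> y < 2 ^ N) -> wf_gate g rest ->
  (forall b, b \in l -> holds (g :: rest) b) ->
  (forall l', (forall b, b \in l' -> holds rest b) -> size l' <= 2 * size l + 3 ->
     all (small N) l' -> K (upd (upd S rW r) rG (enc_goals l' [::]))) ->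
  wp N Gate K S.
Proof.
case: g => [[n lb] ps] eH eW eG sl szl N0 sg bd wf hl H.
have /and3P[/= sn' _ _] := sg.
have body : exists s, enc_gate (n, lb, ps) ++ r = TOpen :: binT n ++ TSep :: s.
  by rewrite /enc_gate /=; eexists; rewrite -!catA /=; reflexivity.
have [s es] := body; rewrite es in eW.
apply/wp_seq/wp_pop; eexists; first exact: eW.
apply/wp_seq/(wp_parse _ _ _ (isT : rN != rW)); exists n, (TSep :: s).
split=> //; first exact: leqW.
apply/wp_seq/wp_pop; exists s => //.
set S1 := upd _ rW s.
have eN1 : S1 rN = blk (lsb n) (S rN) by [].
have tail l' : upd (upd (upd S1 rN (S rN)) rW r) rG (enc_goals l' [::]) =
    upd (upd S rW r) rG (enc_goals l' [::]) by rewrite /S1; upd_ext.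
have {}H l' : (forall b, b \in l' -> holds rest b) -> size l' <= 2 * size l + 3 ->
     all (small N) l' -> K (upd (upd (upd S1 rN (S rN)) rW r) rG (enc_goals l' [::])).
  by rewrite tail; apply: H.
have bin p q t E f : ps = [:: p; q] -> opbin lb E t f -> wp N (GateBin t E) K S1.
  move=> eps ob; subst ps.
  apply: (gatebin_complete ob eN1 eH _ eG sl szl N0 sg bd wf hl H).
  have -> : S1 rW = s by [].
  case: ob => _ elb _ _; move: es; rewrite /enc_gate elb /= -!catA /=.
  by move=> [/eqP]; rewrite eqseq_cat // eqxx /= => /eqP[<-]; rewrite -catA /= -catA.
have /and3P[/= ok _ _] := wf.
have two lb' : label_ok ops lb' ps -> (if lb' is LIn _ then false else true) ->
    exists p q, ps = [:: p; q].
  by case: lb' => [a||||||] //; case: (ps) => [|p [|q []]] // _ _; exists p, q.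
apply/wp_alt; case: lb ok es sg wf hl bin {sn' body} => [a||||||] //= ok es sg wf hl bin.
- left; move/nilP: ok es sg wf hl {bin} => -> es sg wf hl.
  apply: (gatein_complete eN1 eH _ eG sl szl N0 sg bd wf hl H).
  have -> : S1 rW = s by [].
  move: es; rewrite /enc_gate /= -!catA /=.
  by move=> [/eqP]; rewrite eqseq_cat // eqxx /= => /eqP[<-]; rewrite -!catA.
- have [p [q eps]] := two LCup ok isT.
  by right; apply/wp_alt; left; apply: bin eps opbin_cup.
- have [p [q eps]] := two LCap ok isT.
  by right; apply/wp_alt; right; apply/wp_alt; left; apply: bin eps opbin_cap.
- have [p [q eps]] := two LPlus ok isT.
  by right; do 2!(apply/wp_alt; right); apply/wp_alt; left; apply: bin eps opbin_plus.
- have [p [q eps]] := two LTimes ok isT.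
  by right; do 3!(apply/wp_alt; right); apply/wp_alt; left; apply: bin eps opbin_times.
- have [p [q eps]] := two LDiv ok isT.
  by right; do 4!(apply/wp_alt; right); apply: bin eps opbin_div.
Qed.

(** * The verifier and its running time *)

(** [TDiv] is left out because it is the base case of the fold in [AnyToken]. *)
Definition all_tokens : seq token :=
  [:: T0; T1; TSep; TOpen; TClose; TEnd; TIn; TCompl; TCup; TCap; TPlus; TTimes].
Definition AnyToken (f : token -> prog) : prog :=
  foldr (fun t p => Alt (f t) p) (f TDiv) all_tokens.

Lemma wp_anytoken N f K S : wp N (AnyToken f) K S <-> exists t, wp N (f t) K S.
Proof.
split.
  rewrite /AnyToken; elim: all_tokens => [|t l IH]; first by exists TDiv.
  by case/wp_alt=> // H; exists t.
case=> t H; rewrite /AnyToken.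
have : t \in rcons all_tokens TDiv by case: t H.
elim: all_tokens => [|t' l IH] /=; first by rewrite inE => /eqP <-.
rewrite inE => /predU1P[<-|/IH tl]; apply/wp_alt; first by left.
by right.
Qed.

(** * Recovering the tokens from the input bits *)

Definition PopBits i (u : seq bool) (p : prog) : prog :=
  foldr (fun b p => pop i (tok b) ;; p) p u.

Lemma wp_popbits N i u p K S : wp N (PopBits i u p) K S <->
  exists2 r, S i = bits u ++ r & wp N p K (upd S i r).
Proof.
elim: u S => [|b u IH] S.
  split=> [H|[r /= <-]]; last by rewrite upd_id.
  by exists (S i); rewrite ?upd_id.
split.
  move/wp_seq/wp_pop=> [r e /IH[r' ]]; rewrite upd_eq upd_upd => e' H.
  by exists r'; rewrite // e e'.
case=> r e H; apply/wp_seq/wp_pop; exists (bits u ++ r) => //.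
by apply/IH; exists r; rewrite ?upd_eq ?upd_upd.
Qed.

(** The last input bit is on top, so each token is recognised backwards and the tokens arrive from
    last to first; on [rW] the first one ends on top. *)
Definition ReadToken : prog :=
  AnyToken (fun t => PopBits rI (rev (token_bits t)) (push rW t)).
Definition Tokenize : prog := Star ReadToken ;; isempty rI.

Lemma wp_readtokens N n K S : iter n (wp N ReadToken) K S <->
  exists ts r, [/\ size ts = n, S rI = bits (rev (to_bits ts)) ++ r &
                   K (upd (upd S rI r) rW (ts ++ S rW))].
Proof.
elim: n S => [|n IH] S.
  split=> [H|[[|t ts] [r []]] //= _ <-]; last by rewrite !upd_id.
  by exists [::], (S rI); split=> //; rewrite !upd_id.
have E ts t : bits (rev (to_bits (rcons ts t))) =
    bits (rev (token_bits t)) ++ bits (rev (to_bits ts)).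
  rewrite -cats1 /to_bits map_cat flatten_cat /= cats0 rev_cat.
  exact: map_cat.
rewrite iterS; split.
  case/wp_anytoken=> t /wp_popbits[r e /wp_push/IH[ts [r' [sz]]]].
  rewrite /upd /= => er H; exists (rcons ts t), r'; rewrite size_rcons sz E.
  split=> //; first by rewrite e er catA.
  by move: H; rewrite cat_rcons; congr K; upd_ext.
case=> ts; case/lastP: ts => [|ts t] [r []] //; rewrite size_rcons E => -[sz] e H.
apply/wp_anytoken; exists t; apply/wp_popbits; eexists.
  by rewrite e -catA; reflexivity.
apply/wp_push/IH; exists ts, r; split=> //; move: H; rewrite cat_rcons.
by congr K; upd_ext.
Qed.

Lemma bits_inj : injective bits. Proof. exact: inj_map tok_inj. Qed.

Lemma input_rI w : input_stacks w rI = bits (rev w).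
Proof. by rewrite /input_stacks /= /bits map_rev. Qed.

Definition tokens_at ts : stacks := fun i => if i == rW then ts else [::].

Lemma wp_tokenize N K w : wp N Tokenize K (input_stacks w) <->
  exists ts, [/\ size ts <= N, w = to_bits ts & K (tokens_at ts)].
Proof.
have E ts : upd (upd (input_stacks w) rI [::]) rW (ts ++ input_stacks w rW) =
    tokens_at ts.
  apply: functional_extensionality => i; rewrite /upd /tokens_at /= cats0.
  by case: eqP => // _; case: eqP => // i0; rewrite /input_stacks; case: eqP.
split.
  move/wp_seq/wp_star=> [n nN /wp_readtokens[ts [r [sz e /wp_empty[]]]]].
  move=> r0; have {}r0 : r = [::] := r0; rewrite r0 in e *; rewrite E => H.
  exists ts; rewrite sz; split=> //.
  move: e; rewrite cats0 -[LHS]/(input_stacks w rI) input_rI => /bits_inj/(congr1 rev).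
  by rewrite !revK.
case=> ts [sz e H]; apply/wp_seq/wp_star; exists (size ts) => //.
apply/wp_readtokens; exists ts, [::]; split=> //.
  by rewrite cats0 -e -input_rI.
by apply/wp_empty; split=> //; rewrite E.
Qed.

(** When no gate is left, the goals that hold are exactly those of kind [kNot]. *)
Definition DropNot := pop rG kNot ;; Drop rG ;; Drop rG.
Definition Final :=
  pop rW TEnd ;; Parse rD ;; Xfer rX rF ;; Eq ;; isempty rW ;;
  Star DropNot ;; isempty rG.

Lemma wp_final_sound N K S : wp N Final K S -> exists b v s l,
  [/\ S rW = TEnd :: binT b, S rX = blk v s, num v = b,
      S rG = enc_goals l [::] & forall a, a \in l -> holds [::] a].
Proof.
move/wp_seq/wp_pop=> [r0 e0].
move/wp_seq/(wp_parse _ _ _ (isT : rD != rW))=> [b [r1 [_]]]; rewrite upd_eq => e1.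
move/wp_seq/(wp_xfer _ _ _ (isT : uniq [:: rX; rF; rT]))=> [v [s [_ eX]]].
case/wp_seq/wp_eq_sound=> x [y [d [f []]]]; move: eX.
rewrite /upd /= => eX /blk_inj[<- <-] /blk_inj[<- <-] => e.
move/wp_seq/wp_empty=> [] /= r1E; rewrite r1E cats0 in e1.
move/wp_seq/wp_star=> [n _].
set S1 := (fun j => _); have -> : S rG = S1 rG by [].
move=> H; exists b, v, s.
suff [l eG hl] : exists2 l, S1 rG = enc_goals l [::] & forall a, a \in l -> holds [::] a.
  by exists l; split=> //; [rewrite e0 e1 | rewrite -e num_lsb].
move: (S1) H => {S1 S eX e0} S; elim: n S => [|n IH] S.
  by move=> H; case: (iffLR (wp_empty N rG K S) H) => e' _; exists [::].
rewrite iterS => /wp_seq/wp_pop[r2 e2] /wp_seq/wp_drop[u [r3 [_]]].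
rewrite upd_eq => e3 /wp_drop[v' [r4 [_]]]; rewrite upd_eq => e4 /IH[l].
rewrite upd_eq => e5 hl; exists ((kNot, u, v') :: l).
  by rewrite e2 e3 e4 e5.
by apply/holds_cons; split.
Qed.

Lemma wp_final_complete N b s l S :
  S rW = TEnd :: binT b -> S rX = blk (lsb b) s -> size (bin b) <= N ->
  S rG = enc_goals l [::] -> size l <= N -> all (small N) l ->
  (forall a, a \in l -> holds [::] a) -> wp N Final (fun _ => True) S.
Proof.
move=> eW eX sb eG sl al hl.
apply/wp_seq/wp_pop; eexists; first exact: eW.
apply/wp_seq/(wp_parse _ _ _ (isT : rD != rW)); exists b, [::].
split; [exact: leqW | by rewrite cats0 |].
apply/wp_seq/(wp_xfer _ _ _ (isT : uniq [:: rX; rF; rT])); exists (lsb b), s.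
rewrite size_lsbE; split=> //.
apply/wp_seq/(@wp_eq_complete N (lsb b) (lsb b) (S rD) (S rF)); rewrite ?size_lsbE //.
apply/wp_seq/wp_empty; split=> //; apply/wp_seq/wp_star; exists (size l) => //.
set S1 := upd _ rF _; have {eG} : S1 rG = enc_goals l [::] by [].
move: (S1) => {S1 S eX eW} S; elim: l S sl al hl => [|[[k u] v] l IH] S sl.
  by move=> _ _ eG; apply/wp_empty.
case/andP=> /andP[/= su sv] al /holds_cons[hk hl] eG.
have ek : k = kNot by move: hk; rewrite /holds /=; case: (k).
apply/wp_seq/wp_pop; eexists; first by rewrite eG ek.
apply/wp_seq/wp_drop; eexists; eexists; split; [exact: su | by rewrite upd_eq |].
apply/wp_drop; eexists; eexists; split; [exact: sv | by rewrite upd_eq |].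
by apply: IH => //; apply: ltnW.
Qed.

(** The gate list is rebuilt from its end: once the later gates [gs] are known, [reduces] is
    instantiated with them and yields both the earlier goals and the well-formedness of [g]. *)
Lemma gates_sound N n K S : S rH = [::] ->
  iter n (wp N Gate) (wp N Final K) S -> exists gs b v s l,
  [/\ S rW = flatten (map enc_gate gs) ++ TEnd :: binT b,
      S rX = blk v s /\ num v = b,
      S rG = enc_goals l [::], wf_gates ops gs &
      forall a, a \in l -> holds gs a].
Proof.
elim: n S => [|n IH] S eH.
  by case/wp_final_sound=> b [v [s [l [? ? ? ? ?]]]]; exists [::], b, v, s, l.
rewrite iterS => /(wp_gate_sound eH)[g [l [l' [r [eW eG red]]]]].
case/IH=> // gs [b [v [s [l2 []]]]]; rewrite /upd /= => er eX el wf hl.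
have l12 := enc_goals_inj el.
rewrite -l12 in hl; have [hl' wfg] := red gs hl.
exists (g :: gs), b, v, s, l; split=> //; first by rewrite eW er /= catA.
by rewrite -[wf_gates _ _]/(wf_gates ops (g :: gs)) wf_gates_cons wfg wf.
Qed.

(** The initial goal is laid out on [rG] from the bottom, guessed value, name, kind; the second copy
    of the guess waits on [rX] for [Final]. *)
Definition Main :=
  Tokenize ;; Parse rA ;; pop rW TSep ;; Guess rG rX ;; Xfer rA rG ;;
  push rG kVal ;; Star Gate ;; Final.

Lemma main_ok : prog_ok Main. Proof. by []. Qed.

(** A value demanded of the output gate already proves that this gate occurs in the list. *)
Lemma sem_name gs x v : sem gs x v -> x \in map gname gs.
Proof.
by elim: gs => //= g gs IH; rewrite inE eq_sym; case: eqP => //= _ /IH.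
Qed.

Lemma main_sound N w : wp N Main (fun _ => True) (input_stacks w) -> MC ops w.
Proof.
move/wp_seq/wp_tokenize=> [ts [_ ew]].
move/wp_seq/(wp_parse _ _ _ (isT : rA != rW))=> [c [r1 [_ e1]]].
move/wp_seq/wp_pop=> [r2 e2]; have {}e2 : r1 = TSep :: r2 := e2.
move/wp_seq/(wp_guess _ _ _ (isT : rG != rX))=> [u _].
move/wp_seq/(wp_xfer _ _ _ (isT : uniq [:: rA; rG; rT]))=> [x [s [_]]].
move=> /= /blk_inj[<- _] /wp_seq/wp_push/wp_seq/wp_star[n _ /gates_sound].
case=> // gs [b [v [s' [l []]]]]; rewrite /upd /= => er2 [/blk_inj[<- _] ub] el wf hl.
have {}el : enc_goals [:: (kVal, lsb c, u)] [::] = enc_goals l [::] := el.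
case: l el hl => [|a l] //= /enc_goal_inj[<- _] /holds_cons[].
rewrite /holds /= num_lsb ub => hs _.
exists (c, gs), b; split; last split.
- by rewrite ew -[ts]/(tokens_at ts rW) e1 e2 er2 /enc_instance /enc_circuit /= -!catA.
- by rewrite /is_circuit /= wf (sem_name hs).
- by [].
Qed.

(* Without complement every result set is finite: a gate squares the bound at
   most, and an exact quotient does not exceed the dividend. *)
Lemma sem_bound L gs x v : 0 < L -> wf_gates ops gs -> all (gate_small L) gs ->
  sem gs x v -> v < 2 ^ (L * 2 ^ size gs).
Proof.
move=> L0; elim: gs x v => //= -[[n lb] ps] gs IH x v.
case/and4P=> /= ok _ _ wf /andP[/and3P[/= _ _ sa] al].
have {}IH y w : sem gs y w -> w < 2 ^ (L * 2 ^ size gs) by apply: IH.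
have leB : 2 ^ (L * 2 ^ size gs) <= 2 ^ (L * 2 ^ (size gs).+1).
  by rewrite leq_exp2l // leq_mul2l leq_exp2l // leqnSn orbT.
have eqB : 2 ^ (L * 2 ^ (size gs).+1) = 2 ^ (L * 2 ^ size gs) * 2 ^ (L * 2 ^ size gs).
  by rewrite expnS mulnCA mul2n -addnn expnD.
have B2 : 1 < 2 ^ (L * 2 ^ size gs).
  by rewrite -{1}(expn0 2) ltn_exp2l // muln_gt0 L0 expn_gt0.
have IH' y w : sem gs y w -> w < 2 ^ (L * 2 ^ (size gs).+1).
  by move/IH => h; apply: leq_trans leB.
(* With [B] the bound for the later gates, the bound to prove is [B * B]; a sum stays below it
   because [B] is at least 2. *)
rewrite eqB in IH' *; move: B2 IH IH' {leB eqB}; set B := 2 ^ (L * 2 ^ size gs).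
move=> B2 IH IH'.
case: eqP => _; last exact: IH'.
case: lb ok sa => [a||||||] //=; case: ps => [|p [|q []]] //.
- move=> _ sa ->; have h := num_bound (lsb a); rewrite num_lsb size_lsbE in h.
  apply: leq_trans h _; apply: (@leq_trans B).
    by rewrite leq_exp2l //; apply: leq_trans sa _; rewrite leq_pmulr // expn_gt0.
  by rewrite leq_pmulr // ltnW.
- by move=> _ _ [] /IH'.
- by move=> _ _ [/IH'].
- move=> _ _ [a [b [/IH ha [/IH hb ->]]]].
  by apply: (@leq_trans (2 * B)); [lia | rewrite leq_mul2r B2 orbT].
- move=> _ _ [a [b [/IH ha [/IH hb ->]]]].
  exact: ltn_mul.
- move=> _ _ [a [b [/IH' ha [_ [b0 ea]]]]]; apply: leq_ltn_trans ha.
  by rewrite ea leq_pmulr // lt0n; apply/eqP.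
Qed.

(** The measure is [size l + 3]: a gate turns [k] goals into at most [2 * k + 3], and
    [2 * k + 3 + 3] is [2 * (k + 3)], so this quantity at most doubles per gate. *)
Lemma gates_complete N L gs b s l S : 0 < N -> 0 < L ->
  S rH = [::] -> S rW = flatten (map enc_gate gs) ++ TEnd :: binT b ->
  S rX = blk (lsb b) s -> size (bin b) <= N -> S rG = enc_goals l [::] ->
  all (small N) l -> wf_gates ops gs -> all (gate_small L) gs ->
  L * 2 ^ size gs <= N -> (size l + 3) * 2 ^ (size gs).+1 <= N ->
  (forall a, a \in l -> holds gs a) ->
  iter (size gs) (wp N Gate) (wp N Final (fun _ => True)) S.
Proof.
move=> N0 L0; elim: gs l S => [|g gs IH] l S eH eW eX sb eG al.
  move=> _ _ _ szl hl; apply: wp_final_complete eW eX sb eG _ al hl.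
  by move: szl; rewrite expn1; lia.
rewrite wf_gates_cons => /andP[wfg wf] /andP[sg sgs] LN szl hl.
have LN' : L * 2 ^ size gs <= N.
  by apply: leq_trans LN; rewrite leq_mul2l leq_exp2l // leqnSn orbT.
have leLN : L <= N by apply: leq_trans LN; rewrite leq_pmulr // expn_gt0.
have sgN : gate_small N g.
  case/and3P: sg => s1 s2 s3; apply/and3P; split; first exact: leq_trans leLN.
    by apply: sub_all s2 => p h; apply: leq_trans leLN.
  by case: (glabel g) s3 => // a h; apply: leq_trans leLN.
have bd x y : sem gs x y -> y < 2 ^ N.
  move/(sem_bound L0 wf sgs) => h; apply: leq_trans h _.
  by rewrite leq_exp2l.
have szl' : 2 * (size l + 3) * 2 ^ (size gs).+1 <= N.
  by move: szl; rewrite [2 ^ _.+2]expnS mulnA [_ * 2]mulnC.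
rewrite iterS; apply: (wp_gate_complete eH _ eG al _ N0 sgN bd wfg hl).
- by rewrite eW /= -catA.
- apply: leq_trans szl'; apply: (@leq_trans (2 * (size l + 3))); first by lia.
  by rewrite leq_pmulr // expn_gt0.
move=> l' hl' sl' al'; apply: (IH l') => //.
apply: leq_trans szl'; rewrite leq_mul2r; apply/orP; right.
by rewrite mulnDr -[2 * 3]/(3 + 3) addnA leq_add2r.
Qed.

(** * Sizes and time in terms of the input length *)

Local Arguments enc_gate : simpl never.

Lemma size_to_bits ts : size (to_bits ts) = 4 * size ts.
Proof.
elim: ts => //= t ts IH; rewrite /to_bits /= size_cat -/(to_bits ts) IH mulnS.
by case: t.
Qed.

Lemma gate_small_enc N g : label_ok ops (glabel g) (gpreds g) ->
  size (enc_gate g) <= N -> gate_small N g.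
Proof.
case: g => [[n lb] ps] /= ok; rewrite /enc_gate; do 4!rewrite ?size_cat ?size_map /=.
move=> h.
have hp : all (fun p => size (bin p) <= N) ps.
  have : size (flatten [seq binT p ++ [:: TSep] | p <- ps]) <= N by lia.
  elim: ps {ok h} => //= p ps IH; rewrite !size_cat size_map => h.
  by rewrite IH ?andbT; lia.
apply/and3P; split=> //=; first by lia.
by case: lb {ok} h => //= a; rewrite size_map; lia.
Qed.

Lemma gates_small N gs : wf_gates ops gs ->
  size (flatten (map enc_gate gs)) <= N ->
  all (gate_small N) gs && (size gs <= N).
Proof.
move=> wf h.
have sg : size gs <= size (flatten (map enc_gate gs)).
  elim: gs {wf h} => //= g gs IH.
  by rewrite size_cat; exact: (@leq_add 1 (size gs) (size (enc_gate g)) _ isT IH).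
rewrite (leq_trans sg h) andbT {sg}; elim: gs wf h => // g gs IH.
rewrite wf_gates_cons => /andP[/and3P[ok _ _] wf].
rewrite -[flatten _]/(enc_gate g ++ flatten (map enc_gate gs)) size_cat => h.
rewrite /= (IH wf) ?gate_small_enc //.
- exact: leq_trans (leq_addr _ _) h.
- exact: leq_trans (leq_addl _ _) h.
Qed.

(** The exponent meets both demands of [gates_complete]: [n * 2 ^ n] is at most [2 ^ (2 * n)] for
    the length of values, and a list starting with one goal needs at most
    [(1 + 3) * 2 ^ (n + 1) = 2 ^ (n + 3)]. *)
Definition iterations n := 2 ^ (2 * n + 3).

Lemma main_complete w : MC ops w ->
  0 < size w /\ wp (iterations (size w)) Main (fun _ => True) (input_stacks w).
Proof.
case=> -[c gs] [b [ew [/andP[/= wf _] hs]]]; rewrite /circuit_sem /= in hs.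
have := congr1 size ew; rewrite size_to_bits /enc_instance /enc_circuit /=.
do 3!rewrite ?size_cat ?size_map /=.
move=> sw.
set n := size w in sw *; have n0 : 0 < n by lia.
split=> //; set N := iterations n.
have nN : n <= N.
  apply: (@leq_trans (2 ^ n)); first exact: ltnW (ltn_expl _ _).
  by rewrite leq_exp2l //; lia.
have N0 : 0 < N by apply: leq_trans nN.
have /andP[sgs szg] : all (gate_small n) gs && (size gs <= n).
  by apply: gates_small wf _; lia.
have nb : n * 2 ^ size gs <= N.
  apply: (@leq_trans (2 ^ n * 2 ^ n)); last by rewrite -expnD leq_exp2l //; lia.
  by apply: leq_mul; [exact: ltnW (ltn_expl _ _) | rewrite leq_exp2l].
have sb : size (lsb b) <= N.
  apply: small_sem hs => // x y /(sem_bound n0 wf sgs) h; apply: leq_trans h _.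
  by rewrite leq_exp2l.
apply/wp_seq/wp_tokenize; exists (enc_instance (c, gs) b); split=> //.
  apply: leq_trans nN; rewrite /n {1}ew size_to_bits; lia.
apply/wp_seq/(wp_parse _ _ _ (isT : rA != rW)).
exists c, (TSep :: flatten (map enc_gate gs) ++ TEnd :: binT b).
split; [by lia | by rewrite /tokens_at /= /enc_instance /enc_circuit /= -!catA |].
apply/wp_seq/wp_pop; exists (flatten (map enc_gate gs) ++ TEnd :: binT b) => //.
apply/wp_seq/(wp_guess _ _ _ (isT : rG != rX)); exists (lsb b) => //.
apply/wp_seq/(wp_xfer _ _ _ (isT : uniq [:: rA; rG; rT])).
exists (lsb c), [::]; split=> //; first by rewrite size_lsbE; lia.
apply/wp_seq/wp_push/wp_seq/wp_star; exists (size gs); first by lia.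
apply: (@gates_complete N n gs b [::] [:: (kVal, lsb c, lsb b)]) => //.
- by rewrite -size_lsbE.
- by rewrite /= /small /= sb andbT size_lsbE; lia.
- rewrite -[_ + 3]/(2 ^ 2) -expnD leq_exp2l //; lia.
- by apply: holds_val1; rewrite !num_lsb.
Qed.

Lemma accepts_mono M w t t' : t <= t' -> accepts_within M w t -> accepts_within M w t'.
Proof.
by move=> tt' [cs /and3P[sz p a]]; exists cs; rewrite (leq_trans sz tt') p a.
Qed.

(** The time is 2 to an exponent linear in [n], namely at most [n.+1 * (8 * z + 7)]. As [n.+1] is at
    least 2, the factor [8 * z + 7] is below [n.+1 ^ (8 * z + 7)], which turns the constant factor
    into a power. *)
Lemma time_bound n (c z : nat) : 0 < n -> c <= (iterations n).+2 ^ z ->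
  c * (n + c + 3) + 3 <= 2 ^ (n.+1 ^ (8 * z + 8)).
Proof.
move=> n0 hc.
have hN : (iterations n).+2 <= 2 ^ (2 * n + 4).
  have : 1 < iterations n by rewrite -{1}(expn0 2) ltn_exp2l // addn3.
  by rewrite addnS expnS -/(iterations n); lia.
have {hc hN} : c <= 2 ^ ((2 * n + 4) * z).
  apply: leq_trans hc _; rewrite expnM; case: z => [|z] //.
  by rewrite leq_exp2r.
set D := 2 ^ _ => hc.
have D0 : 0 < D by rewrite expn_gt0.
have n3 : n + 3 <= 2 ^ (n + 2).
  elim: n {n0 D D0 hc} => // n IH; rewrite !addSn expnS; lia.
have step1 : c * (n + c + 3) + 3 <= D * D * 2 ^ (n + 2) * 4.
  have h1 : n + c + 3 <= D * 2 ^ (n + 2) * 2.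
    have a1 : D <= D * 2 ^ (n + 2) by rewrite leq_pmulr // expn_gt0.
    have a2 : 2 ^ (n + 2) <= D * 2 ^ (n + 2) by rewrite leq_pmull.
    by lia.
  have h2 : c * (n + c + 3) <= D * (D * 2 ^ (n + 2) * 2) by apply: leq_mul.
  have h3 : 4 <= D * D * 2 ^ (n + 2).
    apply: (@leq_trans (2 ^ (n + 2))); first by lia.
    by rewrite leq_pmull // muln_gt0 D0.
  by move: h2; rewrite !mulnA; lia.
apply: leq_trans step1 _; rewrite -[4]/(2 ^ 2) -!expnD leq_exp2l //.
apply: (@leq_trans (n.+1 * (8 * z + 7))); first by nia.
rewrite [8 * z + 8]addnS expnS leq_mul2l /=.
apply: (@leq_trans (2 ^ (8 * z + 7))); first exact: ltnW (ltn_expl _ _).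
by rewrite leq_exp2r // addnS.
Qed.

Theorem theorem3 : in_NEXP (MC O_cup_cap_plus_times_div).
Proof.
exists (ntm Main), (8 * psize Main + 8) => w; split.
  case/main_complete=> w0 H; apply: accepts_mono (ntm_complete main_ok H).
  exact: time_bound w0 (cost_bound _ _).
by case/(ntm_sound main_ok)=> N; apply: main_sound.
Qed.
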